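(* Let $F:\mathbb{C}\to\mathbb{C}$ be an entire function, $F\not\equiv 0$, let $a\in\mathbb{C}$ be a center of $\dot{x}=F(x)$, and let $\mathcal{V}$ be the center basin (period annulus) of $F$ in $a$. Then $\mathcal{V}$ is connected, path-connected and simply connected.
   Context: Consider the autonomous planar system $\dot{x}=F(x)$, $x\in\mathbb{C}$, $t\in\mathbb{R}$; $\Gamma(x)$ denotes the (full) orbit through $x$ on the maximal interval of existence. For a closed Jordan curve $\Gamma$, $\operatorname{Int}(\Gamma)$ denotes the bounded component of $\mathbb{C}\setminus\Gamma$. Equilibria are the zeros of $F$. A center is a simple zero $a$ of $F$ having a neighborhood in which all orbits other than $\{a\}$ are closed periodic orbits surrounding $a$. The center basin (period annulus) of $a$ is $\mathcal{V}:=\{a\}\cup\{x\in\mathbb{C}:\Gamma(x)\text{ is a (nonconstant) periodic orbit with }a\in\operatorname{Int}(\Gamma(x))\}$. *)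

(* Defs.v *)
(* Stdlib reals with Coquelicot; the plane is Coquelicot's C. *)
From Stdlib Require Import Reals.
From Coquelicot Require Import Coquelicot.
Local Open Scope R_scope.

(** ** Topology *)

Definition connected {T : UniformSpace} (S : T -> Prop) : Prop :=
  forall U V : T -> Prop,
    open U -> open V ->
    (forall z, S z -> U z \/ V z) ->
    (exists z, S z /\ U z) ->
    (exists z, S z /\ V z) ->
    exists z, S z /\ U z /\ V z.

Definition component {T : UniformSpace} (S : T -> Prop) (x y : T) : Prop :=
  exists K : T -> Prop, connected K /\ (forall z, K z -> S z) /\ K x /\ K y.

Definition unit_interval (t : R) : Prop := 0 <= t <= 1.

(* Only the restriction of g to [0,1] matters. *)
Definition is_path_in {T : UniformSpace} (S : T -> Prop) (g : R -> T) : Prop :=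
  continuous_on unit_interval g /\ forall t, unit_interval t -> S (g t).

Definition path_connected {T : UniformSpace} (S : T -> Prop) : Prop :=
  forall x y, S x -> S y ->
    exists g : R -> T, is_path_in S g /\ g 0 = x /\ g 1 = y.

(* H (t, s) is the point of the s-th loop at parameter t; the homotopy stays in
   S and fixes the base point. *)
Definition null_homotopic_in {T : UniformSpace}
    (S : T -> Prop) (g : R -> T) : Prop :=
  exists H : R * R -> T,
    continuous_on
      (fun p : R * R => unit_interval (fst p) /\ unit_interval (snd p)) H /\
    (forall t s, unit_interval t -> unit_interval s -> S (H (t, s))) /\
    (forall t, unit_interval t -> H (t, 0) = g t) /\
    (forall t, unit_interval t -> H (t, 1) = g 0) /\
    (forall s, unit_interval s -> H (0, s) = g 0 /\ H (1, s) = g 0).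

Definition simply_connected {T : UniformSpace} (S : T -> Prop) : Prop :=
  path_connected S /\
  forall g : R -> T, is_path_in S g -> g 0 = g 1 -> null_homotopic_in S g.

Definition bounded_in_C (S : C -> Prop) : Prop :=
  exists M : R, forall z, S z -> Cmod z <= M.

(* The points whose component in the complement of G is bounded. For a closed
   Jordan curve G there is, by the Jordan curve theorem, exactly one bounded
   component, so this is that component. *)
Definition Int (G : C -> Prop) (z : C) : Prop :=
  ~ G z /\ bounded_in_C (component (fun w => ~ G w) z).

(** ** The differential equation x' = F(x) *)

Definition entire (F : C -> C) : Prop :=
  forall z : C, ex_derive (K := C_AbsRing) (V := C_NormedModule) F z.

Definition is_solution (F : C -> C) (alpha beta : Rbar) (u : R -> C) : Prop :=
  forall t : R, Rbar_lt alpha t -> Rbar_lt t beta ->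
    is_derive (K := R_AbsRing) (V := C_R_NormedModule) u t (F (u t)).

(* u is a solution on ]alpha, beta[ with u(0) = x that has no extension to a
   strictly larger open interval. *)
Definition is_maximal_solution
    (F : C -> C) (x : C) (alpha beta : Rbar) (u : R -> C) : Prop :=
  Rbar_lt alpha 0 /\ Rbar_lt 0 beta /\ u 0 = x /\
  is_solution F alpha beta u /\
  forall (alpha' beta' : Rbar) (v : R -> C),
    Rbar_le alpha' alpha -> Rbar_le beta beta' ->
    is_solution F alpha' beta' v ->
    (forall t : R, Rbar_lt alpha t -> Rbar_lt t beta -> v t = u t) ->
    alpha' = alpha /\ beta' = beta.

Definition orbit (F : C -> C) (x y : C) : Prop :=
  exists (alpha beta : Rbar) (u : R -> C) (t : R),
    is_maximal_solution F x alpha beta u /\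
    Rbar_lt alpha t /\ Rbar_lt t beta /\ u t = y.

Definition is_periodic_orbit (F : C -> C) (G : C -> Prop) : Prop :=
  exists (u : R -> C) (T : R),
    is_solution F m_infty p_infty u /\
    0 < T /\ (forall t, u (t + T) = u t) /\
    (exists t, u t <> u 0) /\
    forall y, G y <-> exists t, u t = y.

Definition is_simple_zero (F : C -> C) (a : C) : Prop :=
  F a = RtoC 0 /\
  exists l : C,
    is_derive (K := C_AbsRing) (V := C_NormedModule) F a l /\ l <> RtoC 0.

Definition is_center (F : C -> C) (a : C) : Prop :=
  is_simple_zero F a /\
  locally a (fun x : C => x <> a ->
    is_periodic_orbit F (orbit F x) /\ Int (orbit F x) a).

Definition center_basin (F : C -> C) (a x : C) : Prop :=
  x = a \/ (is_periodic_orbit F (orbit F x) /\ Int (orbit F x) a).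

(* Main.v *)
(* Since F is holomorphic, x' = F(x) can be solved in complex time, and the flows
   of F and of i F commute. As a is a center, F'(a) = i l with l real and nonzero;
   say l > 0, so that a attracts the flow of i F. Let G be a periodic orbit, K the
   component of a in its complement, and U the complex-time solution equal to G on
   the real axis. On one side of the axis, say above, U enters K. It stays there:
   if two horizontal lines had a common image point, the closed strip between them
   would have a compact open image. As K is bounded, U then extends to the upper
   half-plane. The closure of the image of Im z > s, minus the image of Im z = s,
   is open; at a zero w of F this holds because F'(w) <> 0, w being a limit of
   orbits of one fixed period. Hence this closure contains every connected set that
   meets it and avoids the image of Im z = s. It follows that a is a limit of U at
   i oo, that the image of each line Im z = s is an orbit in the basin, and that the
   flow of i F moves each basin point inside the basin to a (were a repelling for
   it, U could not approach a from the real axis). By stability of a this is a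
   deformation retraction of the basin onto a. The argument uses no version of the
   Jordan curve theorem. Second-order Taylor bounds for F, needed for the flow, come
   from Goursat's lemma and Cauchy's formula on a square. *)

Require Import Defs.
From Stdlib Require Import ZArith Reals Lra Lia ClassicalEpsilon Classical FunctionalExtensionality.
From Coquelicot Require Import Coquelicot.
Local Open Scope R_scope.
Local Open Scope C_scope.

(** [entire] gives a derivative at each point and nothing about its continuity, yet differentiating
    a solution in complex time takes Lipschitz and quadratic Taylor bounds that are uniform on
    discs. The Cauchy integral that supplies them is normalized by the integral of 1 / (z - y) over
    a square, which is only bounded below and never evaluated. Compactness always comes from
    periodicity: a closed horizontal strip has the same image as a rectangle whose width is the
    period. So images of strips are closed, and they stay away from the zeros of F. The half-plane
    is reached in steps of fixed height, because the width of the strip to which a bounded solution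
    extends depends on the bound alone, and the component of a provides the same bound at every
    height. Of F'(a) only the sign of the imaginary part enters: the linear part of i F at a has
    real part - Im F'(a). If Im F'(a) < 0, then F is replaced by - F, which reverses every orbit and
    keeps the basin. *)

Lemma Rlt_Rmin (x a b : R) : (x < Rmin a b)%R -> x < a /\ x < b.
Proof. pose proof (Rmin_l a b). pose proof (Rmin_r a b). lra. Qed.

Ltac ceq := apply injective_projections; simpl; try ring; try field; try lra.

(** * Inequalities for the modulus *)

Lemma Cmod_diag (x : C) : Cmod (x - x) = 0%R.
Proof. replace (x - x) with (RtoC 0) by ring. apply Cmod_0. Qed.

Lemma Cmod_minus_sym (x y : C) : Cmod (x - y) = Cmod (y - x).
Proof. rewrite <- Cmod_opp. f_equal. ring. Qed.

Lemma Cmod_sub_triangle (x y z : C) : Cmod (x - z) <= Cmod (x - y) + Cmod (y - z).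
Proof. replace (x - z) with ((x - y) + (y - z)) by ring. apply Cmod_triangle. Qed.

Lemma Cmod_le_sub (x y : C) : Cmod x <= Cmod y + Cmod (x - y).
Proof. replace x with (y + (x - y)) at 1 by ring. apply Cmod_triangle. Qed.

Lemma Cmod_fst (x : C) : Rabs (fst x) <= Cmod x.
Proof. apply re_le_Cmod. Qed.

Lemma Cmod_snd (x : C) : Rabs (snd x) <= Cmod x.
Proof. eapply Rle_trans; [|apply Rmax_Cmod]. apply Rmax_r. Qed.

Lemma Cmod_sqr (x : C) : (Cmod x * Cmod x = fst x * fst x + snd x * snd x)%R.
Proof. replace (Cmod x * Cmod x)%R with (Cmod x ^ 2)%R by ring.
  rewrite Cmod2_alt. unfold Re, Im. ring. Qed.

Lemma Cmod_le_parts (x : C) : Cmod x <= Rabs (fst x) + Rabs (snd x).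
Proof.
  pose proof (Cmod_ge_0 x). pose proof (Rabs_pos (fst x)). pose proof (Rabs_pos (snd x)).
  apply Rsqr_incr_0_var; [|lra]. unfold Rsqr. rewrite Cmod_sqr.
  pose proof (Rsqr_abs (fst x)). pose proof (Rsqr_abs (snd x)). unfold Rsqr in *. nra.
Qed.

Lemma Cmod_real_scal (t : R) (z : C) : 0 <= t -> Cmod (RtoC t * z) = (t * Cmod z)%R.
Proof. intros H. rewrite Cmod_mult, Cmod_R, Rabs_pos_eq; auto. Qed.

Lemma Cmod_zero_eq (x y : C) : Cmod (x - y) = 0%R -> x = y.
Proof. intros H. apply Cmod_eq_0 in H. replace x with ((x - y) + y) by ring. rewrite H. ring. Qed.

Lemma Cmod_pos_neq (x y : C) : x <> y -> 0 < Cmod (x - y).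
Proof. intros H. destruct (Rle_lt_or_eq_dec 0 (Cmod (x - y)) (Cmod_ge_0 _)); auto.
  exfalso; apply H, Cmod_zero_eq; auto. Qed.

Lemma Csub_neq_0 (x y : C) : x <> y -> x - y <> 0.
Proof. intros H E. apply H. replace x with ((x - y) + y) by ring. rewrite E. ring. Qed.

Lemma Cmod_segment (w p q : C) (r t : R) : Cmod (p - w) < r -> Cmod (q - w) < r -> 0 <= t <= 1 ->
  Cmod (p + RtoC t * (q - p) - w) < r.
Proof.
  intros Hp Hq Ht. replace (p + RtoC t * (q - p) - w) with (RtoC (1 - t) * (p - w) + RtoC t * (q - w)) by ceq.
  eapply Rle_lt_trans; [apply Cmod_triangle|]. rewrite !Cmod_real_scal by lra.
  destruct (Rle_dec (Cmod (p - w)) (Cmod (q - w))); nra.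
Qed.

(** * Continuity and derivatives in the epsilon-delta form *)

(** The balls of the uniform space C are squares; these forms use the Euclidean modulus, which is
    multiplicative. *)
Definition ccont (g : C -> C) (z : C) : Prop :=
  forall eps, 0 < eps -> exists d, 0 < d /\
    forall w, Cmod (w - z) < d -> Cmod (g w - g z) < eps.

Definition rcont (u : R -> C) (t : R) : Prop :=
  forall eps, 0 < eps -> exists d, 0 < d /\
    forall s, Rabs (s - t) < d -> Cmod (u s - u t) < eps.

Definition cderiv (g : C -> C) (z l : C) : Prop :=
  forall eps, 0 < eps -> exists d, 0 < d /\
    forall w, Cmod (w - z) < d -> Cmod (g w - g z - l * (w - z)) <= eps * Cmod (w - z).

(** By components, so that real calculus applies directly; [rderiv_eps] gives the form with the
    modulus. *)
Definition rderiv (u : R -> C) (t : R) (v : C) : Prop :=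
  is_derive (fun s => fst (u s)) t (fst v) /\ is_derive (fun s => snd (u s)) t (snd v).

Lemma is_derive_eps (f : R -> R) (t l : R) :
  is_derive f t l <->
  (forall eps, 0 < eps -> exists d, 0 < d /\
    forall s, Rabs (s - t) < d -> Rabs (f s - f t - l * (s - t)) <= eps * Rabs (s - t))%R.
Proof.
  split.
  - intros [_ H] eps He. specialize (H t (fun P HP => HP) (mkposreal eps He)).
    destruct H as [d Hd]. exists d. split; [apply cond_pos|].
    intros s Hs. specialize (Hd s Hs). simpl in Hd.
    unfold norm, minus, plus, opp, scal in Hd; simpl in Hd. unfold abs, mult in Hd; simpl in Hd.
    replace (f s - f t - l * (s - t))%R with (f s + - f t + - ((s + - t) * l))%R by ring. exact Hd.
  - intros H. split; [apply is_linear_scal_l|].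
    intros x Hx. apply (is_filter_lim_locally_unique (V := AbsRing_NormedModule R_AbsRing)) in Hx. subst x.
    intros eps. destruct (H eps (cond_pos eps)) as [d [Hd0 Hd]].
    exists (mkposreal d Hd0). intros s Hs. specialize (Hd s Hs).
    unfold norm, minus, plus, opp, scal; simpl. unfold abs, mult; simpl.
    replace (f s + - f t + - ((s + - t) * l))%R with (f s - f t - l * (s - t))%R by ring. exact Hd.
Qed.

Lemma rderiv_eps (u : R -> C) (t : R) (v : C) :
  rderiv u t v <->
  (forall eps, 0 < eps -> exists d, 0 < d /\
    forall s, Rabs (s - t) < d ->
      (Cmod (u s - u t - v * RtoC (s - t)) <= eps * Rabs (s - t))).
Proof.
  unfold rderiv. rewrite !is_derive_eps. split.
  - intros [H1 H2] eps He.
    destruct (H1 (eps / 2)%R) as [d1 [Hd1 K1]]; [lra|].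
    destruct (H2 (eps / 2)%R) as [d2 [Hd2 K2]]; [lra|].
    exists (Rmin d1 d2). split; [apply Rmin_pos; auto|]. intros s Hs.
    specialize (K1 s (proj1 (Rlt_Rmin _ _ _ Hs))).
    specialize (K2 s (proj2 (Rlt_Rmin _ _ _ Hs))).
    eapply Rle_trans; [apply Cmod_le_parts|]. simpl.
    match goal with |- (Rabs ?a + Rabs ?b <= _) =>
      replace a with (fst (u s) - fst (u t) - fst v * (s - t))%R by ring;
      replace b with (snd (u s) - snd (u t) - snd v * (s - t))%R by ring end. lra.
  - intros H; split; intros eps He; destruct (H eps He) as [d [Hd K]];
    exists d; (split; [auto|]); intros s Hs; specialize (K s Hs); eapply Rle_trans; try exact K.
    + eapply Rle_trans; [|apply Cmod_fst]. right. f_equal. simpl. ring.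
    + eapply Rle_trans; [|apply Cmod_snd]. right. f_equal. simpl. ring.
Qed.

Lemma cderiv_iff (g : C -> C) (z l : C) :
  cderiv g z l <-> is_derive (K := C_AbsRing) (V := C_NormedModule) g z l.
Proof.
  split.
  - intros H. split; [apply is_linear_scal_l|].
    intros x Hx. apply (is_filter_lim_locally_unique (V := AbsRing_NormedModule C_AbsRing)) in Hx. subst x.
    intros eps. destruct (H eps (cond_pos eps)) as [d [Hd0 Hd]].
    exists (mkposreal d Hd0). intros s Hs. specialize (Hd s Hs).
    unfold norm, minus, plus, opp, scal; simpl. unfold abs, mult; simpl.
    replace (g s + - g z + - ((s + - z) * l)) with (g s - g z - l * (s - z)) by ring. exact Hd.
  - intros [_ H] eps He. specialize (H z (fun P HP => HP) (mkposreal eps He)).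
    destruct H as [d Hd]. exists d. split; [apply cond_pos|].
    intros s Hs. specialize (Hd s Hs). simpl in Hd.
    unfold norm, minus, plus, opp, scal in Hd; simpl in Hd. unfold abs, mult in Hd; simpl in Hd.
    replace (g s - g z - l * (s - z)) with (g s + - g z + - ((s + - z) * l)) by ring. exact Hd.
Qed.

Lemma rderiv_iff (u : R -> C) (t : R) (v : C) :
  rderiv u t v <-> is_derive (K := R_AbsRing) (V := C_R_NormedModule) u t v.
Proof.
  rewrite rderiv_eps. split.
  - intros H. split; [apply is_linear_scal_l|].
    intros x Hx. apply (is_filter_lim_locally_unique (V := AbsRing_NormedModule R_AbsRing)) in Hx. subst x.
    intros eps. destruct (H eps (cond_pos eps)) as [d [Hd0 Hd]].
    exists (mkposreal d Hd0). intros s Hs. specialize (Hd s Hs).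
    rewrite <- Cmod_norm. 
    eapply Rle_trans; [|exact Hd]. right. f_equal. apply injective_projections; simpl;
    unfold minus, plus, opp, scal; simpl; unfold mult; simpl; ring.
  - intros [_ H] eps He. specialize (H t (fun P HP => HP) (mkposreal eps He)).
    destruct H as [d Hd]. exists d. split; [apply cond_pos|].
    intros s Hs. specialize (Hd s Hs). simpl in Hd. rewrite <- Cmod_norm in Hd.
    eapply Rle_trans; [|exact Hd]. right. f_equal. apply injective_projections; simpl;
    unfold minus, plus, opp, scal; simpl; unfold mult; simpl; ring.
Qed.

Lemma cderiv_ccont (g : C -> C) (z l : C) : cderiv g z l -> ccont g z.
Proof.
  intros H eps He. destruct (H 1%R) as [d [Hd K]]; [lra|].
  pose proof (Cmod_ge_0 l) as Hl.
  exists (Rmin d (eps / (2 + Cmod l))). split.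
  - apply Rmin_pos; auto. apply Rdiv_lt_0_compat; lra.
  - intros w Hw. specialize (K w (proj1 (Rlt_Rmin _ _ _ Hw))).
    assert (Hw2 := Rlt_le_trans _ _ _ Hw (Rmin_r _ _)).
    assert (Hx : Cmod (w - z) * (2 + Cmod l) < eps).
    { apply (Rmult_lt_compat_r (2 + Cmod l)) in Hw2; [|lra].
      unfold Rdiv in Hw2. rewrite Rmult_assoc, Rinv_l in Hw2; lra. }
    pose proof (Cmod_le_sub (g w - g z) (l * (w - z))) as T.
    rewrite Cmod_mult in T. pose proof (Cmod_ge_0 (w - z)). nra.
Qed.

Lemma rderiv_rcont (u : R -> C) (t : R) (v : C) : rderiv u t v -> rcont u t.
Proof.
  rewrite rderiv_eps.
  intros H eps He. destruct (H 1%R) as [d [Hd K]]; [lra|].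
  pose proof (Cmod_ge_0 v) as Hl.
  exists (Rmin d (eps / (2 + Cmod v))). split.
  - apply Rmin_pos; auto. apply Rdiv_lt_0_compat; lra.
  - intros w Hw. specialize (K w (proj1 (Rlt_Rmin _ _ _ Hw))).
    assert (Hw2 := Rlt_le_trans _ _ _ Hw (Rmin_r _ _)).
    assert (Hx : Rabs (w - t) * (2 + Cmod v) < eps).
    { apply (Rmult_lt_compat_r (2 + Cmod v)) in Hw2; [|lra].
      unfold Rdiv in Hw2. rewrite Rmult_assoc, Rinv_l in Hw2; lra. }
    pose proof (Cmod_le_sub (u w - u t) (v * RtoC (w - t))) as T.
    rewrite Cmod_mult, Cmod_R in T. pose proof (Rabs_pos (w - t)). nra.
Qed.

Lemma ccont_rcont_comp (g : C -> C) (u : R -> C) (t : R) :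
  ccont g (u t) -> rcont u t -> rcont (fun s => g (u s)) t.
Proof.
  intros Hg Hu eps He. destruct (Hg eps He) as [d [Hd K]].
  destruct (Hu d Hd) as [d' [Hd' K']]. exists d'; split; auto.
Qed.

Lemma cderiv_rderiv_comp (g : C -> C) (u : R -> C) (t : R) (l v : C) :
  cderiv g (u t) l -> rderiv u t v -> rderiv (fun s => g (u s)) t (l * v).
Proof.
  intros Hg Hu. pose proof (rderiv_rcont _ _ _ Hu) as Hc.
  rewrite rderiv_eps in Hu. apply rderiv_eps. intros eps He.
  pose proof (Cmod_ge_0 l) as Hl. pose proof (Cmod_ge_0 v) as Hv.
  (* [e2] makes |l| times the error of u at most half of the allowed error. [e1] does the same for
     the error of g, since |u s - u t| is at most (e2 + |v|) |s - t|. *)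
  set (e2 := (eps / (2 * (1 + Cmod l)))%R).
  assert (He2 : 0 < e2) by (apply Rdiv_lt_0_compat; lra).
  assert (E2 : (e2 * (1 + Cmod l) = eps / 2)%R) by (unfold e2; field; lra).
  set (e1 := (eps / (2 * (e2 + Cmod v)))%R).
  assert (He1 : 0 < e1) by (apply Rdiv_lt_0_compat; lra).
  assert (E1 : (e1 * (e2 + Cmod v) = eps / 2)%R) by (unfold e1; field; lra).
  destruct (Hg e1 He1) as [d1 [Hd1 K1]].
  destruct (Hu e2 He2) as [d2 [Hd2 K2]].
  destruct (Hc d1 Hd1) as [d3 [Hd3 K3]].
  exists (Rmin d2 d3). split; [apply Rmin_pos; auto|]. intros s Hs.
  specialize (K2 s (proj1 (Rlt_Rmin _ _ _ Hs))).
  specialize (K3 s (proj2 (Rlt_Rmin _ _ _ Hs))).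
  specialize (K1 _ K3).
  replace (g (u s) - g (u t) - l * v * RtoC (s - t)) with
    ((g (u s) - g (u t) - l * (u s - u t)) + l * (u s - u t - v * RtoC (s - t))) by ring.
  eapply Rle_trans; [apply Cmod_triangle|]. rewrite Cmod_mult.
  pose proof (Cmod_le_sub (u s - u t) (v * RtoC (s - t))) as T.
  rewrite Cmod_mult, Cmod_R in T. pose proof (Rabs_pos (s - t)).
  assert (A : Cmod (u s - u t) <= (e2 + Cmod v) * Rabs (s - t)) by lra.
  assert (B : e1 * Cmod (u s - u t) <= eps / 2 * Rabs (s - t)).
  { rewrite <- E1. rewrite Rmult_assoc. apply Rmult_le_compat_l; lra. }
  assert (D : Cmod l * Cmod (u s - u t - v * RtoC (s - t)) <= (Cmod l * e2) * Rabs (s - t)).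
  { rewrite Rmult_assoc. apply Rmult_le_compat_l; lra. }
  nra.
Qed.

Lemma rderiv_affine (a b : C) (t : R) : rderiv (fun s => a + RtoC s * b) t b.
Proof.
  split; simpl; auto_derive; auto; ring.
Qed.

Lemma rderiv_comp_affine (u : R -> C) (k m t : R) (v : C) :
  rderiv u (k * t + m) v -> rderiv (fun s => u (k * s + m)%R) t (RtoC k * v).
Proof.
  intros [H1 H2]. split.
  - eapply (is_derive_ext (fun s => fst (u (k * s + m)%R))); [reflexivity|].
    evar_last. apply (is_derive_comp (fun s => fst (u s)) (fun s => (k * s + m)%R)); [exact H1|].
    auto_derive; auto. unfold scal; simpl; unfold mult; simpl. ring.
  - eapply (is_derive_ext (fun s => snd (u (k * s + m)%R))); [reflexivity|].
    evar_last. apply (is_derive_comp (fun s => snd (u s)) (fun s => (k * s + m)%R)); [exact H2|].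
    auto_derive; auto. unfold scal; simpl; unfold mult; simpl. ring.
Qed.

Lemma rderiv_ext_loc (u v : R -> C) (t : R) (l : C) (r : R) :
  (0 < r) -> (forall s, Rabs (s - t) < r -> u s = v s) -> rderiv u t l -> rderiv v t l.
Proof.
  intros Hr E [H1 H2]. split.
  - apply (is_derive_ext_loc (fun s => fst (u s))); auto.
    exists (mkposreal r Hr). intros s Hs. rewrite E; auto.
  - apply (is_derive_ext_loc (fun s => snd (u s))); auto.
    exists (mkposreal r Hr). intros s Hs. rewrite E; auto.
Qed.

Lemma cderiv_ext_loc (u v : C -> C) (t : C) (l : C) (r : R) :
  (0 < r) -> (forall s, Cmod (s - t) < r -> u s = v s) -> cderiv u t l -> cderiv v t l.
Proof.
  intros Hr E H eps He. destruct (H eps He) as [d [Hd K]].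
  exists (Rmin d r). split; [apply Rmin_pos; auto|]. intros w Hw.
  rewrite <- !E. apply K. 
  - eapply Rlt_le_trans; [exact Hw|apply Rmin_l].
  - rewrite Cmod_diag. auto.
  - eapply Rlt_le_trans; [exact Hw|apply Rmin_r].
Qed.

Lemma cderiv_shift (g : C -> C) (z c l : C) :
  cderiv g (z + c) l -> cderiv (fun w => g (w + c)) z l.
Proof.
  intros H eps He. destruct (H eps He) as [d [Hd K]]. exists d; split; auto.
  intros w Hw. replace (w - z) with ((w + c) - (z + c)) by ring. apply K.
  replace (w + c - (z + c)) with (w - z) by ring. auto.
Qed.

Lemma cderiv_along (g : C -> C) (z d : C) (t : R) (l : C) :
  cderiv g (z + RtoC t * d) l -> rderiv (fun s => g (z + RtoC s * d)) t (l * d).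
Proof.
  intros H. apply (cderiv_rderiv_comp g (fun s => z + RtoC s * d)); auto. apply rderiv_affine.
Qed.

Lemma rcont_parts (u : R -> C) (t : R) :
  rcont u t <-> continuous (fun s => fst (u s)) t /\ continuous (fun s => snd (u s)) t.
Proof.
  split.
  - intros H; split; intros P [eps HP]; destruct (H eps (cond_pos eps)) as [d [Hd K]];
    exists (mkposreal d Hd); intros s Hs; apply HP; specialize (K s Hs);
    eapply Rle_lt_trans; try exact K.
    + apply (Cmod_fst (u s - u t)).
    + apply (Cmod_snd (u s - u t)).
  - intros [H1 H2] eps He.
    assert (He2 : 0 < eps / 2) by lra.
    destruct (proj1 (filterlim_locally _ _) H1 (mkposreal _ He2)) as [d1 K1].
    destruct (proj1 (filterlim_locally _ _) H2 (mkposreal _ He2)) as [d2 K2].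
    exists (Rmin d1 d2). split; [apply Rmin_pos; apply cond_pos|]. intros s Hs.
    specialize (K1 s (proj1 (Rlt_Rmin _ _ _ Hs))).
    specialize (K2 s (proj2 (Rlt_Rmin _ _ _ Hs))).
    eapply Rle_lt_trans; [apply Cmod_le_parts|].
    change (Rabs (fst (u s) - fst (u t)) < eps / 2) in K1.
    change (Rabs (snd (u s) - snd (u t)) < eps / 2) in K2.
    simpl. change (Rabs (fst (u s) - fst (u t)) + Rabs (snd (u s) - snd (u t)) < eps). lra.
Qed.

Lemma rcont_affine (a b : C) (t : R) : rcont (fun s => a + RtoC s * b) t.
Proof. eapply rderiv_rcont, rderiv_affine. Qed.

Lemma rcont_const (a : C) (t : R) : rcont (fun _ => a) t.
Proof. intros eps He. exists 1%R. split; [lra|]. intros. rewrite Cmod_diag; auto. Qed.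

Lemma rcont_plus (u v : R -> C) t : rcont u t -> rcont v t -> rcont (fun s => u s + v s) t.
Proof.
  rewrite !rcont_parts. intros [A B] [A' B']. split; simpl.
  - apply (continuous_plus (fun s => fst (u s)) (fun s => fst (v s))); auto.
  - apply (continuous_plus (fun s => snd (u s)) (fun s => snd (v s))); auto.
Qed.

Lemma rcont_mult (u v : R -> C) t : rcont u t -> rcont v t -> rcont (fun s => u s * v s) t.
Proof.
  rewrite !rcont_parts. intros [A B] [A' B']. split; simpl.
  - apply (continuous_minus (fun s => (fst (u s) * fst (v s))%R) (fun s => (snd (u s) * snd (v s))%R));
    apply (continuous_mult (K := R_AbsRing)); auto.
  - apply (continuous_plus (fun s => (fst (u s) * snd (v s))%R) (fun s => (snd (u s) * fst (v s))%R));
    apply (continuous_mult (K := R_AbsRing)); auto.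
Qed.

Lemma cderiv_inv (x : C) : x <> 0 -> cderiv (fun w => / w) x (- / (x * x)).
Proof.
  intros Hx eps He.
  assert (Hm : 0 < Cmod x) by (apply Cmod_gt_0; auto).
  (* The first radius gives |w| > |x| / 2; with it the second one bounds the exact error |w - x|^2 /
     (|x|^2 |w|) by eps |w - x|. *)
  exists (Rmin (Cmod x / 2) (eps * (Cmod x * Cmod x * Cmod x) / 2)). split.
  { apply Rmin_pos; [lra|]. assert (0 < Cmod x * Cmod x * Cmod x) by (apply Rmult_lt_0_compat; nra). nra. }
  intros w Hw.
  destruct (Rlt_Rmin _ _ _ Hw) as [H1 H2].
  assert (Hwm : Cmod x / 2 < Cmod w).
  { pose proof (Cmod_le_sub x w) as T. rewrite Cmod_minus_sym in T. lra. }
  assert (Hw0 : w <> 0) by (apply Cmod_gt_0; lra).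
  replace (/ w - / x - - / (x * x) * (w - x)) with ((w - x) * (w - x) / (x * x * w)) by (field; auto).
  assert (Hxx : x * x * w <> 0) by (repeat apply Cmult_neq_0; auto).
  rewrite Cmod_div, !Cmod_mult by auto. pose proof (Cmod_ge_0 (w - x)).
  apply Rle_trans with (Cmod (w - x) * Cmod (w - x) / (Cmod x * Cmod x * (Cmod x / 2)))%R.
  - apply Rmult_le_compat_l; [nra|]. apply Rinv_le_contravar; [|].
    + apply Rmult_lt_0_compat; nra.
    + apply Rmult_le_compat_l; nra.
  - assert (0 < Cmod x * Cmod x * (Cmod x / 2)) by (apply Rmult_lt_0_compat; nra).
    apply Rmult_le_reg_r with (Cmod x * Cmod x * (Cmod x / 2))%R; auto.
    unfold Rdiv at 1. rewrite Rmult_assoc, Rinv_l by lra. nra.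
Qed.

Lemma ccont_inv (x : C) : x <> 0 -> ccont (fun w => / w) x.
Proof. intros H. eapply cderiv_ccont, cderiv_inv, H. Qed.

Lemma rcont_inv (u : R -> C) t : u t <> 0 -> rcont u t -> rcont (fun s => / u s) t.
Proof. intros H. apply (ccont_rcont_comp (fun w => / w)). apply ccont_inv; auto. Qed.

(** * Complex-valued integrals *)

Definition CInt (f : R -> C) (a b : R) : C :=
  (RInt (fun t => fst (f t)) a b, RInt (fun t => snd (f t)) a b).

Lemma rcont_ex_RInt (f : R -> C) (a b : R) : a <= b -> (forall t, a <= t <= b -> rcont f t) ->
  ex_RInt (fun t => fst (f t)) a b /\ ex_RInt (fun t => snd (f t)) a b.
Proof.
  intros Hab H. split; apply (ex_RInt_continuous (V := R_CompleteNormedModule)); intros t Ht;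
  rewrite Rmin_left, Rmax_right in Ht by lra; apply (proj1 (rcont_parts f t)); auto.
Qed.

Lemma CInt_ext (f g : R -> C) (a b : R) : a <= b -> (forall t, a <= t <= b -> f t = g t) ->
  CInt f a b = CInt g a b.
Proof.
  intros Hab H. unfold CInt. f_equal; apply RInt_ext; intros t Ht;
  rewrite Rmin_left, Rmax_right in Ht by lra; rewrite H; auto; lra.
Qed.

Lemma CInt_plus (f g : R -> C) (a b : R) : a <= b ->
  (forall t, a <= t <= b -> rcont f t) -> (forall t, a <= t <= b -> rcont g t) ->
  CInt (fun t => f t + g t) a b = CInt f a b + CInt g a b.
Proof.
  intros Hab Hf Hg. destruct (rcont_ex_RInt f a b Hab Hf). destruct (rcont_ex_RInt g a b Hab Hg).
  unfold CInt. apply injective_projections; simpl.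
  - apply (RInt_plus (V := R_CompleteNormedModule) (fun t => fst (f t)) (fun t => fst (g t))); auto.
  - apply (RInt_plus (V := R_CompleteNormedModule) (fun t => snd (f t)) (fun t => snd (g t))); auto.
Qed.

Lemma CInt_scal (c : C) (f : R -> C) (a b : R) : a <= b ->
  (forall t, a <= t <= b -> rcont f t) ->
  CInt (fun t => c * f t) a b = c * CInt f a b.
Proof.
  intros Hab Hf. destruct (rcont_ex_RInt f a b Hab Hf) as [E1 E2].
  assert (S : forall k (h : R -> R), ex_RInt h a b -> ex_RInt (fun t => (k * h t)%R) a b)
    by (intros k h Hh; apply (ex_RInt_scal (V := R_NormedModule) h a b k Hh)).
  assert (T : forall k (h : R -> R), ex_RInt h a b -> RInt (fun t => (k * h t)%R) a b = (k * RInt h a b)%R)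
    by (intros k h Hh; apply (RInt_scal (V := R_CompleteNormedModule) h a b k Hh)).
  unfold CInt. apply injective_projections; simpl.
  - rewrite <- !T by auto.
    apply (RInt_minus (V := R_CompleteNormedModule) (fun t => (fst c * fst (f t))%R) (fun t => (snd c * snd (f t))%R)); auto.
  - rewrite <- !T by auto.
    apply (RInt_plus (V := R_CompleteNormedModule) (fun t => (fst c * snd (f t))%R) (fun t => (snd c * fst (f t))%R)); auto.
Qed.

(* The factor 2 comes from bounding the real and imaginary parts separately. *)
Lemma CInt_bound (f : R -> C) (a b M : R) : a <= b ->
  (forall t, a <= t <= b -> rcont f t) ->
  (forall t, a <= t <= b -> Cmod (f t) <= M) ->
  (Cmod (CInt f a b) <= 2 * M * (b - a)).
Proof.
  intros Hab Hf HM. destruct (rcont_ex_RInt f a b Hab Hf) as [E1 E2].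
  eapply Rle_trans; [apply Cmod_le_parts|]. unfold CInt; simpl.
  assert (A : Rabs (RInt (fun t => fst (f t)) a b) <= (b - a) * M).
  { apply abs_RInt_le_const; auto. intros t Ht. eapply Rle_trans; [apply Cmod_fst|auto]. }
  assert (B : Rabs (RInt (fun t => snd (f t)) a b) <= (b - a) * M).
  { apply abs_RInt_le_const; auto. intros t Ht. eapply Rle_trans; [apply Cmod_snd|auto]. }
  lra.
Qed.

Lemma RInt_comp_affine (h : R -> R) (k m : R) :
  (forall t, 0 <= t <= 1 -> continuous h (k * t + m)%R) ->
  (k * RInt (fun t => h (k * t + m)%R) 0 1 = RInt h m (k + m))%R.
Proof.
  intros H.
  rewrite <- (RInt_scal (V := R_CompleteNormedModule) (fun t => h (k * t + m)%R)).
  - rewrite (RInt_comp_lin (V := R_CompleteNormedModule) h k m 0 1). f_equal; ring.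
    apply (ex_RInt_continuous (V := R_CompleteNormedModule)). intros z Hz.
    (* The interval from m to k + m may be degenerate or reversed, hence the cases for the sign of
       k. *)
    destruct (Req_dec k 0) as [->|Hk].
    + replace z with (0 * 0 + m)%R. apply H; lra.
      revert Hz. rewrite !Rmult_0_l, Rmin_left, Rmax_right; lra.
    + replace z with (k * ((z - m) / k) + m)%R by (field; auto). apply H.
      assert (E : (z - m = k * ((z - m) / k))%R) by (field; auto).
      destruct (Rtotal_order k 0) as [Hk'|[Hk'|Hk']]; [|lra|].
      * rewrite Rmin_right, Rmax_left in Hz by lra. nra.
      * rewrite Rmin_left, Rmax_right in Hz by lra. nra.
  - apply (ex_RInt_continuous (V := R_CompleteNormedModule)). intros z Hz.
    rewrite Rmin_left, Rmax_right in Hz by lra.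
    apply (continuous_comp (fun t => (k * t + m)%R) h); [|auto].
    apply (ex_derive_continuous (V := R_NormedModule)). auto_derive; auto.
Qed.

Lemma CInt_comp_affine (f : R -> C) (k m : R) :
  (forall t, 0 <= t <= 1 -> rcont f (k * t + m)%R) ->
  RtoC k * CInt (fun t => f (k * t + m)%R) 0 1 = CInt f m (k + m).
Proof.
  intros H. unfold CInt. apply injective_projections; simpl.
  - rewrite <- (RInt_comp_affine (fun t => fst (f t))). ring.
    intros t Ht. apply (proj1 (rcont_parts f _)); auto.
  - rewrite <- (RInt_comp_affine (fun t => snd (f t))). ring.
    intros t Ht. apply (proj1 (rcont_parts f _)); auto.
Qed.

Lemma CInt_Chasles (f : R -> C) (a b c : R) : a <= b -> b <= c ->
  (forall t, a <= t <= c -> rcont f t) ->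
  CInt f a b + CInt f b c = CInt f a c.
Proof.
  intros Hab Hbc H. 
  destruct (rcont_ex_RInt f a b Hab) as [E1 E2]. intros; apply H; lra.
  destruct (rcont_ex_RInt f b c Hbc) as [E3 E4]. intros; apply H; lra.
  unfold CInt. apply injective_projections; simpl.
  - apply (RInt_Chasles (V := R_CompleteNormedModule) (fun t => fst (f t))); auto.
  - apply (RInt_Chasles (V := R_CompleteNormedModule) (fun t => snd (f t))); auto.
Qed.

Lemma CInt_swap (f : R -> C) (a b : R) : a <= b ->
  (forall t, a <= t <= b -> rcont f t) -> CInt f b a = - CInt f a b.
Proof.
  intros Hab H. destruct (rcont_ex_RInt f a b Hab H) as [E1 E2].
  unfold CInt. apply injective_projections; simpl; symmetry.
  - apply (opp_RInt_swap (V := R_CompleteNormedModule) (fun t => fst (f t)) a b E1).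
  - apply (opp_RInt_swap (V := R_CompleteNormedModule) (fun t => snd (f t)) a b E2).
Qed.

Lemma CInt_affine (a b : C) : CInt (fun t => a + RtoC t * b) 0 1 = a + b * RtoC (/ 2).
Proof.
  assert (K : forall p q : R, RInt (fun t => (p + q * t)%R) 0 1 = (p + q / 2)%R).
  { intros p q. apply is_RInt_unique. evar_last.
    apply (is_RInt_derive (V := R_CompleteNormedModule) (fun t => (p * t + q * t * t / 2)%R)).
    - intros x _. auto_derive; auto. field.
    - intros x _. apply (ex_derive_continuous (V := R_NormedModule)). auto_derive; auto.
    - unfold minus, plus, opp; simpl. field. }
  unfold CInt. apply injective_projections; simpl.
  - rewrite (RInt_ext _ (fun t => (fst a + fst b * t)%R)). rewrite K. field.
    intros; simpl; ring.
  - rewrite (RInt_ext _ (fun t => (snd a + snd b * t)%R)). rewrite K. field.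
    intros; simpl; ring.
Qed.

Lemma CInt_primitive (f : R -> C) (a b t : R) : a < 0 < b -> a < t < b ->
  (forall s, a < s < b -> rcont f s) -> rderiv (fun s => CInt f 0 s) t (f t).
Proof.
  intros H0 Ht Hc. 
  assert (HB : forall h : R -> R, (forall s, a < s < b -> continuous h s) ->
     is_derive (fun s => RInt h 0 s) t (h t)).
  { intros h Hh. apply (is_derive_RInt (V := R_NormedModule) h _ 0 t); [|apply Hh; lra].
    assert (Hr : 0 < Rmin (t - a) (b - t)) by (apply Rmin_pos; lra).
    exists (mkposreal _ Hr). intros s Hs.
    apply (RInt_correct (V := R_CompleteNormedModule)).
    apply (ex_RInt_continuous (V := R_CompleteNormedModule)). intros z Hz. apply Hh.
    change (Rabs (s - t) < Rmin (t - a) (b - t)) in Hs.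
    pose proof (Rmin_l (t - a) (b - t)). pose proof (Rmin_r (t - a) (b - t)).
    apply Rabs_def2 in Hs. destruct (Rle_dec 0 s).
    - rewrite Rmin_left, Rmax_right in Hz by lra. lra.
    - rewrite Rmin_right, Rmax_left in Hz by lra. lra. }
  split; simpl; [apply (HB (fun t => fst (f t)))|apply (HB (fun t => snd (f t)))];
    intros; apply (proj1 (rcont_parts f _)); auto.
Qed.

(** * Choice principles and geometrically convergent sequences *)

Lemma choice_function (A B : Type) (Q : A -> B -> Prop) :
  (forall x, exists y, Q x y) -> exists f, forall x, Q x (f x).
Proof.
  intros H. exists (fun x => proj1_sig (constructive_indefinite_description _ (H x))).
  intros x. exact (proj2_sig (constructive_indefinite_description _ (H x))).
Qed.

Lemma dependent_choice (T : Type) (P : T -> Prop) (Q : T -> T -> Prop) (x0 : T) :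
  (forall x, P x -> exists y, P y /\ Q x y) -> P x0 ->
  exists f : nat -> T, f O = x0 /\ forall n, P (f n) /\ Q (f n) (f (S n)).
Proof.
  intros H H0.
  set (next := fun x => epsilon (inhabits x0) (fun y => P y /\ Q x y)).
  assert (Hn : forall x, P x -> P (next x) /\ Q x (next x)).
  { intros x Hx. apply (epsilon_spec (inhabits x0) (fun y => P y /\ Q x y)). auto. }
  exists (nat_rect (fun _ => T) x0 (fun _ x => next x)). split; [reflexivity|].
  assert (HP : forall n, P (nat_rect (fun _ => T) x0 (fun _ x => next x) n)).
  { induction n; simpl; auto. apply Hn; auto. }
  intros n. split; auto. apply Hn; auto.
Qed.

(** The intervals of radius 2 K / 2^n about x n are nested; p is the supremum of their left ends. *)
Lemma geometric_limit_R (x : nat -> R) (K : R) :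
  (forall n, Rabs (x (S n) - x n) <= K * (/ 2) ^ n)%R ->
  exists p, forall n, Rabs (p - x n) <= 2 * K * (/ 2) ^ n.
Proof.
  intros H.
  assert (Hp : forall n, 0 < (/ 2) ^ n) by (intros; apply pow_lt; lra).
  assert (HK : 0 <= K).
  { specialize (H O). simpl in H. pose proof (Rabs_pos (x 1%nat - x 0%nat)). lra. }
  set (l := fun n => (x n - 2 * K * (/ 2) ^ n)%R).
  set (u := fun n => (x n + 2 * K * (/ 2) ^ n)%R).
  assert (Hl : forall n, l n <= l (S n)).
  { intros n. unfold l. specialize (H n). apply Rabs_le_between in H. simpl. lra. }
  assert (Hu : forall n, u (S n) <= u n).
  { intros n. unfold u. specialize (H n). apply Rabs_le_between in H. simpl. lra. }
  assert (Hl' : forall n k, l n <= l (n + k)%nat).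
  { induction k. rewrite Nat.add_0_r; lra. rewrite Nat.add_succ_r. specialize (Hl (n + k)%nat). lra. }
  assert (Hu' : forall n k, u (n + k)%nat <= u n).
  { induction k. rewrite Nat.add_0_r; lra. rewrite Nat.add_succ_r. specialize (Hu (n + k)%nat). lra. }
  assert (Hlu : forall n m, l n <= u m).
  { intros n m. specialize (Hl' n m). specialize (Hu' m n). rewrite Nat.add_comm in Hu'.
    assert (l (n + m)%nat <= u (n + m)%nat); [|lra].
    unfold l, u. specialize (Hp (n + m)%nat). nra. }
  destruct (completeness (fun r => exists n, r = l n)) as [p [Hp1 Hp2]].
  - exists (u O). intros r [n ->]. apply Hlu.
  - exists (l O). exists O. reflexivity.
  - exists p. intros n. apply Rabs_le_between.
    assert (A : l n <= p) by (apply Hp1; exists n; reflexivity).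
    assert (B : p <= u n) by (apply Hp2; intros r [m ->]; apply Hlu).
    unfold l, u in *. lra.
Qed.

Lemma geometric_limit (x : nat -> C) (K : R) :
  (forall n, Cmod (x (S n) - x n) <= K * (/ 2) ^ n)%R ->
  exists p, forall n, Cmod (p - x n) <= 4 * K * (/ 2) ^ n.
Proof.
  intros H.
  destruct (geometric_limit_R (fun n => fst (x n)) K) as [p1 H1].
  { intros n. eapply Rle_trans; [apply (Cmod_fst (x (S n) - x n))|auto]. }
  destruct (geometric_limit_R (fun n => snd (x n)) K) as [p2 H2].
  { intros n. eapply Rle_trans; [apply (Cmod_snd (x (S n) - x n))|auto]. }
  exists (p1, p2). intros n. eapply Rle_trans; [apply Cmod_le_parts|]. simpl.
  specialize (H1 n). specialize (H2 n). simpl in *.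
  change (Rabs (p1 - fst (x n)) + Rabs (p2 - snd (x n)) <= 4 * K * (/ 2) ^ n). lra.
Qed.

Lemma half_pow_small (K eps : R) : 0 < eps -> exists n, K * (/ 2) ^ n < eps.
Proof.
  intros He.
  destruct (pow_lt_1_zero (/ 2) ltac:(rewrite Rabs_pos_eq; lra) (eps / (Rabs K + 1))) as [n Hn].
  { apply Rdiv_lt_0_compat; auto. pose proof (Rabs_pos K); lra. }
  exists n. specialize (Hn n (Nat.le_refl n)). rewrite Rabs_pos_eq in Hn by (apply pow_le; lra).
  pose proof (Rabs_pos K). pose proof (Rle_abs K). 
  apply (Rmult_lt_compat_l (Rabs K + 1)) in Hn; [|lra].
  replace ((Rabs K + 1) * (eps / (Rabs K + 1)))%R with eps in Hn by (field; lra).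
  assert (0 < (/ 2) ^ n) by (apply pow_lt; lra). nra.
Qed.

(** * Goursat's lemma *)

(** Contour integral along the straight segment from a to b. *)
Definition Seg (g : C -> C) (a b : C) : C :=
  (b - a) * CInt (fun t => g (a + RtoC t * (b - a))) 0 1.

Definition seg_ccont (g : C -> C) (a b : C) : Prop :=
  forall t, 0 <= t <= 1 -> ccont g (a + RtoC t * (b - a)).

Lemma seg_rcont (g : C -> C) (a b : C) (t : R) : seg_ccont g a b -> 0 <= t <= 1 ->
  rcont (fun t => g (a + RtoC t * (b - a))) t.
Proof.
  intros H Ht. apply (ccont_rcont_comp g (fun t => a + RtoC t * (b - a))); auto.
  apply rcont_affine.
Qed.

Lemma Seg_rev (g : C -> C) (a b : C) : seg_ccont g a b -> Seg g b a = - Seg g a b.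
Proof.
  intros H. unfold Seg.
  set (f := fun t => g (a + RtoC t * (b - a))).
  assert (Hf : forall t, 0 <= t <= 1 -> rcont f t) by (intros; apply seg_rcont; auto).
  assert (E : CInt (fun t => g (b + RtoC t * (a - b))) 0 1 = CInt f 0 1).
  { pose proof (CInt_comp_affine f (-1) 1) as K.
    replace (-1 + 1)%R with 0%R in K by ring.
    rewrite (CInt_swap f 0 1) in K by (auto; lra).
    replace (CInt f 0 1) with (- (RtoC (-1) * CInt f 0 1)) by ceq.
    replace (RtoC (-1) * CInt f 0 1) with (- CInt f 0 1) by ceq.
    rewrite <- K by (intros; apply Hf; lra).
    rewrite (CInt_ext _ (fun t => f (-1 * t + 1)%R)); [ceq|lra|].
    intros t Ht. unfold f. f_equal. ceq. }
  rewrite E. ring.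
Qed.

Definition midpoint (a b : C) : C := (a + b) * RtoC (/ 2).

Lemma Seg_mid (g : C -> C) (a b : C) : seg_ccont g a b ->
  Seg g a b = Seg g a (midpoint a b) + Seg g (midpoint a b) b.
Proof.
  intros H. unfold Seg.
  set (f := fun t => g (a + RtoC t * (b - a))).
  assert (Hf : forall t, 0 <= t <= 1 -> rcont f t) by (intros; apply seg_rcont; auto).
  rewrite <- (CInt_Chasles f 0 (/ 2) 1) by (auto; lra).
  pose proof (CInt_comp_affine f (/ 2) 0) as K1.
  pose proof (CInt_comp_affine f (/ 2) (/ 2)) as K2.
  replace (/ 2 + 0)%R with (/ 2)%R in K1 by ring. replace (/ 2 + / 2)%R with 1%R in K2 by field.
  rewrite <- K1, <- K2 by (intros; apply Hf; lra).
  rewrite (CInt_ext (fun t => g (a + RtoC t * (midpoint a b - a))) (fun t => f (/ 2 * t + 0)%R)); [|lra|].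
  rewrite (CInt_ext (fun t => g (midpoint a b + RtoC t * (b - midpoint a b))) (fun t => f (/ 2 * t + / 2)%R)); [|lra|].
  - replace (b - midpoint a b) with ((b - a) * RtoC (/ 2)) by (unfold midpoint; ceq).
    replace (midpoint a b - a) with ((b - a) * RtoC (/ 2)) by (unfold midpoint; ceq). ring.
  - intros t Ht. unfold f. f_equal. unfold midpoint. ceq.
  - intros t Ht. unfold f. f_equal. unfold midpoint. ceq.
Qed.

Lemma Seg_plus (g h : C -> C) (a b : C) : seg_ccont g a b -> seg_ccont h a b ->
  Seg (fun z => g z + h z) a b = Seg g a b + Seg h a b.
Proof.
  intros Hg Hh. unfold Seg.
  rewrite (CInt_plus (fun t => g (a + RtoC t * (b - a))) (fun t => h (a + RtoC t * (b - a)))).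
  - ring.
  - lra.
  - intros; apply seg_rcont; auto.
  - intros; apply seg_rcont; auto.
Qed.

Lemma Seg_scal (c : C) (g : C -> C) (a b : C) : seg_ccont g a b ->
  Seg (fun z => c * g z) a b = c * Seg g a b.
Proof.
  intros Hg. unfold Seg.
  rewrite (CInt_scal c (fun t => g (a + RtoC t * (b - a)))).
  - ring.
  - lra.
  - intros; apply seg_rcont; auto.
Qed.

Lemma Seg_ext (g h : C -> C) (a b : C) :
  (forall t, 0 <= t <= 1 -> g (a + RtoC t * (b - a)) = h (a + RtoC t * (b - a))) ->
  Seg g a b = Seg h a b.
Proof. intros H. unfold Seg. f_equal. apply CInt_ext; auto; lra. Qed.

Lemma Seg_bound (g : C -> C) (a b : C) (M : R) : seg_ccont g a b ->
  (forall t, 0 <= t <= 1 -> Cmod (g (a + RtoC t * (b - a))%C) <= M) ->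
  (Cmod (Seg g a b) <= 2 * M * Cmod (b - a)).
Proof.
  intros H HM. unfold Seg. rewrite Cmod_mult.
  assert (K : Cmod (CInt (fun t => g (a + RtoC t * (b - a))%C) 0 1) <= 2 * M * (1 - 0)).
  { apply CInt_bound; auto; try lra. intros; apply seg_rcont; auto. }
  pose proof (Cmod_ge_0 (b - a)). nra.
Qed.

Lemma Seg_affine (p q a b : C) : Seg (fun z => p + q * z) a b = (b - a) * (p + q * midpoint a b).
Proof.
  unfold Seg. f_equal.
  rewrite (CInt_ext _ (fun t => (p + q * a) + RtoC t * (q * (b - a)))); [|lra|intros; ring].
  rewrite CInt_affine. unfold midpoint. ceq.
Qed.

Lemma ccont_affine (p q z : C) : ccont (fun z => p + q * z) z.
Proof.
  apply (cderiv_ccont _ z q). intros eps He. exists 1%R. split; [lra|]. intros w _.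
  replace (p + q * w - (p + q * z) - q * (w - z)) with (RtoC 0) by ring. rewrite Cmod_0.
  pose proof (Cmod_ge_0 (w - z)). nra.
Qed.

Definition Tri (g : C -> C) (a b c : C) : C := Seg g a b + Seg g b c + Seg g c a.

(** Convexity keeps bisected triangles in D, closedness keeps their limit point there. Half-planes
    are the instances used. *)
Definition convex_closed (D : C -> Prop) : Prop :=
  (forall a b t, D a -> D b -> 0 <= t <= 1 -> D (a + RtoC t * (b - a))) /\
  (forall p, (forall eps, 0 < eps -> exists q, D q /\ Cmod (q - p) < eps) -> D p).

Section Goursat.
Variables (D : C -> Prop) (g : C -> C).
Hypothesis (HD : convex_closed D).
Hypothesis (Hg : forall z, D z -> exists l, cderiv g z l).

Let Hseg a b : D a -> D b -> seg_ccont g a b.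
Proof.
  intros Ha Hb t Ht. destruct (Hg (a + RtoC t * (b - a))) as [l Hl]; [apply (proj1 HD); auto|].
  eapply cderiv_ccont, Hl.
Qed.

Let Dmid a b : D a -> D b -> D (midpoint a b).
Proof.
  intros. replace (midpoint a b) with (a + RtoC (/ 2) * (b - a)) by (unfold midpoint; ceq).
  apply (proj1 HD); auto; lra.
Qed.

Let good (s : (C * C * C) * (R * R)) : Prop :=
  let '((a, b, c), (d, e)) := s in
  D a /\ D b /\ D c /\ Cmod (b - a) <= d /\ Cmod (c - b) <= d /\ Cmod (a - c) <= d /\
  (e <= Cmod (Tri g a b c)).

Let next (s s' : (C * C * C) * (R * R)) : Prop :=
  let '((a, b, c), (d, e)) := s in let '((a', b', c'), (d', e')) := s' in
  d' = (/ 2 * d)%R /\ e' = (/ 4 * e)%R /\ Cmod (a' - a) <= d.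

(** Bisection: the sides of the medial triangle p q r are run through in both directions and cancel,
    so one of the four parts keeps a quarter of the integral while all sides are halved. *)
Let Hnext s : good s -> exists s', good s' /\ next s s'.
Proof.
  destruct s as [[[a b] c] [d e]]. intros (Da & Db & Dc & H1 & H2 & H3 & He).
  set (p := midpoint a b). set (q := midpoint b c). set (r := midpoint c a).
  assert (Dp : D p) by (apply Dmid; auto). assert (Dq : D q) by (apply Dmid; auto).
  assert (Dr : D r) by (apply Dmid; auto).
  assert (ET : Tri g a b c = Tri g a p r + Tri g p b q + Tri g r q c + Tri g p q r).
  { unfold Tri. rewrite (Seg_mid g a b), (Seg_mid g b c), (Seg_mid g c a) by auto.
    fold p q r.
    rewrite (Seg_rev g p r), (Seg_rev g p q), (Seg_rev g q r) by auto. ring. }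
  assert (Hhalf : forall x, Cmod (RtoC (/ 2) * x) = (/ 2 * Cmod x)%R).
  { intros. apply Cmod_real_scal. lra. }
  assert (K : forall x y, Cmod (x - y) <= d ->
     (Cmod ((x - y) * RtoC (/ 2)) <= / 2 * d) /\ Cmod ((y - x) * RtoC (/ 2)) <= / 2 * d).
  { intros x y Hxy. rewrite !(Cmult_comm _ (RtoC (/ 2))), !Hhalf. rewrite (Cmod_minus_sym y x). lra. }
  destruct (K _ _ H1) as [A1 B1]. destruct (K _ _ H2) as [A2 B2]. destruct (K _ _ H3) as [A3 B3].
  assert (Hd : 0 <= d) by (eapply Rle_trans; [apply Cmod_ge_0|exact H1]).
  assert (Cho : / 4 * e <= Cmod (Tri g a p r) \/ / 4 * e <= Cmod (Tri g p b q) \/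
     (/ 4 * e <= Cmod (Tri g r q c)) \/ / 4 * e <= Cmod (Tri g p q r)).
  { destruct (Rle_dec (/ 4 * e) (Cmod (Tri g a p r))); auto.
    destruct (Rle_dec (/ 4 * e) (Cmod (Tri g p b q))); auto.
    destruct (Rle_dec (/ 4 * e) (Cmod (Tri g r q c))); auto.
    destruct (Rle_dec (/ 4 * e) (Cmod (Tri g p q r))); auto.
    exfalso. rewrite ET in He.
    pose proof (Cmod_triangle (Tri g a p r + Tri g p b q + Tri g r q c) (Tri g p q r)).
    pose proof (Cmod_triangle (Tri g a p r + Tri g p b q) (Tri g r q c)).
    pose proof (Cmod_triangle (Tri g a p r) (Tri g p b q)). lra. }
  assert (Epa : p - a = (b - a) * RtoC (/ 2)) by (unfold p, midpoint; ceq).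
  assert (Ebp : b - p = (b - a) * RtoC (/ 2)) by (unfold p, midpoint; ceq).
  assert (Eqb : q - b = (c - b) * RtoC (/ 2)) by (unfold q, midpoint; ceq).
  assert (Ecq : c - q = (c - b) * RtoC (/ 2)) by (unfold q, midpoint; ceq).
  assert (Ear : a - r = (a - c) * RtoC (/ 2)) by (unfold r, midpoint; ceq).
  assert (Erc : r - c = (a - c) * RtoC (/ 2)) by (unfold r, midpoint; ceq).
  assert (Erp : r - p = (c - b) * RtoC (/ 2)) by (unfold r, p, midpoint; ceq).
  assert (Epq : p - q = (a - c) * RtoC (/ 2)) by (unfold q, p, midpoint; ceq).
  assert (Eqr : q - r = (b - a) * RtoC (/ 2)) by (unfold q, r, midpoint; ceq).
  destruct Cho as [T|[T|[T|T]]].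
  - exists ((a, p, r), (/ 2 * d, / 4 * e)%R). unfold good, next.
    rewrite Epa, Erp, Ear. rewrite Cmod_diag.
    repeat split; auto.
  - exists ((p, b, q), (/ 2 * d, / 4 * e)%R). unfold good, next.
    rewrite Ebp, Eqb, Epq, Epa. repeat split; auto. lra.
  - exists ((r, q, c), (/ 2 * d, / 4 * e)%R). unfold good, next.
    rewrite Eqr, Ecq, Erc. repeat split; auto.
    replace (r - a) with ((c - a) * RtoC (/ 2)) by (unfold r, midpoint; ceq). lra.
  - exists ((p, q, r), (/ 2 * d, / 4 * e)%R). unfold good, next.
    rewrite (Cmod_minus_sym q p), Epq, (Cmod_minus_sym r q), Eqr, (Cmod_minus_sym p r), Erp, Epa.
    repeat split; auto. lra.
Qed.

(** Affine functions integrate to 0 around a triangle, so g may be replaced by its Taylor remainder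
    at p. On the triangle |z - p| is at most d + d + 4 d, so the remainder is at most 6 eps d; each
    side contributes 12 eps d^2 because of the factor 2 in [Seg_bound]. *)
Lemma Tri_estimate (a b c p l : C) (d eps : R) : D a -> D b -> D c ->
  (Cmod (b - a) <= d) -> Cmod (c - b) <= d -> Cmod (a - c) <= d ->
  (Cmod (p - a) <= 4 * d) -> 0 <= eps ->
  (forall w, Cmod (w - p) <= 6 * d -> Cmod (g w - g p - l * (w - p)) <= eps * Cmod (w - p)) ->
  (Cmod (Tri g a b c) <= 36 * eps * (d * d)).
Proof.
  intros Da Db Dc H1 H2 H3 Hp Heps Hl.
  assert (Hd : 0 <= d) by (eapply Rle_trans; [apply Cmod_ge_0|exact H1]).
  set (r := fun z => g z + (- (g p - l * p) + (- l) * z)).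
  set (h := fun z => - (g p - l * p) + (- l) * z).
  assert (Hh : forall x y, seg_ccont h x y) by (intros x y t _; apply ccont_affine).
  assert (ER : forall x y, D x -> D y -> Seg r x y = Seg g x y + Seg h x y).
  { intros. apply Seg_plus; auto. }
  assert (ET : Tri g a b c = Seg r a b + Seg r b c + Seg r c a).
  { unfold Tri. rewrite !ER by auto. unfold h. rewrite !Seg_affine. unfold midpoint.
    match goal with |- ?L = _ => set (x := L) end.
    unfold x. ring. }
  assert (EB : forall x y, D x -> D y -> Cmod (x - a) <= d -> Cmod (y - x) <= d ->
     (Cmod (Seg r x y) <= 12 * eps * (d * d))).
  { intros x y Dx Dy Hx Hy. eapply Rle_trans; [apply (Seg_bound _ _ _ (6 * eps * d)%R)|].
    - intros t Ht eta Heta. 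
      destruct (Hseg x y Dx Dy t Ht (eta / 2)%R ltac:(lra)) as [d1 [Hd1 K1]].
      destruct (Hh x y t Ht (eta / 2)%R ltac:(lra)) as [d2 [Hd2 K2]].
      exists (Rmin d1 d2). split; [apply Rmin_pos; auto|]. intros w Hw.
      specialize (K1 w (proj1 (Rlt_Rmin _ _ _ Hw))).
      specialize (K2 w (proj2 (Rlt_Rmin _ _ _ Hw))).
      set (z := x + RtoC t * (y - x)) in *.
      replace (r w - r z) with ((g w - g z) + (h w - h z)) by (unfold r, h; ring).
      eapply Rle_lt_trans; [apply Cmod_triangle|]. lra.
    - intros t Ht. set (z := x + RtoC t * (y - x)).
      assert (Hz : Cmod (z - p) <= 6 * d).
      { pose proof (Cmod_sub_triangle z a p) as T1. rewrite (Cmod_minus_sym a p) in T1.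
        pose proof (Cmod_sub_triangle z x a) as T2.
        assert (Cmod (z - x) <= d); [|lra].
        unfold z. replace (x + RtoC t * (y - x) - x) with (RtoC t * (y - x)) by ring.
        rewrite Cmod_real_scal by lra. pose proof (Cmod_ge_0 (y - x)). nra. }
      replace (r z) with (g z - g p - l * (z - p)) by (unfold r; ring).
      eapply Rle_trans; [apply Hl; auto|]. nra.
    - assert (0 <= 6 * eps * d) by nra. pose proof (Cmod_ge_0 (y - x)). nra. }
  rewrite ET.
  assert (E1 := EB a b Da Db). assert (E2 := EB b c Db Dc). assert (E3 := EB c a Dc Da).
  replace (a - a) with (RtoC 0) in E1 by ring. rewrite Cmod_0 in E1.
  rewrite (Cmod_minus_sym c a) in E3.
  specialize (E1 ltac:(auto) ltac:(auto)). specialize (E2 ltac:(auto) ltac:(auto)).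
  specialize (E3 ltac:(auto) ltac:(auto)).
  pose proof (Cmod_triangle (Seg r a b + Seg r b c) (Seg r c a)).
  pose proof (Cmod_triangle (Seg r a b) (Seg r b c)). lra.
Qed.

Lemma goursat (a b c : C) : D a -> D b -> D c -> Tri g a b c = 0.
Proof.
  intros Da Db Dc.
  set (d := (Cmod (b - a) + Cmod (c - b) + Cmod (a - c))%R).
  set (e := Cmod (Tri g a b c)).
  pose proof (Cmod_ge_0 (b - a)). pose proof (Cmod_ge_0 (c - b)). pose proof (Cmod_ge_0 (a - c)).
  destruct (dependent_choice _ good next ((a, b, c), (d, e)) Hnext) as [f [Hf0 Hf]].
  { unfold good, d, e. repeat split; auto; lra. }
  set (A := fun n => fst (fst (fst (f n)))). 
  assert (Hde : forall n, snd (f n) = ((d * (/ 2) ^ n)%R, (e * (/ 4) ^ n)%R)).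
  { induction n. rewrite Hf0; simpl. f_equal; ring.
    destruct (Hf n) as [_ Hn]. destruct (f n) as [[[? ?] ?] [dn en]].
    destruct (f (S n)) as [[[? ?] ?] [dn' en']]. simpl in IHn. injection IHn as -> ->.
    destruct Hn as (-> & -> & _). simpl. f_equal; ring. }
  assert (HA : forall n, Cmod (A (S n) - A n) <= d * (/ 2) ^ n).
  { intros n. destruct (Hf n) as [_ Hn]. specialize (Hde n). unfold A.
    destruct (f n) as [[[? ?] ?] [dn en]]. destruct (f (S n)) as [[[? ?] ?] [dn' en']].
    simpl in *. injection Hde as -> ->. apply Hn. }
  destruct (geometric_limit A d HA) as [p Hp].
  assert (Dp : D p).
  { apply (proj2 HD). intros eps Heps. destruct (half_pow_small (4 * d) eps Heps) as [n Hn].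
    exists (A n). split.
    - destruct (Hf n) as [Hg' _]. unfold A. destruct (f n) as [[[? ?] ?] [dn en]]. apply Hg'.
    - rewrite Cmod_minus_sym. eapply Rle_lt_trans; [apply Hp|]. auto. }
  destruct (Hg p Dp) as [l Hl].
  assert (Hd0 : 0 <= d) by (unfold d; lra).
  (* The lower bound for the n-th integral and the estimate from differentiability at p both scale
     like 4^(-n), so the scale cancels. *)
  assert (Hsmall : forall eps, 0 < eps -> e <= 36 * eps * (d * d)).
  { intros eps Heps. destruct (Hl eps Heps) as [del [Hdel K]].
    destruct (half_pow_small (6 * d) del Hdel) as [n Hn].
    specialize (Hp n). destruct (Hf n) as [Hgood _]. specialize (Hde n). unfold A in Hp.
    destruct (f n) as [[[x y] z] [dn en]]. simpl in *. injection Hde as -> ->.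
    destruct Hgood as (Dx & Dy & Dz & G1 & G2 & G3 & GT).
    assert (E := Tri_estimate x y z p l (d * (/ 2) ^ n) eps Dx Dy Dz G1 G2 G3).
    assert (E' := E ltac:(lra) ltac:(lra)). clear E.
    assert (E := E' ltac:(intros w Hw; apply K; lra)). clear E'.
    assert (P4 : ((/ 4) ^ n = (/ 2) ^ n * (/ 2) ^ n)%R).
    { rewrite <- Rpow_mult_distr. f_equal. field. }
    rewrite P4 in GT. assert (Hpos : 0 < (/ 2) ^ n * (/ 2) ^ n).
    { assert (0 < (/ 2) ^ n) by (apply pow_lt; lra). nra. }
    apply Rmult_le_reg_r with ((/ 2) ^ n * (/ 2) ^ n)%R; auto. lra. }
  assert (He : e <= 0).
  { destruct (Rle_dec e 0) as [|n]; auto. exfalso.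
    (* This eps makes the bound in [Hsmall] at most e / 2. *)
    assert (Hq : 0 < e / (72 * (d * d + 1))) by (apply Rdiv_lt_0_compat; nra).
    specialize (Hsmall _ Hq).
    replace (36 * (e / (72 * (d * d + 1))) * (d * d))%R with (e / 2 * (d * d / (d * d + 1)))%R in Hsmall by (field; nra).
    assert (d * d / (d * d + 1) <= 1).
    { apply Rmult_le_reg_r with (d * d + 1)%R; [nra|]. unfold Rdiv. rewrite Rmult_assoc, Rinv_l by nra. nra. }
    nra. }
  apply Cmod_eq_0. apply Rle_antisym; [exact He|apply Cmod_ge_0].
Qed.
End Goursat.

(** * Cauchy's formula on a square and second-order Taylor bounds *)

Lemma ccont_const (c z : C) : ccont (fun _ => c) z.
Proof. intros eps He. exists 1%R. split; [lra|]. intros. replace (c - c) with (RtoC 0) by ring.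
  rewrite Cmod_0; auto. Qed.

Lemma ccont_plus (f g : C -> C) z : ccont f z -> ccont g z -> ccont (fun w => f w + g w) z.
Proof.
  intros Hf Hg eps He.
  destruct (Hf (eps / 2)%R ltac:(lra)) as [d1 [Hd1 K1]].
  destruct (Hg (eps / 2)%R ltac:(lra)) as [d2 [Hd2 K2]].
  exists (Rmin d1 d2). split; [apply Rmin_pos; auto|]. intros w Hw.
  specialize (K1 w (proj1 (Rlt_Rmin _ _ _ Hw))).
  specialize (K2 w (proj2 (Rlt_Rmin _ _ _ Hw))).
  replace (f w + g w - (f z + g z)) with ((f w - f z) + (g w - g z)) by ring.
  eapply Rle_lt_trans; [apply Cmod_triangle|lra].
Qed.

Lemma ccont_mult (f g : C -> C) z : ccont f z -> ccont g z -> ccont (fun w => f w * g w) z.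
Proof.
  intros Hf Hg eps He.
  pose proof (Cmod_ge_0 (f z)). pose proof (Cmod_ge_0 (g z)).
  set (k := (1 + Cmod (f z) + Cmod (g z))%R). assert (Hk : 1 <= k) by (unfold k; lra).
  set (e := Rmin 1 (eps / (2 * k))).
  assert (He' : 0 < e) by (apply Rmin_pos; [lra|apply Rdiv_lt_0_compat; lra]).
  assert (He1 : e <= 1) by apply Rmin_l.
  assert (He2 : e * k <= eps / 2).
  { apply Rle_trans with (eps / (2 * k) * k)%R; [apply Rmult_le_compat_r; [lra|apply Rmin_r]|].
    right; field; lra. }
  destruct (Hf e He') as [d1 [Hd1 K1]].
  destruct (Hg e He') as [d2 [Hd2 K2]].
  exists (Rmin d1 d2). split; [apply Rmin_pos; auto|]. intros w Hw.
  specialize (K1 w (proj1 (Rlt_Rmin _ _ _ Hw))).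
  specialize (K2 w (proj2 (Rlt_Rmin _ _ _ Hw))).
  replace (f w * g w - f z * g z) with ((f w - f z) * (g w - g z) + (f w - f z) * g z + f z * (g w - g z)) by ring.
  eapply Rle_lt_trans; [apply Cmod_triangle|].
  eapply Rle_lt_trans; [apply Rplus_le_compat_r, Cmod_triangle|]. rewrite !Cmod_mult.
  pose proof (Cmod_ge_0 (f w - f z)). pose proof (Cmod_ge_0 (g w - g z)). unfold k in *. nra.
Qed.

Lemma cderiv_mult (f g : C -> C) (z l m : C) : cderiv f z l -> cderiv g z m ->
  cderiv (fun w => f w * g w) z (l * g z + f z * m).
Proof.
  intros Hf Hg eps He.
  pose proof (Cmod_ge_0 (f z)). pose proof (Cmod_ge_0 (g z)).
  pose proof (Cmod_ge_0 l). 
  set (k := (2 + Cmod l + Cmod (f z) + Cmod (g z))%R). assert (Hk : 2 <= k) by (unfold k; lra).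
  set (e := Rmin 1 (eps / k)).
  assert (He' : 0 < e) by (apply Rmin_pos; [lra|apply Rdiv_lt_0_compat; lra]).
  assert (He1 : e <= 1) by apply Rmin_l.
  assert (He2 : e * k <= eps).
  { apply Rle_trans with (eps / k * k)%R; [apply Rmult_le_compat_r; [lra|apply Rmin_r]|].
    right; field; lra. }
  destruct (Hf e He') as [d1 [Hd1 K1]].
  destruct (Hg e He') as [d2 [Hd2 K2]].
  destruct (cderiv_ccont _ _ _ Hg e He') as [d3 [Hd3 K3]].
  exists (Rmin d1 (Rmin d2 d3)). split; [repeat apply Rmin_pos; auto|]. intros w Hw.
  assert (Hw' := Rlt_le_trans _ _ _ Hw (Rmin_r _ _)).
  specialize (K1 w (proj1 (Rlt_Rmin _ _ _ Hw))).
  specialize (K2 w (proj1 (Rlt_Rmin _ _ _ Hw'))).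
  specialize (K3 w (proj2 (Rlt_Rmin _ _ _ Hw'))).
  replace (f w * g w - f z * g z - (l * g z + f z * m) * (w - z)) with
    ((f w - f z - l * (w - z)) * g z + f z * (g w - g z - m * (w - z)) + (f w - f z) * (g w - g z)) by ring.
  eapply Rle_trans; [apply Cmod_triangle|].
  eapply Rle_trans; [apply Rplus_le_compat_r, Cmod_triangle|]. rewrite !Cmod_mult.
  pose proof (Cmod_le_sub (f w - f z) (l * (w - z))) as T. rewrite Cmod_mult in T.
  pose proof (Cmod_ge_0 (f w - f z)). pose proof (Cmod_ge_0 (g w - g z)). pose proof (Cmod_ge_0 (w - z)).
  set (h := Cmod (w - z)) in *.
  apply Rle_trans with (e * h * Cmod (g z) + Cmod (f z) * (e * h) + (Cmod l * h + 1 * h) * e)%R.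
  - apply Rplus_le_compat; [apply Rplus_le_compat|].
    + apply Rmult_le_compat_r; auto.
    + apply Rmult_le_compat_l; auto.
    + apply Rmult_le_compat; auto; nra.
  - apply Rle_trans with (e * k * h)%R; [unfold k; nra|]. apply Rmult_le_compat_r; auto.
Qed.

Lemma ccont_ext_inv (y z : C) : z <> y -> ccont (fun w => / (w - y)) z.
Proof.
  intros H eps He. destruct (ccont_inv (z - y) (Csub_neq_0 _ _ H) eps He) as [d [Hd K]].
  exists d; split; auto. intros w Hw. apply K. replace (w - y - (z - y)) with (w - z) by ring. auto.
Qed.

(** * Compactness of rectangles *)

Definition in_rect (a b c e : R) (z : C) : Prop := (a <= fst z <= b) /\ c <= snd z <= e.

(** Stands in for finite subcovers: a radius chosen point by point has a uniform lower bound over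
    centres that still cover the rectangle. *)
Lemma rect_lebesgue_number (a b c e : R) (d : C -> R) :
  (forall u, in_rect a b c e u -> 0 < d u) ->
  exists d0, 0 < d0 /\ forall z, in_rect a b c e z ->
    exists u, in_rect a b c e u /\ Cmod (z - u) < d u /\ d0 <= d u.
Proof.
  intros Hd.
  (* Halved because the compactness lemma bounds the two coordinates separately; 1 is a default
     value off the rectangle. *)
  assert (Hpos : forall u, 0 < (if excluded_middle_informative (in_rect a b c e u) then d u / 2 else 1)).
  { intros u. destruct (excluded_middle_informative _) as [i|]; [|lra]. specialize (Hd u i). lra. }
  destruct (compactness_value_2d a b c e (fun u v => mkposreal _ (Hpos (u, v)))) as [d0 H0].
  exists (d0 : R). split; [apply cond_pos|]. intros z [Hz1 Hz2].
  apply NNPP. intros N. apply (H0 (fst z) (snd z) Hz1 Hz2). intros (u & v & Hu & Hv & K1 & K2 & K3).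
  simpl in K1, K2, K3. destruct (excluded_middle_informative (in_rect a b c e (u, v))) as [i|n].
  - apply N. exists (u, v). split; auto. pose proof (cond_pos d0). split; [|lra].
    eapply Rle_lt_trans; [apply Cmod_le_parts|]. simpl.
    change (Rabs (fst z - u) + Rabs (snd z - v) < d (u, v)). lra.
  - apply n. split; auto.
Qed.

Lemma rect_bounded (a b c e : R) (g : C -> C) : (forall z, in_rect a b c e z -> ccont g z) ->
  exists B, 0 < B /\ forall z, in_rect a b c e z -> Cmod (g z) <= B.
Proof.
  intros Hg.
  assert (H : forall u, exists d, in_rect a b c e u -> 0 < d /\ d <= / (1 + Cmod (g u)) /\
    forall w, Cmod (w - u) < d -> Cmod (g w - g u) < 1).
  { intros u. destruct (classic (in_rect a b c e u)) as [i|n]; [|exists 1%R; tauto].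
    destruct (Hg u i 1%R ltac:(lra)) as [d [Hd K]]. pose proof (Cmod_ge_0 (g u)).
    (* The size of g u is encoded in the radius, so a lower bound d0 for the radii bounds 1 + |g u|
       by / d0. *)
    exists (Rmin d (/ (1 + Cmod (g u)))). intros _. split; [|split; [apply Rmin_r|]].
    - apply Rmin_pos; auto. apply Rinv_0_lt_compat; lra.
    - intros w Hw. apply K. eapply Rlt_le_trans; [exact Hw|apply Rmin_l]. }
  destruct (choice_function _ _ _ H) as [d Hd].
  destruct (rect_lebesgue_number a b c e d) as [d0 [H0 K0]]; [intros; apply Hd; auto|].
  pose proof (Rinv_0_lt_compat _ H0). exists (/ d0 + 1)%R. split; [lra|].
  intros z Hz. destruct (K0 z Hz) as (u & Hu & Hzu & Hdu). destruct (Hd u Hu) as (D1 & D2 & D3).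
  specialize (D3 z Hzu). pose proof (Cmod_le_sub (g z) (g u)). pose proof (Cmod_ge_0 (g u)).
  assert (1 + Cmod (g u) <= / d0); [|lra].
  rewrite <- (Rinv_inv (1 + Cmod (g u))). apply Rinv_le_contravar; lra.
Qed.

(** If w is not a value, |g z - w| has a positive lower bound near each point. This bound is built
    into the radius, so that the covering makes it uniform. *)
Lemma rect_image_closed (a b c e : R) (g : C -> C) (w : C) : (forall z, in_rect a b c e z -> ccont g z) ->
  (forall eps, 0 < eps -> exists z, in_rect a b c e z /\ Cmod (g z - w) < eps) ->
  exists z, in_rect a b c e z /\ g z = w.
Proof.
  intros Hg Hw. apply NNPP. intros N.
  assert (H : forall u, exists d, in_rect a b c e u -> 0 < d /\
    forall z, Cmod (z - u) < d -> d <= Cmod (g z - w)).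
  { intros u. destruct (classic (in_rect a b c e u)) as [i|n]; [|exists 1%R; tauto].
    assert (Hu : 0 < Cmod (g u - w)) by (apply Cmod_pos_neq; intros E; apply N; exists u; auto).
    destruct (Hg u i (Cmod (g u - w) / 2)%R ltac:(lra)) as [d [Hd K]].
    exists (Rmin d (Cmod (g u - w) / 2)). intros _. split; [apply Rmin_pos; lra|].
    intros z Hz. specialize (K z (proj1 (Rlt_Rmin _ _ _ Hz))).
    eapply Rle_trans; [apply Rmin_r|]. pose proof (Cmod_sub_triangle (g u) (g z) w) as T.
    rewrite (Cmod_minus_sym (g u) (g z)) in T. lra. }
  destruct (choice_function _ _ _ H) as [d Hd].
  destruct (rect_lebesgue_number a b c e d) as [d0 [H0 K0]]; [intros; apply Hd; auto|].
  destruct (Hw d0 H0) as [z [Hz Hzw]].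
  destruct (K0 z Hz) as (u & Hu & Hzu & Hdu). destruct (Hd u Hu) as (D1 & D2).
  specialize (D2 z Hzu). lra.
Qed.

Lemma continuous_bounded (F : C -> C) : (forall z, ccont F z) ->
  forall R0, exists B, 0 < B /\ forall z, Cmod z <= R0 -> Cmod (F z) <= B.
Proof.
  intros HF R0. destruct (rect_bounded (- R0) R0 (- R0) R0 F) as [B [HB0 HB]]; auto.
  exists B. split; auto. intros z Hz. apply HB.
  pose proof (Cmod_fst z) as A1. pose proof (Cmod_snd z) as A2.
  split; apply Rabs_le_between; lra.
Qed.

Definition dot (v z : C) : R := (fst v * fst z + snd v * snd z)%R.

Lemma dot_bound (v z : C) : Rabs (dot v z) <= Cmod v * Cmod z.
Proof.
  replace (dot v z) with (fst (Cconj v * z)) by (unfold dot; simpl; ring).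
  eapply Rle_trans; [apply Cmod_fst|]. rewrite Cmod_mult, Cmod_conj. lra.
Qed.

Lemma halfplane_convex_closed (v w : C) (k : R) : convex_closed (fun z => (k <= dot v (z - w))).
Proof.
  split.
  - intros a b t Ha Hb Ht.
    replace (dot v (a + RtoC t * (b - a) - w)) with ((1 - t) * dot v (a - w) + t * dot v (b - w))%R
      by (unfold dot; simpl; ring). nra.
  - intros p Hp. destruct (Rle_dec k (dot v (p - w))) as [|n]; auto. exfalso.
    set (e := (k - dot v (p - w))%R). assert (He : 0 < e) by (unfold e; lra).
    pose proof (Cmod_ge_0 v).
    destruct (Hp (e / (2 * (Cmod v + 1)))%R) as [q [Hq Hqp]].
    { apply Rdiv_lt_0_compat; lra. }
    assert (E : (dot v (q - w) = dot v (p - w) + dot v (q - p))%R) by (unfold dot; simpl; ring).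
    pose proof (dot_bound v (q - p)) as B. pose proof (Rle_abs (dot v (q - p))).
    assert (Cmod v * Cmod (q - p) < e); [|unfold e in *; lra].
    pose proof (Cmod_ge_0 (q - p)).
    apply (Rmult_lt_compat_r (Cmod v + 1)) in Hqp; [|lra].
    replace (e / (2 * (Cmod v + 1)) * (Cmod v + 1))%R with (e / 2)%R in Hqp by (field; lra). nra.
Qed.

(* Shrinking an edge towards w sweeps a trapezoid, cut into two triangles in a
   half-plane that avoids w. *)
Lemma edge_shrink (g : C -> C) (w b c v : C) (k r : R) :
  (forall z, z <> w -> exists l, cderiv g z l) ->
  (0 < k) -> (dot v (b - w) = k)%R -> (dot v (c - w) = k)%R -> 0 < r <= 1 ->
  let b' := w + RtoC r * (b - w) in let c' := w + RtoC r * (c - w) in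
  Seg g b c - Seg g b' c' = Seg g b b' - Seg g c c'.
Proof.
  intros Hg Hk Hb Hc Hr b' c'.
  set (D := fun z => (r * k <= dot v (z - w))).
  assert (HD : convex_closed D) by apply halfplane_convex_closed.
  assert (Hrk : 0 < r * k) by nra.
  assert (HgD : forall z, D z -> exists l, cderiv g z l).
  { intros z Hz. apply Hg. intros ->. unfold D in Hz.
    replace (dot v (w - w)) with 0%R in Hz by (unfold dot; simpl; ring). lra. }
  assert (Db : D b) by (unfold D; nra). assert (Dc : D c) by (unfold D; nra).
  assert (Db' : D b').
  { unfold D, b'. replace (dot v _) with (r * dot v (b - w))%R by (unfold dot; simpl; ring). rewrite Hb; lra. }
  assert (Dc' : D c').
  { unfold D, c'. replace (dot v _) with (r * dot v (c - w))%R by (unfold dot; simpl; ring). rewrite Hc; lra. }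
  pose proof (goursat D g HD HgD b c c' Db Dc Dc') as T1.
  pose proof (goursat D g HD HgD b c' b' Db Dc' Db') as T2.
  unfold Tri in T1, T2.
  assert (S : forall x y, D x -> D y -> seg_ccont g x y).
  { intros x y Dx Dy t Ht. destruct (HgD (x + RtoC t * (y - x))) as [l Hl]; [apply (proj1 HD); auto|].
    eapply cderiv_ccont, Hl. }
  rewrite (Seg_rev g b c') in T1 by auto.
  rewrite (Seg_rev g b' c') in T2 by auto. rewrite (Seg_rev g b b') in T2 by auto.
  replace (Seg g b c - Seg g b' c') with ((Seg g b c + Seg g c c' + - Seg g b c') +
    (Seg g b c' + - Seg g b' c' + - Seg g b b') + Seg g b b' - Seg g c c') by ring.
  rewrite T1, T2. ring.
Qed.

(** * The Cauchy integral over the square *)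

Section Square.
Variables (F : C -> C) (R0 : R).
Hypothesis (HF : forall z, exists l, cderiv F z l).
Hypothesis (HR0 : 0 < R0).

(* The square with corners rho, i rho, -rho, -i rho then stays at distance at least
   1/2 from the disc of radius R0. *)
Let rho : R := (2 * R0 + 1)%R.

(** A side is indexed by the unit o at its start and ends at the rotated corner, so one estimate
    that is uniform in o serves all four sides. *)
Let corner (o : C) : C := RtoC rho * o.
Let edge (g : C -> C) (o : C) : C := Seg g (corner o) (corner (Ci * o)).

Definition square_integral (g : C -> C) : C :=
  edge g 1 + edge g Ci + edge g (Ci * Ci) + edge g (Ci * (Ci * Ci)).

Let Lam := square_integral.

Let on_square (z : C) : Prop :=
  exists o t, Cmod o = 1%R /\ 0 <= t <= 1 /\
    z = corner o + RtoC t * (corner (Ci * o) - corner o).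

(** Outward normal to the side that starts at the corner rho o. *)
Let normal (o : C) : C := o * (1 + Ci).

Let unit_sqr o : Cmod o = 1%R -> (fst o * fst o + snd o * snd o = 1)%R.
Proof. intros H. rewrite <- Cmod_sqr, H. ring. Qed.

Let normal_corner o : Cmod o = 1%R -> dot (normal o) (corner o) = rho.
Proof.
  intros H. apply unit_sqr in H. unfold dot, normal, corner; simpl.
  transitivity (rho * (fst o * fst o + snd o * snd o))%R; [ring|rewrite H; ring].
Qed.

Let normal_corner' o : Cmod o = 1%R -> dot (normal o) (corner (Ci * o)) = rho.
Proof.
  intros H. apply unit_sqr in H. unfold dot, normal, corner; simpl.
  transitivity (rho * (fst o * fst o + snd o * snd o))%R; [ring|rewrite H; ring].
Qed.

Let Cmod_normal o : Cmod o = 1%R -> Cmod (normal o) <= 2.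
Proof.
  intros H. unfold normal. rewrite Cmod_mult, H, Rmult_1_l.
  eapply Rle_trans; [apply Cmod_triangle|]. rewrite Cmod_1, Cmod_Ci. lra.
Qed.

Let Cmod_Ci_mult o : Cmod o = 1%R -> Cmod (Ci * o) = 1%R.
Proof. intros H. rewrite Cmod_mult, Cmod_Ci, H. ring. Qed.

Let normal_sub o w : Cmod o = 1%R -> Cmod w <= R0 ->
  (1 <= dot (normal o) (corner o - w)) /\
  dot (normal o) (corner (Ci * o) - w) = dot (normal o) (corner o - w).
Proof.
  intros Ho Hw.
  assert (E : forall z, dot (normal o) (z - w) = (dot (normal o) z - dot (normal o) w)%R)
    by (intros; unfold dot; simpl; ring).
  rewrite !E, normal_corner, normal_corner' by auto. split; auto.
  pose proof (dot_bound (normal o) w). pose proof (Rle_abs (dot (normal o) w)).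
  pose proof (Cmod_normal o Ho). pose proof (Cmod_ge_0 w). unfold rho. nra.
Qed.

Let Cmod_edge o : Cmod o = 1%R -> Cmod (corner (Ci * o) - corner o) <= 2 * rho.
Proof.
  intros Ho. replace (corner (Ci * o) - corner o) with (RtoC rho * (o * (Ci + - (1)))) by (unfold corner; ring).
  rewrite Cmod_real_scal by (unfold rho; lra). rewrite Cmod_mult, Ho.
  pose proof (Cmod_triangle Ci (- (1))) as T. rewrite Cmod_Ci, Cmod_m1 in T. unfold rho in *. nra.
Qed.

(** 3 rho is a corner plus the length bound 2 rho of a side, and 4 rho adds |w|. The lower bound
    holds because the normal component of z - w is at least 1 and the normal has modulus at most
    2. *)
Let on_square_facts z w : on_square z -> Cmod w <= R0 ->
  (Cmod z <= 3 * rho) /\ / 2 <= Cmod (z - w) <= 4 * rho.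
Proof.
  intros (o & t & Ho & Ht & ->) Hw. set (z := corner o + _).
  assert (Hz : Cmod z <= 3 * rho).
  { unfold z. eapply Rle_trans; [apply Cmod_triangle|].
    rewrite Cmod_real_scal by lra. pose proof (Cmod_edge o Ho).
    pose proof (Cmod_ge_0 (corner (Ci * o) - corner o)).
    unfold corner at 1. rewrite Cmod_real_scal, Ho by (unfold rho; lra). nra. }
  split; auto. split.
  - destruct (normal_sub o w Ho Hw) as [N1 N2].
    assert (E : dot (normal o) (z - w) = ((1 - t) * dot (normal o) (corner o - w)
       + t * dot (normal o) (corner (Ci * o) - w))%R) by (unfold dot, z; simpl; ring).
    rewrite N2 in E. pose proof (dot_bound (normal o) (z - w)).
    pose proof (Rle_abs (dot (normal o) (z - w))). pose proof (Cmod_normal o Ho).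
    pose proof (Cmod_ge_0 (z - w)). nra.
  - pose proof (Cmod_triangle z (- w)) as T. rewrite Cmod_opp in T. unfold rho in *.
    change (Cmod (z + - w) <= 4 * (2 * R0 + 1)). lra.
Qed.

Let ok (g : C -> C) : Prop := forall z, on_square z -> ccont g z.

Let ok_seg g o : ok g -> Cmod o = 1%R -> seg_ccont g (corner o) (corner (Ci * o)).
Proof. intros H Ho t Ht. apply H. exists o, t; auto. Qed.

Let unit_corners : Cmod 1 = 1%R /\ Cmod Ci = 1%R /\ Cmod (Ci * Ci) = 1%R /\ Cmod (Ci * (Ci * Ci)) = 1%R.
Proof. repeat split; repeat apply Cmod_Ci_mult; try apply Cmod_1; try apply Cmod_Ci. Qed.

Let Lam_plus g h : ok g -> ok h -> Lam (fun z => g z + h z) = Lam g + Lam h.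
Proof.
  intros Hg Hh. destruct unit_corners as (U1 & U2 & U3 & U4).
  unfold Lam, square_integral, edge. rewrite !Seg_plus by (apply ok_seg; auto). ring.
Qed.

Let Lam_scal c g : ok g -> Lam (fun z => c * g z) = c * Lam g.
Proof.
  intros Hg. destruct unit_corners as (U1 & U2 & U3 & U4).
  unfold Lam, square_integral, edge. rewrite !Seg_scal by (apply ok_seg; auto). ring.
Qed.

Let Lam_ext g h : (forall z, on_square z -> g z = h z) -> Lam g = Lam h.
Proof.
  intros H. destruct unit_corners as (U1 & U2 & U3 & U4).
  assert (E : forall o, Cmod o = 1%R -> edge g o = edge h o).
  { intros o Ho. apply Seg_ext. intros t Ht. apply H. exists o, t; auto. }
  unfold Lam, square_integral. rewrite !E; auto.
Qed.

(** 16 rho: four sides of length at most 2 rho, times the factor 2 of [Seg_bound]. *)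
Let Lam_bound g M : ok g -> (forall z, on_square z -> Cmod (g z) <= M) ->
  (Cmod (Lam g) <= 16 * rho * M).
Proof.
  intros Hg HM. destruct unit_corners as (U1 & U2 & U3 & U4).
  assert (E : forall o, Cmod o = 1%R -> Cmod (edge g o) <= 4 * rho * M).
  { intros o Ho. assert (HM0 : 0 <= M).
    { eapply Rle_trans; [apply Cmod_ge_0|apply (HM (corner o + RtoC 0 * (corner (Ci * o) - corner o)))].
      exists o, 0%R. repeat split; auto; lra. }
    eapply Rle_trans; [apply (Seg_bound _ _ _ M)|].
    - apply ok_seg; auto.
    - intros t Ht. apply HM. exists o, t; auto.
    - pose proof (Cmod_edge o Ho). nra. }
  unfold Lam, square_integral.
  pose proof (E _ U1). pose proof (E _ U2). pose proof (E _ U3). pose proof (E _ U4).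
  pose proof (Cmod_triangle (edge g 1 + edge g Ci + edge g (Ci * Ci)) (edge g (Ci * (Ci * Ci)))).
  pose proof (Cmod_triangle (edge g 1 + edge g Ci) (edge g (Ci * Ci))).
  pose proof (Cmod_triangle (edge g 1) (edge g Ci)). lra.
Qed.

(** Cauchy's theorem with a removable singularity at w. By [edge_shrink] the square may be scaled by
    r towards w, the radial segments cancelling in pairs; as g is bounded near w, the integral over
    the small square is O(r). *)
Let square_cauchy (g : C -> C) (w : C) (d M : R) : Cmod w <= R0 ->
  (forall z, z <> w -> exists l, cderiv g z l) -> 0 < d ->
  (forall z, z <> w -> Cmod (z - w) < d -> Cmod (g z) <= M) -> Lam g = 0.
Proof.
  intros Hw Hg Hd HM. destruct unit_corners as (U1 & U2 & U3 & U4).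
  set (pt := fun r o => w + RtoC r * (corner o - w)).
  assert (HS : forall r o, 0 < r <= 1 -> Cmod o = 1%R ->
     edge g o - Seg g (pt r o) (pt r (Ci * o)) = Seg g (corner o) (pt r o) - Seg g (corner (Ci * o)) (pt r (Ci * o))).
  { intros r o Hr Ho. destruct (normal_sub o w Ho Hw) as [N1 N2].
    apply (edge_shrink g w (corner o) (corner (Ci * o)) (normal o) (dot (normal o) (corner o - w)) r); auto. lra. }
  assert (HE : forall r, 0 < r <= 1 -> Lam g = Seg g (pt r 1) (pt r (Ci * 1)) + Seg g (pt r Ci) (pt r (Ci * Ci))
    + Seg g (pt r (Ci * Ci)) (pt r (Ci * (Ci * Ci))) + Seg g (pt r (Ci * (Ci * Ci))) (pt r (Ci * (Ci * (Ci * Ci))))).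
  { intros r Hr.
    pose proof (HS r 1 Hr U1) as E1. pose proof (HS r Ci Hr U2) as E2.
    pose proof (HS r _ Hr U3) as E3. pose proof (HS r _ Hr U4) as E4.
    unfold Lam, square_integral.
    replace (Ci * 1) with Ci in * by ring.
    replace (Ci * (Ci * (Ci * Ci))) with (RtoC 1) in * by ceq.
    set (S1 := Seg g (corner 1) (pt r 1)) in *. set (S2 := Seg g (corner Ci) (pt r Ci)) in *.
    set (S3 := Seg g (corner (Ci * Ci)) (pt r (Ci * Ci))) in *.
    set (S4 := Seg g (corner (Ci * (Ci * Ci))) (pt r (Ci * (Ci * Ci)))) in *.
    match type of E1 with (?x - ?y = _) => assert (E1' : x = y + (S1 - S2)) by (rewrite <- E1; ring) end.
    match type of E2 with (?x - ?y = _) => assert (E2' : x = y + (S2 - S3)) by (rewrite <- E2; ring) end.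
    match type of E3 with (?x - ?y = _) => assert (E3' : x = y + (S3 - S4)) by (rewrite <- E3; ring) end.
    match type of E4 with (?x - ?y = _) => assert (E4' : x = y + (S4 - S1)) by (rewrite <- E4; ring) end.
    rewrite E1', E2', E3', E4'. ring. }
  assert (Hrho : 0 < rho) by (unfold rho; lra).
  assert (HM0 : 0 <= M).
  { eapply Rle_trans; [apply Cmod_ge_0|apply (HM (w + RtoC (d / 2)))].
    - intros E. assert (E2 : RtoC (d / 2) = 0) by (replace (RtoC (d / 2)) with (w + RtoC (d / 2) - w) by ring; rewrite E; ring).
      apply RtoC_inj in E2. lra.
    - replace (w + RtoC (d / 2) - w) with (RtoC (d / 2)) by ring. rewrite Cmod_R, Rabs_pos_eq; lra. }
  assert (HB : forall r, 0 < r <= 1 -> r * (4 * rho) < d -> Cmod (Lam g) <= 16 * rho * M * r).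
  { intros r Hr Hrd.
    assert (E : forall o, Cmod o = 1%R -> Cmod (Seg g (pt r o) (pt r (Ci * o)%C)) <= 4 * rho * M * r).
    { intros o Ho.
      assert (Hpt : forall t, pt r o + RtoC t * (pt r (Ci * o) - pt r o) - w =
        RtoC r * (corner o + RtoC t * (corner (Ci * o) - corner o) - w)) by (intros; unfold pt; ring).
      assert (Hne : forall t, 0 <= t <= 1 -> pt r o + RtoC t * (pt r (Ci * o) - pt r o) <> w /\
         (Cmod (pt r o + RtoC t * (pt r (Ci * o)%C - pt r o) - w) < d)).
      { intros t Ht. assert (HO : on_square (corner o + RtoC t * (corner (Ci * o) - corner o))) by (exists o, t; auto).
        destruct (on_square_facts _ w HO Hw) as [_ [O1 O2]]. split.
        - intros E. specialize (Hpt t). rewrite E in Hpt. replace (w - w) with (RtoC 0) in Hpt by ring.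
          apply (f_equal Cmod) in Hpt. rewrite Cmod_0, Cmod_real_scal in Hpt by lra. nra.
        - rewrite Hpt, Cmod_real_scal by lra. nra. }
      eapply Rle_trans; [apply (Seg_bound _ _ _ M)|].
      - intros t Ht. destruct (Hg _ (proj1 (Hne t Ht))) as [l Hl]. eapply cderiv_ccont, Hl.
      - intros t Ht. apply HM; apply Hne; auto.
      - replace (pt r (Ci * o) - pt r o) with (RtoC r * (corner (Ci * o) - corner o)) by (unfold pt; ring).
        rewrite Cmod_real_scal by lra. pose proof (Cmod_edge o Ho).
        pose proof (Cmod_ge_0 (corner (Ci * o) - corner o)).
        assert (0 <= M * r) by nra. nra. }
    rewrite (HE r Hr).
    pose proof (E _ U1). pose proof (E _ U2). pose proof (E _ U3). pose proof (E _ U4).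
    match goal with |- (Cmod (?a + ?b + ?c + ?e) <= _) =>
      pose proof (Cmod_triangle (a + b + c) e); pose proof (Cmod_triangle (a + b) c);
      pose proof (Cmod_triangle a b) end. lra. }
  apply Cmod_eq_0. apply Rle_antisym; [|apply Cmod_ge_0].
  destruct (Rle_dec (Cmod (Lam g)) 0) as [|n]; auto. exfalso. apply Rnot_le_lt in n.
  (* The second term puts the scaled square into the disc of radius d about w; the third makes the
     bound 16 rho M r at most half of |Lam g|, a contradiction. *)
  set (r := Rmin 1 (Rmin (d / (8 * rho)) (Cmod (Lam g) / (32 * rho * (M + 1))))).
  assert (r1 : r <= 1) by apply Rmin_l.
  assert (r2 : r <= d / (8 * rho)) by (eapply Rle_trans; [apply Rmin_r|apply Rmin_l]).
  assert (r3 : r <= Cmod (Lam g) / (32 * rho * (M + 1))) by (eapply Rle_trans; [apply Rmin_r|apply Rmin_r]).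
  assert (HrM : 0 < 32 * rho * (M + 1)) by (apply Rmult_lt_0_compat; lra).
  assert (r0 : 0 < r).
  { repeat apply Rmin_pos; try lra; apply Rdiv_lt_0_compat; lra. }
  assert (K2 : r * (8 * rho) <= d).
  { apply (Rmult_le_compat_r (8 * rho)) in r2; [|lra]. replace (d / (8 * rho) * (8 * rho))%R with d in r2 by (field; lra). lra. }
  assert (K3 : r * (32 * rho * (M + 1)) <= Cmod (Lam g)).
  { apply (Rmult_le_compat_r (32 * rho * (M + 1))) in r3; [|lra].
    replace (Cmod (Lam g) / (32 * rho * (M + 1)) * (32 * rho * (M + 1)))%R with (Cmod (Lam g)) in r3 by (field; nra). lra. }
  specialize (HB r ltac:(lra) ltac:(nra)).
  assert (0 <= r * rho * M) by (apply Rmult_le_pos; nra). nra.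
Qed.

Let ker (y z : C) : C := / (z - y).
(** Classically 2 pi i; used here only through a lower bound and Lipschitz dependence on y. *)
Let J (y : C) : C := Lam (ker y).

Let on_square_neq z y : on_square z -> Cmod y <= R0 -> z <> y.
Proof.
  intros Hz Hy E. destruct (on_square_facts z y Hz Hy) as [_ [H _]]. subst z.
  replace (y - y) with (RtoC 0) in H by ring. rewrite Cmod_0 in H. lra.
Qed.

Let ker_ok y : Cmod y <= R0 -> ok (ker y).
Proof. intros Hy z Hz. apply ccont_ext_inv. apply on_square_neq; auto. Qed.

Let ker_bound y z : Cmod y <= R0 -> on_square z -> Cmod (ker y z) <= 2.
Proof.
  intros Hy Hz. destruct (on_square_facts z y Hz Hy) as [_ [H _]]. unfold ker.
  rewrite Cmod_inv by (apply Csub_neq_0, on_square_neq; auto).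
  rewrite <- (Rinv_inv 2). apply Rinv_le_contravar; lra.
Qed.

Let bounded_on g M := ok g /\ forall z, on_square z -> Cmod (g z) <= M.

Let Lam_bounded g M : bounded_on g M -> Cmod (Lam g) <= 16 * rho * M.
Proof. intros [Hg HM]. apply Lam_bound; auto. Qed.

Let bounded_ker g M y : Cmod y <= R0 -> bounded_on g M -> bounded_on (fun z => g z * ker y z) (2 * M).
Proof.
  intros Hy [Hg HM]. split.
  - intros z Hz. apply ccont_mult; [auto|apply ker_ok; auto].
  - intros z Hz. rewrite Cmod_mult, Rmult_comm. specialize (HM z Hz).
    apply Rmult_le_compat; auto; apply Cmod_ge_0.
Qed.

Let ok_ker g y : Cmod y <= R0 -> ok g -> ok (fun z => g z * ker y z).
Proof. intros Hy Hg z Hz. apply ccont_mult; [auto|apply ker_ok; auto]. Qed.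

(** The resolvent identity 1/(z - y) - 1/(z - x) = (y - x) / ((z - y) (z - x)) under the
    integral. *)
Let Lam_ker_difference g x y : Cmod x <= R0 -> Cmod y <= R0 -> ok g ->
  Lam (fun z => g z * ker y z) = Lam (fun z => g z * ker x z) + (y - x) * Lam (fun z => g z * ker y z * ker x z).
Proof.
  intros Hx Hy Hg.
  rewrite <- Lam_scal by (repeat apply ok_ker; auto).
  rewrite <- (Lam_plus (fun z => g z * ker x z)).
  - apply Lam_ext. intros z Hz. unfold ker.
    pose proof (Csub_neq_0 _ _ (on_square_neq z y Hz Hy)).
    pose proof (Csub_neq_0 _ _ (on_square_neq z x Hz Hx)). field. auto.
  - apply ok_ker; auto.
  - intros z Hz. apply ccont_mult; [apply ccont_const|]. apply ok_ker; [auto|apply ok_ker; auto|auto].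
Qed.

(** The imaginary part of dz / (z - y) is the angle swept as seen from y: per unit of t it is rho
    times the normal component of z - y, at least 1, over |z - y|^2, at most (4 rho)^2. *)
Let edge_ker_lower y o : Cmod y <= R0 -> Cmod o = 1%R ->
  (/ (16 * rho) <= snd (edge (ker y) o)).
Proof.
  intros Hy Ho. assert (Hrho : 0 < rho) by (unfold rho; lra).
  unfold edge, Seg. set (b := corner o). set (c := corner (Ci * o)).
  assert (Hc : forall t, 0 <= t <= 1 -> rcont (fun t => ker y (b + RtoC t * (c - b))) t).
  { intros t Ht. apply seg_rcont; auto. apply ok_seg; auto. }
  rewrite <- (CInt_scal (c - b) (fun t => ker y (b + RtoC t * (c - b)))) by (auto; lra).
  unfold CInt. cbn [snd].
  set (h := fun t => snd ((c - b) * ker y (b + RtoC t * (c - b)))).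
  assert (Hh : ex_RInt h 0 1).
  { apply (rcont_ex_RInt (fun t => (c - b) * ker y (b + RtoC t * (c - b)))); [lra|].
    intros t Ht. apply rcont_mult; [apply rcont_const|auto]. }
  replace (/ (16 * rho))%R with (RInt (fun _ => / (16 * rho))%R 0 1) by (rewrite RInt_const; unfold scal; simpl; unfold mult; simpl; ring).
  apply RInt_le; [lra|apply ex_RInt_const|exact Hh|].
  intros t Ht. unfold h.
  set (z := b + RtoC t * (c - b)).
  assert (Hz : on_square z) by (exists o, t; repeat split; auto; lra).
  destruct (on_square_facts z y Hz Hy) as [_ [H1 H2]].
  destruct (normal_sub o y Ho Hy) as [N1 N2].
  assert (EN : dot (normal o) (z - y) = dot (normal o) (b - y)).
  { transitivity ((1 - t) * dot (normal o) (b - y) + t * dot (normal o) (c - y))%R.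
    - unfold dot, z; simpl; ring.
    - unfold c, b. rewrite N2. ring. }
  unfold ker.
  assert (E : snd ((c - b) * / (z - y)) = (rho * dot (normal o) (z - y) / (Cmod (z - y) * Cmod (z - y)))%R).
  { assert (G : forall n u, 0 < Cmod u -> snd (RtoC rho * (Ci * n) * / u) = (rho * dot n u / (Cmod u * Cmod u))%R).
    { intros n u Hu. assert (Hs : 0 < Cmod u * Cmod u) by nra. rewrite Cmod_sqr in Hs |- *.
      unfold dot. simpl. field. nra. }
    replace (c - b) with (RtoC rho * (Ci * normal o)) by (unfold c, b, corner, normal; ceq).
    apply G. lra. }
  rewrite E, EN.
  apply Rle_trans with (rho * 1 / (4 * rho * (4 * rho)))%R.
  - right. field. lra.
  - apply Rmult_le_compat.
    + nra.
    + left. apply Rinv_0_lt_compat. nra.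
    + apply Rmult_le_compat_l; [lra|]. exact N1.
    + apply Rinv_le_contravar; nra.
Qed.

Let J_lower y : Cmod y <= R0 -> / (16 * rho) <= Cmod (J y).
Proof.
  intros Hy. destruct unit_corners as (U1 & U2 & U3 & U4).
  pose proof (edge_ker_lower y _ Hy U1). pose proof (edge_ker_lower y _ Hy U2).
  pose proof (edge_ker_lower y _ Hy U3). pose proof (edge_ker_lower y _ Hy U4).
  assert (0 < / (16 * rho)) by (apply Rinv_0_lt_compat; unfold rho; lra).
  eapply Rle_trans; [|apply Cmod_snd]. eapply Rle_trans; [|apply Rle_abs].
  unfold J, Lam, square_integral. cbn [snd Cplus]. unfold Cplus; cbn [snd]. lra.
Qed.

Let F_ccont z : ccont F z.
Proof. destruct (HF z) as [l Hl]. eapply cderiv_ccont, Hl. Qed.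

Let inc (x z : C) : C := F z + - F x.

Let inc_ok x : ok (inc x).
Proof. intros z _. apply ccont_plus; [apply F_ccont|apply ccont_const]. Qed.

Let Q (x y : C) : C := Lam (fun z => inc x z * ker x z * ker y z).

(** The difference quotient of F at x is holomorphic off x and bounded near x. *)
Let cauchy_zero x : Cmod x <= R0 -> Lam (fun z => inc x z * ker x z) = 0.
Proof.
  intros Hx. destruct (HF x) as [l Hl]. destruct (Hl 1%R ltac:(lra)) as [d [Hd K]].
  apply (square_cauchy _ x d (1 + Cmod l)%R); auto.
  - intros z Hz. destruct (HF z) as [m Hm].
    assert (Hzx : z - x <> 0) by (apply Csub_neq_0; auto).
    pose proof (cderiv_inv _ Hzx) as Hi.
    assert (Hi' : cderiv (fun w => / (w - x)) z (- / ((z - x) * (z - x)))).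
    { apply (cderiv_shift (fun w => / w) z (- x)). exact Hi. }
    exists ((m * ker x z + inc x z * - / ((z - x) * (z - x)))%C).
    apply (cderiv_mult (inc x)); [|exact Hi'].
    intros eps He. destruct (Hm eps He) as [d' [Hd' K']]. exists d'; split; auto.
    intros w Hw. unfold inc. replace (F w + - F x - (F z + - F x)) with (F w - F z) by ring. auto.
  - intros z Hz Hzd. unfold inc, ker. 
    assert (Hzx : z - x <> 0) by (apply Csub_neq_0; auto).
    assert (Hp : 0 < Cmod (z - x)) by (apply Cmod_gt_0; auto).
    specialize (K z Hzd).
    pose proof (Cmod_le_sub (F z - F x) (l * (z - x))) as T. rewrite Cmod_mult in T.
    rewrite Cmod_mult, Cmod_inv by auto.
    apply Rmult_le_reg_r with (Cmod (z - x)); auto.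
    rewrite Rmult_assoc, Rinv_l by lra. change (F z + - F x) with (F z - F x). lra.
Qed.

(** The integral of (F z - F x) / (z - y) is computed twice: by splitting F z - F x at F y, and by
    moving the pole from y to x with [Lam_ker_difference]. *)
Let cauchy_increment x y : Cmod x <= R0 -> Cmod y <= R0 -> (F y - F x) * J y = (y - x) * Q x y.
Proof.
  intros Hx Hy.
  assert (A : Lam (fun z => inc x z * ker y z) = (F y - F x) * J y).
  { rewrite (Lam_ext _ (fun z => inc y z * ker y z + (F y - F x) * ker y z)) by (intros; unfold inc; ring).
    rewrite Lam_plus, cauchy_zero, Lam_scal by (auto; apply ok_ker; auto;
      intros z _; apply ccont_const).
    unfold J. ring. }
  rewrite <- A, (Lam_ker_difference (inc x) x y), cauchy_zero by auto.
  rewrite (Lam_ext _ (fun z => inc x z * ker x z * ker y z)) by (intros; ring). unfold Q. ring.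
Qed.

(** With q = Q / J the increment is F y - F x = q x y (y - x). The derivative is q x x, and the
    remainder is quadratic because Q and J are Lipschitz in y while J stays away from 0. *)
Lemma second_order_bounds : exists (D : C -> C) (L M : R), 0 < L /\ 0 < M /\
  forall x y, Cmod x <= R0 -> Cmod y <= R0 ->
    (Cmod (D x) <= L) /\ Cmod (F y - F x) <= L * Cmod (y - x) /\
    (Cmod (F y - F x - D x * (y - x)) <= M * (Cmod (y - x) * Cmod (y - x))).
Proof.
  assert (Hrho : 1 < rho) by (unfold rho; lra).
  destruct (continuous_bounded F F_ccont (3 * rho)) as [B [HB0 HB]].
  set (j := (/ (16 * rho))%R). assert (Hj : 0 < j) by (apply Rinv_0_lt_compat; lra).
  assert (Hinc : forall x z, Cmod x <= R0 -> on_square z -> Cmod (inc x z) <= 2 * B).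
  { intros x z Hx Hz. unfold inc. eapply Rle_trans; [apply Cmod_triangle|]. rewrite Cmod_opp.
    destruct (on_square_facts z x Hz Hx) as [Hz' _].
    pose proof (HB z Hz'). pose proof (HB x ltac:(unfold rho; lra)). lra. }
  (* On the square |F z - F x| is at most 2 B and each kernel contributes a factor 2: two kernels in
     Q, three in a difference of Q, two in a difference of J. *)
  set (Bq := (16 * rho * (8 * B))%R). set (Bq' := (16 * rho * (16 * B))%R). set (Bj := (16 * rho * 4)%R).
  assert (HBq : 0 < Bq) by (unfold Bq; nra). assert (HBq' : 0 < Bq') by (unfold Bq'; nra).
  assert (HBj : 0 < Bj) by (unfold Bj; nra).
  assert (Hb : forall x, Cmod x <= R0 -> bounded_on (inc x) (2 * B)) by (intros; split; auto).
  assert (HQ : forall x y, Cmod x <= R0 -> Cmod y <= R0 -> Cmod (Q x y) <= Bq).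
  { intros x y Hx Hy. unfold Bq. replace (8 * B)%R with (2 * (2 * (2 * B)))%R by ring.
    apply Lam_bounded. repeat apply bounded_ker; auto. }
  assert (Hdiff : forall g M x y, Cmod x <= R0 -> Cmod y <= R0 -> bounded_on g M ->
     Cmod (Lam (fun z => g z * ker y z) - Lam (fun z => g z * ker x z)) <= 16 * rho * (4 * M) * Cmod (y - x)).
  { intros g M x y Hx Hy Hg. rewrite (Lam_ker_difference g x y) by (auto; apply Hg).
    match goal with |- Cmod (?q + ?v * ?w - ?q) <= _ => replace (q + v * w - q) with (v * w) by ring end.
    rewrite Cmod_mult, Rmult_comm. apply Rmult_le_compat_r; [apply Cmod_ge_0|].
    replace (4 * M)%R with (2 * (2 * M))%R by ring. apply Lam_bounded. repeat apply bounded_ker; auto. }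
  assert (HQ' : forall x y, Cmod x <= R0 -> Cmod y <= R0 -> Cmod (Q x y - Q x x) <= Bq' * Cmod (y - x)).
  { intros x y Hx Hy. unfold Bq'. replace (16 * B)%R with (4 * (2 * (2 * B)))%R by ring.
    apply (Hdiff (fun z => inc x z * ker x z)); auto. }
  assert (HJ' : forall x y, Cmod x <= R0 -> Cmod y <= R0 -> Cmod (J y - J x) <= Bj * Cmod (y - x)).
  { intros x y Hx Hy. unfold J, Bj.
    rewrite (Lam_ext (ker y) (fun z => 1 * ker y z)), (Lam_ext (ker x) (fun z => 1 * ker x z)) by (intros; ring).
    replace (16 * rho * 4)%R with (16 * rho * (4 * 1))%R by ring. apply (Hdiff (fun _ => 1)); auto.
    split; [intros z _; apply ccont_const|]. intros z _. rewrite Cmod_1. lra. }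
  assert (HJ0 : forall y, Cmod y <= R0 -> J y <> 0).
  { intros y Hy. apply Cmod_gt_0. pose proof (J_lower y Hy). fold j in H. lra. }
  assert (Hinv : forall y, Cmod y <= R0 -> 0 < / Cmod (J y) <= / j).
  { intros y Hy. pose proof (J_lower y Hy). fold j in H. split; [apply Rinv_0_lt_compat; lra|].
    apply Rinv_le_contravar; auto. }
  assert (Hji : 0 < / j) by (apply Rinv_0_lt_compat; auto).
  set (q := fun x y => Q x y / J y).
  assert (Hq : forall x y, Cmod x <= R0 -> Cmod y <= R0 -> Cmod (q x y) <= Bq * / j).
  { intros x y Hx Hy. unfold q. rewrite Cmod_div by auto.
    apply Rmult_le_compat; [apply Cmod_ge_0| left; apply Hinv; auto|auto|apply Hinv; auto]. }
  assert (HFq : forall x y, Cmod x <= R0 -> Cmod y <= R0 -> F y - F x = q x y * (y - x)).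
  { intros x y Hx Hy. unfold q. transitivity ((y - x) * Q x y / J y).
    - rewrite <- cauchy_increment by auto. field; auto.
    - field; auto. }
  exists (fun x => q x x), (Bq * / j)%R, (Bq' * / j + Bq * / j * (Bj * / j))%R.
  split; [nra|]. split.
  { assert (0 < Bq' * / j) by nra. assert (0 < Bq * / j) by nra. assert (0 < Bj * / j) by nra. nra. }
  intros x y Hx Hy. split; [auto|]. split.
  { rewrite HFq by auto. rewrite Cmod_mult. apply Rmult_le_compat_r; [apply Cmod_ge_0|auto]. }
  rewrite HFq by auto. replace (q x y * (y - x) - q x x * (y - x)) with ((q x y - q x x) * (y - x)) by ring.
  rewrite Cmod_mult, <- Rmult_assoc. apply Rmult_le_compat_r; [apply Cmod_ge_0|].
  assert (E : q x y - q x x = (Q x y - Q x x) / J y - q x x * ((J y - J x) / J y)).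
  { unfold q. field. auto. }
  rewrite E. eapply Rle_trans; [apply Cmod_triangle|]. rewrite Cmod_opp, Cmod_mult, !Cmod_div by auto.
  specialize (HQ' x y Hx Hy). specialize (HJ' x y Hx Hy). specialize (Hq x x Hx Hx).
  destruct (Hinv y Hy) as [I1 I2].
  assert (T1 : Cmod (Q x y - Q x x) / Cmod (J y) <= Bq' * Cmod (y - x) * / j).
  { apply Rmult_le_compat; auto; [apply Cmod_ge_0|lra]. }
  assert (T2 : Cmod (J y - J x) / Cmod (J y) <= Bj * Cmod (y - x) * / j).
  { apply Rmult_le_compat; auto; [apply Cmod_ge_0|lra]. }
  assert (T3 : Cmod (q x x) * (Cmod (J y - J x) / Cmod (J y)) <= Bq * / j * (Bj * Cmod (y - x) * / j)).
  { apply Rmult_le_compat; auto; [apply Cmod_ge_0|].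
    apply Rmult_le_pos; [apply Cmod_ge_0|lra]. }
  lra.
Qed.
End Square.

(** * Differential equations *)

(** All later arguments use F through this predicate only; being stable under change of sign, it
    lets time be reversed. *)
Definition regular (F D : C -> C) : Prop :=
  (forall z, cderiv F z (D z)) /\
  forall R0, 0 < R0 -> exists L M : R, 0 < L /\ 0 < M /\
    forall x y, Cmod x <= R0 -> Cmod y <= R0 ->
    (Cmod (D x) <= L) /\ Cmod (F y - F x) <= L * Cmod (y - x) /\
    (Cmod (F y - F x - D x * (y - x)) <= M * (Cmod (y - x) * Cmod (y - x))).

Lemma cderiv_unique (F : C -> C) (z l m : C) : cderiv F z l -> cderiv F z m -> l = m.
Proof.
  rewrite !cderiv_iff. intros Hl Hm.
  rewrite <- (is_C_derive_unique _ _ _ Hl). apply is_C_derive_unique, Hm.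
Qed.

Lemma entire_regular (F : C -> C) : entire F -> exists D, regular F D.
Proof.
  intros HF. 
  assert (HF' : forall z, exists l, cderiv F z l).
  { intros z. destruct (HF z) as [l Hl]. exists l. apply cderiv_iff, Hl. }
  exists (C_derive F).
  assert (HD : forall z, cderiv F z (C_derive F z)).
  { intros z. destruct (HF z) as [l Hl]. rewrite (is_C_derive_unique _ _ _ Hl). apply cderiv_iff, Hl. }
  split; auto.
  intros R0 HR0.
  (* The margin 1 leaves a full neighbourhood of every x with |x| at most R0, on which the quadratic
     remainder identifies D x with the derivative. *)
  destruct (second_order_bounds F (R0 + 1) HF' ltac:(lra)) as (D & L & M & HL & HM & K).
  exists L, M. split; auto. split; auto.
  intros x y Hx Hy.
  assert (E : C_derive F x = D x).
  { apply (cderiv_unique F x); auto.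
    intros eps He. exists (Rmin 1 (eps / M)). split; [apply Rmin_pos; [lra|apply Rdiv_lt_0_compat; lra]|].
    intros w Hw. destruct (Rlt_Rmin _ _ _ Hw) as [H1 H2].
    destruct (K x w) as (_ & _ & K3); [lra| |].
    - pose proof (Cmod_le_sub w x). lra.
    - eapply Rle_trans; [exact K3|]. rewrite <- Rmult_assoc.
      apply Rmult_le_compat_r; [apply Cmod_ge_0|].
      apply (Rmult_lt_compat_l M) in H2; auto. replace (M * (eps / M))%R with eps in H2 by (field; lra). lra. }
  rewrite E. apply K; lra.
Qed.

(** * Real induction and differential inequalities *)

(** Connectedness of [0, T], with closedness and openness of A merged into one hypothesis: a point
    approached by A has a neighbourhood in A. *)
Lemma interval_clopen (A : R -> Prop) (T : R) : 0 <= T -> A 0%R ->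
  (forall r, 0 <= r <= T ->
    (forall eps, 0 < eps -> exists r', 0 <= r' <= T /\ Rabs (r' - r) < eps /\ A r') ->
    exists eps, 0 < eps /\ forall r', 0 <= r' <= T -> Rabs (r' - r) < eps -> A r') ->
  A T.
Proof.
  intros HT H0 H.
  set (E := fun t => (0 <= t <= T) /\ forall s, 0 <= s <= t -> A s).
  destruct (completeness E) as [m [Hm1 Hm2]].
  - exists T. intros t [Ht _]. lra.
  - exists 0%R. split; [lra|]. intros s Hs. replace s with 0%R by lra. auto.
  - assert (E0 : E 0%R) by (split; [lra|intros s Hs; replace s with 0%R by lra; auto]).
    assert (Hm : 0 <= m <= T).
    { split; [apply Hm1; auto|]. apply Hm2. intros t [Ht _]. lra. }
    assert (Hlt : forall eps, 0 < eps -> exists t, E t /\ m - eps < t).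
    { intros eps He. apply NNPP. intros N. assert (m <= m - eps); [|lra].
      apply Hm2. intros t Ht. destruct (Rle_dec t (m - eps)); auto. exfalso. apply N. exists t. split; auto; lra. }
    destruct (H m Hm) as [eps [He K]].
    { intros eps He. destruct (Hlt eps He) as [t [[Ht At] Htm]]. exists t. split; auto. split.
      - assert (t <= m) by (apply Hm1; split; auto). apply Rabs_def1; lra.
      - apply At; lra. }
    destruct (Hlt eps He) as [t [[Ht At] Htm]].
    assert (HE : E (Rmin T (m + eps / 2))).
    { split. { split; [apply Rmin_glb; lra|apply Rmin_l]. }
      intros s Hs. assert (s <= T) by (eapply Rle_trans; [apply Hs|apply Rmin_l]).
      assert (s <= m + eps / 2) by (eapply Rle_trans; [apply Hs|apply Rmin_r]).
      destruct (Rle_dec s t). { apply At; lra. }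
      apply K; [lra|]. apply Rabs_def1; lra. }
    assert (Hle : Rmin T (m + eps / 2) <= m) by (apply Hm1; auto).
    destruct HE as [_ HE]. unfold Rmin in *. destruct (Rle_dec T (m + eps / 2)).
    + apply HE; lra.
    + lra.
Qed.

Lemma nonincreasing_of_derive (h h' : R -> R) (a b : R) : a <= b ->
  (forall t, a <= t <= b -> is_derive h t (h' t) /\ h' t <= 0) -> h b <= h a.
Proof.
  intros Hab H.
  destruct (MVT_gen h a b h') as [c [Hc E]].
  - intros x Hx. rewrite Rmin_left, Rmax_right in Hx by lra. apply H; lra.
  - intros x Hx. rewrite Rmin_left, Rmax_right in Hx by lra. apply continuity_pt_filterlim.
    apply (ex_derive_continuous (V := R_NormedModule)). exists (h' x). apply H; lra.
  - rewrite Rmin_left, Rmax_right in Hc by lra. destruct (H c Hc). nra.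
Qed.

Lemma is_derive_continuous_eps (g : R -> R) (t l : R) : is_derive g t l ->
  forall eps, 0 < eps -> exists d, 0 < d /\ forall s, Rabs (s - t) < d -> Rabs (g s - g t) < eps.
Proof.
  intros H eps He.
  assert (C : continuous g t) by (apply (ex_derive_continuous (V := R_NormedModule)); exists l; auto).
  destruct (proj1 (filterlim_locally _ _) C (mkposreal _ He)) as [d K].
  exists d. split; [apply cond_pos|]. intros s Hs. apply (K s Hs).
Qed.

(** The inequality for g' is available only below m. The exponential bound stays below m, so by
    continuity g never leaves the range where it applies. *)
Lemma barrier (g g' : R -> R) (T k m : R) : 0 <= T -> 0 <= k -> 0 <= g 0 ->
  (forall t, 0 <= t <= T -> is_derive g t (g' t)) ->
  (forall t, 0 <= t <= T -> g t < m -> g' t <= k * g t) ->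
  (g 0 * exp (k * T) < m) ->
  forall t, 0 <= t <= T -> g t <= g 0 * exp (k * t).
Proof.
  intros HT Hk H0 Hd Hg Hm.
  assert (Hexp : forall s, 0 <= s <= T -> g 0 * exp (k * s) <= g 0 * exp (k * T)).
  { intros s Hs. apply Rmult_le_compat_l; auto. destruct (Req_dec (k * s) (k * T)) as [->|n]; [lra|].
    left. apply exp_increasing. nra. }
  assert (Hstep : forall t, 0 <= t <= T -> (forall s, 0 <= s <= t -> g s < m) -> g t <= g 0 * exp (k * t)).
  { intros t Ht Hs.
    assert (K : g t * exp (- (k * t)) <= g 0 * exp (- (k * 0))).
    { apply (nonincreasing_of_derive (fun s => (g s * exp (- (k * s)))%R)
        (fun s => (g' s * exp (- (k * s)) + g s * (- k * exp (- (k * s))))%R)); [lra|].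
      intros s Hs'. split.
      - apply (Derive.is_derive_mult g (fun s => exp (- (k * s)))%R); [apply Hd; lra|].
        auto_derive; auto; ring.
      - specialize (Hg s ltac:(lra) (Hs s Hs')). pose proof (exp_pos (- (k * s))). nra. }
    rewrite Rmult_0_r, Ropp_0, exp_0, Rmult_1_r in K.
    apply (Rmult_le_compat_r (exp (k * t))) in K; [|left; apply exp_pos].
    rewrite Rmult_assoc, <- exp_plus in K. replace (- (k * t) + k * t)%R with 0%R in K by ring.
    rewrite exp_0, Rmult_1_r in K. exact K. }
  assert (HA : forall s, 0 <= s <= T -> g s <= g 0 * exp (k * s)).
  { apply (interval_clopen (fun t => forall s, 0 <= s <= t -> g s <= g 0 * exp (k * s)) T HT).
    - intros s Hs. replace s with 0%R by lra. rewrite Rmult_0_r, exp_0. lra.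
    - intros r Hr Happ.
      set (m0 := (g 0 * exp (k * T))%R) in *.
      (* Two such variations of g add up to at most half the gap between [m0] and m. *)
      destruct (is_derive_continuous_eps g r _ (Hd r Hr) ((m - m0) / 4)%R ltac:(lra)) as [d [Hd0 K]].
      destruct (Happ d Hd0) as [r1 [Hr1 [Hd1 A1]]].
      assert (G1 : g r1 <= m0) by (eapply Rle_trans; [apply A1; lra|apply Hexp; lra]).
      assert (Gd : forall s, Rabs (s - r) < d -> g s < m).
      { intros s Hs. pose proof (K r1 Hd1) as Q1. pose proof (K s Hs) as Q2.
        apply Rabs_def2 in Q1. apply Rabs_def2 in Q2. lra. }
      exists d. split; auto. intros r' Hr' Hd' s Hs. apply Hstep; [lra|]. intros s' Hs'.
      destruct (Rle_dec s' r1).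
      + eapply Rle_lt_trans; [apply A1; lra|]. eapply Rle_lt_trans; [apply Hexp; lra|auto].
      + apply Gd. apply Rabs_def2 in Hd1. apply Rabs_def2 in Hd'. apply Rabs_def1; lra. }
  exact HA.
Qed.

Lemma rderiv_sqr (Y : R -> C) (t : R) (v : C) : rderiv Y t v ->
  is_derive (fun s => Cmod (Y s) * Cmod (Y s))%R t (2 * dot (Y t) v)%R.
Proof.
  intros [H1 H2].
  apply (is_derive_ext (fun s => (fst (Y s) * fst (Y s) + snd (Y s) * snd (Y s))%R)).
  { intros s. symmetry. apply Cmod_sqr. }
  evar_last.
  - apply (is_derive_plus (fun s => (fst (Y s) * fst (Y s))%R) (fun s => (snd (Y s) * snd (Y s))%R)).
    + apply (Derive.is_derive_mult (fun s => fst (Y s)) (fun s => fst (Y s)) t _ _ H1 H1).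
    + apply (Derive.is_derive_mult (fun s => snd (Y s)) (fun s => snd (Y s)) t _ _ H2 H2).
  - unfold plus; simpl. unfold dot. ring.
Qed.

Lemma exp_ge_1 (x : R) : 0 <= x -> 1 <= exp x.
Proof. intros H. pose proof (exp_ineq1_le x). lra. Qed.

(* Gronwall's inequality; the estimate on Y' is only assumed while |Y| < m, which
   allows constants that are valid on a ball. *)
Lemma growth (Y Y' : R -> C) (T k eta m : R) : 0 <= T -> 0 <= k -> 0 <= eta ->
  (forall t, 0 <= t <= T -> rderiv Y t (Y' t)) ->
  (forall t, 0 <= t <= T -> Cmod (Y t) < m -> Cmod (Y' t) <= k * Cmod (Y t) + eta) ->
  ((Cmod (Y 0%R) + eta) * exp ((2 * k + 1) * T) < m) ->
  forall t, 0 <= t <= T -> Cmod (Y t) <= (Cmod (Y 0%R) + eta) * exp ((2 * k + 1) * T).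
Proof.
  intros HT Hk He Hd Hg Hm.
  set (E := exp ((2 * k + 1) * T)) in *.
  assert (HE : 1 <= E).
  { apply exp_ge_1. apply Rmult_le_pos; lra. }
  pose proof (Cmod_ge_0 (Y 0%R)) as HY0.
  assert (Hm0 : 0 <= m) by nra.
  (* The square is differentiable where |Y| need not be. With y = |Y|, the bound 2 y (k y + eta) <=
     (2 k + 1) (y^2 + eta^2) gives the rate 2 k + 1. *)
  set (g := fun t => (Cmod (Y t) * Cmod (Y t) + eta * eta)%R).
  assert (Hsq : g 0%R * E <= ((Cmod (Y 0%R) + eta) * E) * ((Cmod (Y 0%R) + eta) * E)).
  { unfold g. set (y := Cmod (Y 0%R)) in *.
    assert (y * y + eta * eta <= (y + eta) * (y + eta)) by nra.
    assert (0 <= y * y + eta * eta) by nra.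
    assert (E <= E * E) by nra. 
    apply Rle_trans with ((y + eta) * (y + eta) * (E * E))%R; [|right; ring].
    apply Rmult_le_compat; auto; lra. }
  intros t Ht.
  assert (B : g t <= g 0%R * exp ((2 * k + 1) * t)).
  { apply (barrier g (fun t => (2 * dot (Y t) (Y' t))%R) T (2 * k + 1)%R (m * m)%R); auto.
    - lra.
    - unfold g. nra.
    - intros s Hs. unfold g. evar_last.
      + apply (is_derive_plus (fun t => (Cmod (Y t) * Cmod (Y t))%R) (fun _ => (eta * eta)%R)).
        * apply rderiv_sqr. apply Hd; auto.
        * apply is_derive_const.
      + unfold plus, zero; simpl. ring.
    - intros s Hs Hgm. unfold g in *.
      pose proof (Cmod_ge_0 (Y s)).
      assert (Hsm : Cmod (Y s) < m).
      { destruct (Rlt_dec (Cmod (Y s)) m); auto. exfalso. nra. }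
      specialize (Hg s Hs Hsm).
      pose proof (dot_bound (Y s) (Y' s)). pose proof (Rle_abs (dot (Y s) (Y' s))).
      assert (Cmod (Y s) * Cmod (Y' s) <= Cmod (Y s) * (k * Cmod (Y s) + eta)) by (apply Rmult_le_compat_l; auto).
      set (y := Cmod (Y s)) in *. pose proof (Rle_0_sqr (y - eta)%R) as S. unfold Rsqr in S.
      pose proof (Rle_0_sqr eta) as S2. unfold Rsqr in S2. nra.
    - fold E. eapply Rle_lt_trans; [exact Hsq|]. apply Rmult_le_0_lt_compat; auto; apply Rmult_le_pos; lra. }
  assert (Hexp : exp ((2 * k + 1) * t) <= E).
  { unfold E. destruct (Req_dec t T) as [->|n]; [lra|]. left. apply exp_increasing.
    apply Rmult_lt_compat_l; lra. }
  pose proof (Cmod_ge_0 (Y t)).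
  assert (g t <= ((Cmod (Y 0%R) + eta) * E) * ((Cmod (Y 0%R) + eta) * E)).
  { eapply Rle_trans; [exact B|]. eapply Rle_trans; [|exact Hsq]. apply Rmult_le_compat_l; auto. unfold g; nra. }
  unfold g in H0. apply Rsqr_incr_0_var; [|nra]. unfold Rsqr. nra.
Qed.

Lemma rderiv_plus (u v : R -> C) t a b : rderiv u t a -> rderiv v t b -> rderiv (fun s => u s + v s) t (a + b).
Proof.
  intros [A1 A2] [B1 B2]. split.
  - apply (is_derive_plus (fun s => fst (u s)) (fun s => fst (v s)) t _ _ A1 B1).
  - apply (is_derive_plus (fun s => snd (u s)) (fun s => snd (v s)) t _ _ A2 B2).
Qed.

Lemma rderiv_mult (u v : R -> C) t a b : rderiv u t a -> rderiv v t b ->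
  rderiv (fun s => u s * v s) t (a * v t + u t * b).
Proof.
  intros [A1 A2] [B1 B2]. split; simpl.
  - evar_last. 
    + apply (is_derive_minus (fun s => (fst (u s) * fst (v s))%R) (fun s => (snd (u s) * snd (v s))%R)).
      * apply (Derive.is_derive_mult _ _ t _ _ A1 B1).
      * apply (Derive.is_derive_mult _ _ t _ _ A2 B2).
    + unfold minus, plus, opp; simpl. ring.
  - evar_last. 
    + apply (is_derive_plus (fun s => (fst (u s) * snd (v s))%R) (fun s => (snd (u s) * fst (v s))%R)).
      * apply (Derive.is_derive_mult _ _ t _ _ A1 B2).
      * apply (Derive.is_derive_mult _ _ t _ _ A2 B1).
    + unfold plus; simpl. ring.
Qed.

Lemma rderiv_const (a : C) t : rderiv (fun _ => a) t 0.
Proof. split; simpl; apply (is_derive_const (V := R_NormedModule)). Qed.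

Lemma rderiv_scal (c : C) (u : R -> C) t a : rderiv u t a -> rderiv (fun s => c * u s) t (c * a).
Proof.
  intros H. replace (c * a) with (0 * u t + c * a) by ring.
  apply (rderiv_mult (fun _ => c) u); auto. apply rderiv_const.
Qed.

Lemma rderiv_eq (u : R -> C) t a b : rderiv u t a -> a = b -> rderiv u t b.
Proof. intros H <-. exact H. Qed.

Lemma rderiv_minus (u v : R -> C) t a b : rderiv u t a -> rderiv v t b -> rderiv (fun s => u s - v s) t (a - b).
Proof.
  intros A B. apply (rderiv_plus u (fun s => - v s)); auto.
  apply (rderiv_eq (fun s => - v s) t (- (1) * b)); [|ring].
  apply (rderiv_ext_loc (fun s => - (1) * v s) _ t _ 1%R); [lra|intros; ring|]. apply rderiv_scal; auto.
Qed.

Lemma rderiv_unique (u : R -> C) t a b : rderiv u t a -> rderiv u t b -> a = b.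
Proof.
  intros [A1 A2] [B1 B2]. apply injective_projections.
  - rewrite <- (is_derive_unique _ _ _ A1). apply is_derive_unique; auto.
  - rewrite <- (is_derive_unique _ _ _ A2). apply is_derive_unique; auto.
Qed.

Lemma curve_bounded (u : R -> C) (T : R) : 0 <= T -> (forall t, 0 <= t <= T -> rcont u t) ->
  exists B, 0 < B /\ forall t, 0 <= t <= T -> Cmod (u t) <= B.
Proof.
  intros HT Hc.
  apply (interval_clopen (fun T' => exists B, 0 < B /\ forall t, 0 <= t <= T' -> Cmod (u t) <= B) T HT).
  - exists (Cmod (u 0%R) + 1)%R. split; [pose proof (Cmod_ge_0 (u 0%R)); lra|].
    intros t Ht. replace t with 0%R by lra. lra.
  - intros r Hr H. destruct (Hc r Hr 1%R ltac:(lra)) as [d [Hd K]].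
    destruct (H d Hd) as [r1 [Hr1 [Hd1 [B [HB HB1]]]]].
    exists d. split; auto. intros r' Hr' Hd'. exists (B + Cmod (u r) + 1)%R.
    pose proof (Cmod_ge_0 (u r)). split; [lra|].
    intros t Ht. destruct (Rle_dec t r1).
    + specialize (HB1 t ltac:(lra)). lra.
    + assert (Hdt : Rabs (t - r) < d).
      { apply Rabs_def2 in Hd1. apply Rabs_def2 in Hd'. apply Rabs_def1; lra. }
      specialize (K t Hdt). pose proof (Cmod_le_sub (u t) (u r)). lra.
Qed.

(** * Existence, uniqueness and dependence on initial values *)

Section Flow.
Variables (F D : C -> C).
Hypothesis (HF : regular F D).

Lemma regular_ccont z : ccont F z.
Proof. eapply cderiv_ccont. apply HF. Qed.

(** The factor c is the direction of time: 1 for F, Ci for i F, z1 - z0 along a segment of complex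
    time. Only X is assumed bounded: while |Y - X| < 1, both curves lie in the disc of radius R0 +
    1, where F is Lipschitz. *)
Lemma ode_dependence (R0 K T : R) : 0 < R0 -> 0 <= K -> 0 <= T ->
  exists E, 1 <= E /\ forall (X Y c : R -> C),
    (forall t, 0 <= t <= T -> rderiv X t (c t * F (X t))) ->
    (forall t, 0 <= t <= T -> rderiv Y t (c t * F (Y t))) ->
    (forall t, 0 <= t <= T -> Cmod (c t) <= K) ->
    (forall t, 0 <= t <= T -> Cmod (X t) <= R0) ->
    (Cmod (Y 0%R - X 0%R) * E < 1) ->
    forall t, 0 <= t <= T -> Cmod (Y t - X t) <= Cmod (Y 0%R - X 0%R) * E.
Proof.
  intros HR HK HT.
  destruct (proj2 HF (R0 + 1)%R ltac:(lra)) as (L & M & HL & HM & B).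
  set (k := (K * L)%R). assert (Hk : 0 <= k) by (unfold k; nra).
  exists (exp ((2 * k + 1) * T)). split.
  { apply exp_ge_1. apply Rmult_le_pos; lra. }
  intros X Y c HX HY Hc HXR Hsmall t Ht.
  rewrite <- (Rplus_0_r (Cmod (Y 0%R - X 0%R))).
  apply (growth (fun t => Y t - X t) (fun t => c t * F (Y t) - c t * F (X t)) T k 0 1); auto.
  - lra.
  - intros s Hs. apply rderiv_minus; auto.
  - intros s Hs Hd. 
    replace (c s * F (Y s) - c s * F (X s)) with (c s * (F (Y s) - F (X s))) by ring.
    rewrite Cmod_mult, Rplus_0_r. 
    assert (HYs : Cmod (Y s) <= R0 + 1).
    { pose proof (Cmod_le_sub (Y s) (X s)). specialize (HXR s Hs). lra. }
    destruct (B (X s) (Y s)) as (_ & B2 & _); [specialize (HXR s Hs); lra|auto|].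
    unfold k. rewrite Rmult_assoc. apply Rmult_le_compat; auto; apply Cmod_ge_0.
  - rewrite Rplus_0_r. auto.
Qed.

Lemma ode_unique (K T : R) (X Y c : R -> C) : 0 <= K -> 0 <= T ->
  (forall t, 0 <= t <= T -> rderiv X t (c t * F (X t))) ->
  (forall t, 0 <= t <= T -> rderiv Y t (c t * F (Y t))) ->
  (forall t, 0 <= t <= T -> Cmod (c t) <= K) ->
  X 0%R = Y 0%R -> X T = Y T.
Proof.
  intros HK HT HX HY Hc E.
  destruct (curve_bounded X T HT) as [B [HB1 HB2]].
  { intros t Ht. eapply rderiv_rcont. auto. }
  destruct (ode_dependence B K T HB1 HK HT) as [Q [HQ H]].
  assert (E0 : Cmod (Y 0%R - X 0%R) = 0%R).
  { rewrite E. replace (Y 0%R - Y 0%R) with (RtoC 0) by ring. apply Cmod_0. }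
  specialize (H X Y c HX HY Hc HB2). rewrite E0 in H. specialize (H ltac:(lra) T ltac:(lra)).
  symmetry. apply Cmod_zero_eq. apply Rle_antisym; [lra|apply Cmod_ge_0].
Qed.

Lemma complex_unique (U V : C -> C) (z0 z1 : C) :
  (forall t, 0 <= t <= 1 -> cderiv U (z0 + RtoC t * (z1 - z0)) (F (U (z0 + RtoC t * (z1 - z0))))) ->
  (forall t, 0 <= t <= 1 -> cderiv V (z0 + RtoC t * (z1 - z0)) (F (V (z0 + RtoC t * (z1 - z0))))) ->
  U z0 = V z0 -> U z1 = V z1.
Proof.
  intros HU HV E.
  assert (P0 : z0 + RtoC 0 * (z1 - z0) = z0) by ring.
  assert (P1 : z0 + RtoC 1 * (z1 - z0) = z1) by ring.
  rewrite <- P1.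
  apply (ode_unique (Cmod (z1 - z0)) 1 (fun t => U (z0 + RtoC t * (z1 - z0))) (fun t => V (z0 + RtoC t * (z1 - z0)))
    (fun _ => z1 - z0)); try lra.
  - apply Cmod_ge_0.
  - intros t Ht. rewrite Cmult_comm. apply cderiv_along. auto.
  - intros t Ht. rewrite Cmult_comm. apply cderiv_along. auto.
  - intros; lra.
  - rewrite P0. exact E.
Qed.

Lemma CInt_bound_sym (f : R -> C) (T M t : R) : Rabs t < T ->
  (forall s, Rabs s < T -> rcont f s) -> (forall s, Rabs s < T -> Cmod (f s) <= M) ->
  (Cmod (CInt f 0 t) <= 2 * M * Rabs t).
Proof.
  intros Ht Hc HM. pose proof (Rabs_def2 _ _ Ht) as [Ht1 Ht2].
  destruct (Rle_dec 0 t).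
  - rewrite (Rabs_pos_eq t) by auto. replace (2 * M * t)%R with (2 * M * (t - 0))%R by ring.
    apply CInt_bound; auto; intros s Hs; [apply Hc|apply HM]; apply Rabs_def1; lra.
  - rewrite (Rabs_left t) by lra. rewrite (CInt_swap f t 0), Cmod_opp; [|lra|].
    + replace (2 * M * - t)%R with (2 * M * (0 - t))%R by ring.
      apply CInt_bound; try lra; intros s Hs; [apply Hc|apply HM]; apply Rabs_def1; lra.
    + intros s Hs; apply Hc; apply Rabs_def1; lra.
Qed.

Lemma CInt_minus_sym (f g : R -> C) (T t : R) : Rabs t < T ->
  (forall s, Rabs s < T -> rcont f s) -> (forall s, Rabs s < T -> rcont g s) ->
  CInt f 0 t - CInt g 0 t = CInt (fun s => f s + - (1) * g s) 0 t.
Proof.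
  intros Ht Hf Hg. pose proof (Rabs_def2 _ _ Ht) as [Ht1 Ht2].
  assert (Hg' : forall s, Rabs s < T -> rcont (fun s => - (1) * g s) s).
  { intros s Hs. apply (rcont_mult (fun _ => - (1))); [apply rcont_const|auto]. }
  assert (Hfg : forall s, Rabs s < T -> rcont (fun s => f s + - (1) * g s) s).
  { intros s Hs. apply rcont_plus; auto. }
  destruct (Rle_dec 0 t).
  - rewrite (CInt_plus f (fun s => - (1) * g s)), (CInt_scal (- (1)) g); auto; [ring|..];
    intros s Hs; try apply Hf; try apply Hg; try apply Hg'; apply Rabs_def1; lra.
  - assert (t <= 0) by lra. 
    assert (I : forall s, t <= s <= 0 -> Rabs s < T) by (intros; apply Rabs_def1; lra).
    rewrite !(CInt_swap _ t 0) by auto.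
    rewrite (CInt_plus f (fun s => - (1) * g s)), (CInt_scal (- (1)) g); auto. ring.
Qed.

(** Smallness is imposed on the factor c instead of on the time, so all solutions share one
    interval. It extends beyond 1 because complex time is read off at t = 1, which must be an
    interior point. *)
Lemma picard (R0 : R) : 0 < R0 -> exists d, 0 < d /\ forall x c, Cmod x <= R0 -> Cmod c <= d ->
  exists X : R -> C, X 0%R = x /\
    forall t, Rabs t < 2 -> rderiv X t (c * F (X t)) /\ Cmod (X t - x) <= 1.
Proof.
  intros HR0.
  destruct (proj2 HF (R0 + 1)%R ltac:(lra)) as (L & M & HL & HM & HB).
  destruct (continuous_bounded F regular_ccont (R0 + 1)%R) as [B [HB0 HBB]].
  (* 4 d B <= 1 keeps the iterates in the unit ball about x and 4 d L <= 1/2 makes the iteration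
     contract; each 4 is the 2 of [CInt_bound] times |t| < 2. *)
  set (d := (/ (8 * (L + B)))%R).
  assert (Hd : 0 < d) by (apply Rinv_0_lt_compat; lra).
  assert (HdB : d * (4 * B) <= 1).
  { unfold d. apply Rmult_le_reg_l with (8 * (L + B))%R; [lra|]. rewrite <- Rmult_assoc, Rinv_r by lra. lra. }
  assert (HdL : d * (4 * L) <= / 2).
  { unfold d. apply Rmult_le_reg_l with (8 * (L + B))%R; [lra|]. rewrite <- Rmult_assoc, Rinv_r by lra. lra. }
  exists d. split; auto. intros x c Hx Hc. pose proof (Cmod_ge_0 c) as Hc0.
  set (step := fun (X : R -> C) (t : R) => x + c * CInt (fun s => F (X s)) 0 t).
  set (X := fun n => nat_rect (fun _ => R -> C) (fun _ => x) (fun _ Y => step Y) n).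
  assert (Xc : forall n t, rcont (X n) t).
  { induction n; intros t.
    - apply rcont_const.
    - change (X (S n)) with (step (X n)). unfold step.
      apply (rcont_plus (fun _ => x)); [apply rcont_const|].
      apply (rcont_mult (fun _ => c)); [apply rcont_const|].
      eapply rderiv_rcont. apply (CInt_primitive _ (- (Rabs t + 1)) (Rabs t + 1)).
      + pose proof (Rabs_pos t). lra.
      + pose proof (Rle_abs t). pose proof (Rle_abs (- t)). rewrite Rabs_Ropp in H0. lra.
      + intros s _. apply (ccont_rcont_comp F (X n)); auto. apply regular_ccont. }
  assert (FXc : forall n t, rcont (fun s => F (X n s)) t).
  { intros. apply (ccont_rcont_comp F (X n)); auto. apply regular_ccont. }
  assert (Hball : forall p, Cmod (p - x) <= 1 -> Cmod p <= R0 + 1).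
  { intros p Hp. pose proof (Cmod_le_sub p x). lra. }
  assert (Xb : forall n t, Rabs t < 2 -> Cmod (X n t - x) <= 1).
  { induction n; intros t Ht.
    - simpl. rewrite Cmod_diag. lra.
    - change (X (S n) t) with (x + c * CInt (fun s => F (X n s)) 0 t).
      replace (x + c * CInt (fun s => F (X n s)) 0 t - x) with (c * CInt (fun s => F (X n s)) 0 t) by ring.
      rewrite Cmod_mult.
      assert (Q : Cmod (CInt (fun s => F (X n s)) 0 t) <= 2 * B * Rabs t).
      { apply (CInt_bound_sym _ 2); auto. }
      pose proof (Cmod_ge_0 (CInt (fun s => F (X n s)) 0 t)). pose proof (Rabs_pos t).
      apply Rle_trans with (d * (2 * B * 2))%R; [|lra].
      apply Rmult_le_compat; auto. nra. }
  assert (Xd : forall n t, Rabs t < 2 -> Cmod (X (S n) t - X n t) <= 1 * (/ 2) ^ n).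
  { induction n; intros t Ht.
    - change (X 0%nat t) with x. rewrite pow_O, Rmult_1_l. auto.
    - change (X (S (S n)) t) with (x + c * CInt (fun s => F (X (S n) s)) 0 t).
      change (X (S n) t) with (x + c * CInt (fun s => F (X n s)) 0 t).
      replace (x + c * CInt (fun s => F (X (S n) s)) 0 t - (x + c * CInt (fun s => F (X n s)) 0 t))
        with (c * (CInt (fun s => F (X (S n) s)) 0 t - CInt (fun s => F (X n s)) 0 t)) by ring.
      rewrite (CInt_minus_sym _ _ 2) by auto. rewrite Cmod_mult.
      set (e := (1 * (/ 2) ^ n)%R) in *. assert (He : 0 < e) by (unfold e; assert (0 < (/ 2) ^ n) by (apply pow_lt; lra); lra).
      match goal with |- (_ * Cmod ?I <= _) => assert (Q : Cmod I <= 2 * (L * e) * Rabs t) end.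
      { apply (CInt_bound_sym _ 2); auto.
        - intros s Hs. apply (rcont_plus (fun s => F (X (S n) s))); auto.
          apply (rcont_mult (fun _ => - (1))); auto. apply rcont_const.
        - intros s Hs. replace (F (X (S n) s) + - (1) * F (X n s)) with (F (X (S n) s) - F (X n s)) by ring.
          destruct (HB (X n s) (X (S n) s)) as (_ & B2 & _); auto.
          eapply Rle_trans; [exact B2|]. apply Rmult_le_compat_l; [lra|auto]. }
      pose proof (Rabs_pos t).
      apply Rle_trans with (d * (2 * (L * e) * 2))%R.
      + apply Rmult_le_compat; auto; [apply Cmod_ge_0|]. assert (0 < L * e) by nra. nra.
      + simpl. fold e. replace (1 * (/ 2 * (/ 2) ^ n))%R with (/ 2 * e)%R by (unfold e; ring). nra. }
  assert (Hlim : forall t, exists p, Rabs t < 2 -> forall n, Cmod (p - X n t) <= 4 * 1 * (/ 2) ^ n).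
  { intros t. destruct (Rlt_dec (Rabs t) 2) as [Ht|].
    - destruct (geometric_limit (fun n => X n t) 1) as [p Hp]; [intros; apply Xd; auto|].
      exists p. auto.
    - exists x. lra. }
  destruct (choice_function _ _ _ Hlim) as [Z HZ].
  assert (Zc : forall t, Rabs t < 2 -> rcont Z t).
  { intros t Ht eps He. destruct (half_pow_small (4 * 1) (eps / 4) ltac:(lra)) as [n Hn].
    destruct (Xc n t (eps / 4)%R ltac:(lra)) as [e [He0 K]].
    exists (Rmin e (2 - Rabs t)). split; [apply Rmin_pos; lra|]. intros s Hs.
    specialize (K s (proj1 (Rlt_Rmin _ _ _ Hs))).
    assert (Hs2 := Rlt_le_trans _ _ _ Hs (Rmin_r _ _)).
    assert (Rs : Rabs s < 2).
    { replace s with ((s - t) + t)%R by ring. eapply Rle_lt_trans; [apply Rabs_triang|]. lra. }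
    pose proof (HZ s Rs n). pose proof (HZ t Ht n).
    pose proof (Cmod_sub_triangle (Z s) (X n s) (Z t)).
    pose proof (Cmod_sub_triangle (X n s) (X n t) (Z t)).
    rewrite (Cmod_minus_sym (X n t) (Z t)) in H2. lra. }
  assert (Zb : forall t, Rabs t < 2 -> Cmod (Z t - x) <= 1).
  { intros t Ht. apply Rnot_lt_le. intros N.
    destruct (half_pow_small (4 * 1) (Cmod (Z t - x) - 1) ltac:(lra)) as [n Hn].
    specialize (HZ t Ht n). pose proof (Xb n t Ht). pose proof (Cmod_sub_triangle (Z t) (X n t) x). lra. }
  assert (FZc : forall t, Rabs t < 2 -> rcont (fun s => F (Z s)) t).
  { intros. apply (ccont_rcont_comp F Z); auto. apply regular_ccont. }
  assert (Zeq : forall t, Rabs t < 2 -> Z t = x + c * CInt (fun s => F (Z s)) 0 t).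
  { intros t Ht. apply Cmod_zero_eq. apply Rle_antisym; [|apply Cmod_ge_0].
    apply Rnot_lt_le. intros N.
    destruct (half_pow_small (4 * 1) (/ 2 * Cmod (Z t - (x + c * CInt (fun s => F (Z s)) 0 t))) ltac:(lra)) as [n Hn].
    set (e := (4 * 1 * (/ 2) ^ n)%R) in *.
    assert (He : 0 < e) by (unfold e; assert (0 < (/ 2) ^ n) by (apply pow_lt; lra); lra).
    assert (H1 : Cmod (Z t - X (S n) t) <= / 2 * e).
    { eapply Rle_trans; [apply HZ; auto|]. simpl. unfold e. right; field. }
    assert (H2 : Cmod (X (S n) t - (x + c * CInt (fun s => F (Z s)) 0 t)) <= / 2 * e).
    { change (X (S n) t) with (x + c * CInt (fun s => F (X n s)) 0 t).
      replace (x + c * CInt (fun s => F (X n s)) 0 t - (x + c * CInt (fun s => F (Z s)) 0 t))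
        with (c * (CInt (fun s => F (X n s)) 0 t - CInt (fun s => F (Z s)) 0 t)) by ring.
      rewrite (CInt_minus_sym _ _ 2) by auto. rewrite Cmod_mult.
      match goal with |- (_ * Cmod ?I <= _) => assert (Q : Cmod I <= 2 * (L * e) * Rabs t) end.
      { apply (CInt_bound_sym _ 2); auto.
        - intros s Hs. apply (rcont_plus (fun s => F (X n s))); auto.
          apply (rcont_mult (fun _ => - (1))); auto. apply rcont_const.
        - intros s Hs. replace (F (X n s) + - (1) * F (Z s)) with (F (X n s) - F (Z s)) by ring.
          destruct (HB (Z s) (X n s)) as (_ & B2 & _); auto.
          eapply Rle_trans; [exact B2|]. apply Rmult_le_compat_l; [lra|].
          rewrite Cmod_minus_sym. apply HZ; auto. }
      pose proof (Rabs_pos t).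
      apply Rle_trans with (d * (2 * (L * e) * 2))%R.
      - apply Rmult_le_compat; auto; [apply Cmod_ge_0|]. assert (0 < L * e) by nra. nra.
      - nra. }
    pose proof (Cmod_sub_triangle (Z t) (X (S n) t) (x + c * CInt (fun s => F (Z s)) 0 t)). lra. }
  exists Z. split.
  - assert (R00 : Rabs 0 < 2) by (rewrite Rabs_R0; lra).
    rewrite (Zeq _ R00).
    assert (E : CInt (fun s => F (Z s)) 0 0 = 0).
    { unfold CInt. apply injective_projections; simpl; apply (RInt_point (V := R_CompleteNormedModule)). }
    rewrite E. ring.
  - intros t Ht. split; auto.
    apply (rderiv_ext_loc (fun s => x + c * CInt (fun s => F (Z s)) 0 s) _ t _ (2 - Rabs t)).
    + lra.
    + intros s Hs. symmetry. apply Zeq.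
      replace s with ((s - t) + t)%R by ring. eapply Rle_lt_trans; [apply Rabs_triang|]. lra.
    + replace (c * F (Z t)) with (0 + c * F (Z t)) by ring.
      apply (rderiv_plus (fun _ => x)); [apply rderiv_const|]. apply rderiv_scal.
      apply Rabs_def2 in Ht.
      apply (CInt_primitive (fun s => F (Z s)) (-2) 2); [lra|lra|].
      intros s Hs. apply FZc. apply Rabs_def1; lra.
Qed.
End Flow.

(** * Complex-time solutions *)

Lemma convex_between (lo hi a b t : R) : lo < a < hi -> lo < b < hi -> 0 <= t <= 1 ->
  (lo < a + t * (b - a) < hi).
Proof. intros Ha Hb Ht. destruct (Rle_dec a b); split; nra. Qed.

Lemma snd_segment (z0 z : C) (t : R) : snd (z0 + RtoC t * (z - z0)) = (snd z0 + t * (snd z - snd z0))%R.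
Proof. simpl. ring. Qed.

Section ComplexTime.
Variables (F D : C -> C).
Hypothesis (HF : regular F D).

(** w z is the value at time 1 of the solution of X' = z F(X) from x. Its derivative in the
    parameter z is found by guessing the solution of the variational equation and bounding the error
    by [growth]. *)
Lemma complex_flow (R0 : R) : 0 < R0 -> exists d, 0 < d /\
  forall x, Cmod x <= R0 -> exists w : C -> C, w 0 = x /\
    forall z, Cmod z < d -> cderiv w z (F (w z)) /\ Cmod (w z - x) <= 1.
Proof.
  intros HR0.
  destruct (picard F D HF R0 HR0) as [d [Hd P]].
  destruct (proj2 HF (R0 + 1)%R ltac:(lra)) as (L & M & HL & HM & HB).
  destruct (continuous_bounded F (regular_ccont F D HF) (R0 + 1)%R) as [B [HB0 HBB]].
  exists d. split; auto. intros x Hx.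
  assert (P' : forall c, exists X : R -> C, Cmod c <= d -> X 0%R = x /\
    forall t, Rabs t < 2 -> rderiv X t (c * F (X t)) /\ Cmod (X t - x) <= 1).
  { intros c. destruct (Rle_dec (Cmod c) d) as [Hc|n].
    - destruct (P x c Hx Hc) as [X HX]. exists X; auto.
    - exists (fun _ => x). tauto. }
  destruct (choice_function _ _ _ P') as [X HX].
  assert (I2 : forall t, 0 <= t <= 1 -> Rabs t < 2) by (intros; apply Rabs_def1; lra).
  assert (XB : forall c t, Cmod c <= d -> 0 <= t <= 1 -> Cmod (X c t) <= R0 + 1).
  { intros c t Hc Ht. destruct (HX c Hc) as [_ K]. destruct (K t (I2 t Ht)) as [_ K2].
    pose proof (Cmod_le_sub (X c t) x). lra. }
  exists (fun z => X z 1%R). split.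
  { assert (H0 : Cmod 0 <= d) by (rewrite Cmod_0; lra).
    destruct (HX 0 H0) as [X0 K].
    apply (ode_unique F D HF 0 1 (X 0) (fun _ => x) (fun _ => 0)); try lra; auto.
    - intros t Ht. apply K. auto.
    - intros t Ht. eapply rderiv_eq; [apply rderiv_const|ring].
    - intros. rewrite Cmod_0; lra. }
  intros z Hz. split; [|apply (HX z ltac:(lra)); apply I2; lra].
  set (k := (d * L)%R). assert (Hk : 0 <= k) by (unfold k; nra).
  set (E := exp ((2 * k + 1) * 1)). assert (HE : 1 <= E) by (apply exp_ge_1; nra).
  destruct (HX z ltac:(lra)) as [Xz0 Kz].
  assert (Delta : forall h, Cmod (z + h) <= d -> forall t, 0 <= t <= 1 ->
    (Cmod (X (z + h)%C t - X z t) <= Cmod h * B * E)).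
  { intros h Hh t Ht. destruct (HX (z + h) Hh) as [Xh0 Kh].
    set (Y := fun t => X (z + h)%C t - X z t).
    assert (Y0 : Cmod (Y 0%R) = 0%R).
    { unfold Y. rewrite Xh0, Xz0. replace (x - x) with (RtoC 0) by ring. apply Cmod_0. }
    assert (Hpos : 0 <= Cmod h * B) by (pose proof (Cmod_ge_0 h); nra).
    assert (G := growth Y (fun t => (z + h) * F (X (z + h)%C t) - z * F (X z t)) 1 k (Cmod h * B)
       ((0 + Cmod h * B) * E + 1)).
    rewrite Y0 in G. fold E in G.
    replace (Cmod h * B * E)%R with ((0 + Cmod h * B) * E)%R by ring.
    apply G; auto; try lra.
    - intros s Hs. apply rderiv_minus; [apply Kh|apply Kz]; auto.
    - intros s Hs _. unfold Y.
      replace ((z + h) * F (X (z + h)%C s) - z * F (X z s)) with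
        ((z + h) * (F (X (z + h)%C s) - F (X z s)) + h * F (X z s)) by ring.
      eapply Rle_trans; [apply Cmod_triangle|]. rewrite !Cmod_mult.
      destruct (HB (X z s) (X (z + h)%C s)) as (_ & B2 & _); [apply XB; auto; lra|apply XB; auto|].
      apply Rplus_le_compat.
      + unfold k. rewrite Rmult_assoc. apply Rmult_le_compat; auto; apply Cmod_ge_0.
      + apply Rmult_le_compat_l; [apply Cmod_ge_0|]. apply HBB. apply XB; auto; lra. }
  (* The first term bounds the Taylor remainder of F at distance |h| B E, the second one h (F p - F
     q). *)
  set (C1 := (d * M * (B * E) * (B * E) + L * (B * E))%R).
  assert (HBE : 0 < B * E) by nra.
  assert (HC1 : 0 < C1).
  { unfold C1. assert (0 < d * M) by nra. assert (0 < d * M * (B * E)) by nra. nra. }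
  assert (Err : forall h, Cmod (z + h) <= d ->
     (Cmod (X (z + h)%C 1%R - X z 1%R - F (X z 1%R) * h) <= C1 * E * (Cmod h * Cmod h))).
  { intros h Hh. destruct (HX (z + h) Hh) as [Xh0 Kh]. specialize (Delta h Hh).
    pose proof (Cmod_ge_0 h) as Hh0.
    (* V t = t h F(X t) solves V' = z F'(X) V + h F(X) with V 0 = 0, so Y is the error of the
       linearization; at t = 1 the derivative F(w z) appears. *)
    set (Y := fun t => X (z + h)%C t - X z t - RtoC t * (h * F (X z t))).
    set (Y' := fun t => ((z + h) * F (X (z + h)%C t) - z * F (X z t)) -
       (1 * (h * F (X z t)) + RtoC t * (h * (D (X z t) * (z * F (X z t)))))).
    assert (Y0 : Cmod (Y 0%R) = 0%R).
    { unfold Y. rewrite Xh0, Xz0. match goal with |- Cmod ?u = _ => replace u with (RtoC 0) by ring end. apply Cmod_0. }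
    set (eta := (C1 * (Cmod h * Cmod h))%R). assert (Heta : 0 <= eta) by (unfold eta; nra).
    assert (G := growth Y Y' 1 k eta ((0 + eta) * E + 1)). rewrite Y0 in G. fold E in G.
    assert (EY : X (z + h)%C 1%R - X z 1%R - F (X z 1%R) * h = Y 1%R) by (unfold Y; ring).
    rewrite EY. replace (C1 * E * (Cmod h * Cmod h))%R with ((0 + eta) * E)%R by (unfold eta; ring).
    apply G; auto; try lra.
    - intros t Ht. unfold Y, Y'. apply rderiv_minus.
      + apply rderiv_minus; [apply Kh|apply Kz]; auto.
      + apply (rderiv_mult RtoC (fun t => h * F (X z t)) t 1).
        * split; simpl; [apply (is_derive_id (K := R_AbsRing))|apply (is_derive_const (V := R_NormedModule))].
        * apply rderiv_scal. apply (cderiv_rderiv_comp F (X z)); [apply HF|apply Kz; auto].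
    - intros t Ht _. specialize (Delta t Ht).
      set (p := X (z + h)%C t) in *. set (q := X z t) in *.
      assert (EY' : Y' t = z * (F p - F q - D q * (p - q)) + z * (D q * Y t) + h * (F p - F q)).
      { unfold Y', Y. fold p q. ring. }
      rewrite EY'. 
      eapply Rle_trans; [apply Cmod_triangle|]. 
      eapply Rle_trans; [apply Rplus_le_compat_r, Cmod_triangle|]. rewrite !Cmod_mult.
      destruct (HB q p) as (B1 & B2 & B3); [apply XB; auto; lra|apply XB; auto|].
      pose proof (Cmod_ge_0 z). pose proof (Cmod_ge_0 (Y t)). pose proof (Cmod_ge_0 (p - q)).
      set (u := Cmod (p - q)) in *.
      assert (T1 : Cmod z * Cmod (F p - F q - D q * (p - q)) <= d * (M * ((Cmod h * B * E) * (Cmod h * B * E)))).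
      { apply Rmult_le_compat; auto; [apply Cmod_ge_0|lra|]. eapply Rle_trans; [exact B3|].
        apply Rmult_le_compat_l; [lra|]. apply Rmult_le_compat; auto. }
      assert (T2 : Cmod z * (Cmod (D q) * Cmod (Y t)) <= d * (L * Cmod (Y t))).
      { apply Rmult_le_compat; auto; [apply Rmult_le_pos; auto; apply Cmod_ge_0|lra|].
        apply Rmult_le_compat_r; auto. }
      assert (T3 : Cmod h * Cmod (F p - F q) <= Cmod h * (L * (Cmod h * B * E))).
      { apply Rmult_le_compat_l; auto. eapply Rle_trans; [exact B2|]. apply Rmult_le_compat_l; auto; lra. }
      unfold k, eta, C1. lra. }
  intros eps He.
  exists (Rmin (d - Cmod z) (eps / (C1 * E))). split.
  { apply Rmin_pos; [lra|]. apply Rdiv_lt_0_compat; nra. }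
  intros w Hw. set (h := w - z) in *. replace w with (z + h) by (unfold h; ring).
  destruct (Rlt_Rmin _ _ _ Hw) as [H1 H2].
  eapply Rle_trans; [apply Err|].
  - pose proof (Cmod_triangle z h). lra.
  - rewrite <- Rmult_assoc. apply Rmult_le_compat_r; [apply Cmod_ge_0|].
    apply (Rmult_lt_compat_l (C1 * E)) in H2; [|nra].
    replace (C1 * E * (eps / (C1 * E)))%R with eps in H2 by (field; nra). lra.
Qed.

(** An explicit local inverse: along the segment zeta from U z0 to p the required complex time
    solves z' = v / F(zeta). Then U (z r) and zeta r solve the same equation with coefficient f. *)
Lemma local_surjectivity (U : C -> C) (z0 : C) (d eps : R) : 0 < d -> 0 < eps ->
  (forall z, Cmod (z - z0) < d -> cderiv U z (F (U z))) -> F (U z0) <> 0 ->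
  exists rho, 0 < rho /\ forall p, Cmod (p - U z0) < rho -> exists z, Cmod (z - z0) < eps /\ U z = p.
Proof.
  intros Hd He HU HF0. set (y := U z0) in *.
  set (kap := (Cmod (F y) / 2)%R).
  assert (Hkap : 0 < kap) by (apply Cmod_gt_0 in HF0; unfold kap; lra).
  destruct (regular_ccont F D HF y kap Hkap) as [r0 [Hr0 K0]].
  assert (Klow : forall q, Cmod (q - y) < r0 -> kap < Cmod (F q)).
  { intros q Hq. specialize (K0 q Hq). pose proof (Cmod_le_sub (F y) (F q)) as T.
    rewrite Cmod_minus_sym in T. unfold kap in *. lra. }
  set (e := Rmin eps d). assert (He' : 0 < e) by (apply Rmin_pos; auto).
  (* r0 / 2 keeps zeta where |F| > kap for |r| < 2; the other radius keeps the time 2 |v| / kap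
     below e. *)
  exists (Rmin (r0 / 2) (kap * e / 2)). split; [apply Rmin_pos; nra|].
  intros p Hp. destruct (Rlt_Rmin _ _ _ Hp) as [H1 H2].
  set (v := p - y) in *.
  set (zeta := fun r : R => y + RtoC r * v).
  assert (Hzeta : forall r, -2 < r < 2 -> Cmod (zeta r - y) < r0).
  { intros r Hr. unfold zeta. replace (y + RtoC r * v - y) with (RtoC r * v) by ring.
    rewrite Cmod_mult, Cmod_R. assert (Rabs r <= 2) by (apply Rabs_le_between; lra).
    pose proof (Rabs_pos r). pose proof (Cmod_ge_0 v). nra. }
  assert (HFz : forall r, -2 < r < 2 -> F (zeta r) <> 0).
  { intros r Hr. apply Cmod_gt_0. pose proof (Klow _ (Hzeta r Hr)). lra. }
  set (f := fun r => v * / F (zeta r)).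
  assert (fc : forall r, -2 < r < 2 -> rcont f r).
  { intros r Hr. apply (rcont_mult (fun _ => v)); [apply rcont_const|].
    apply rcont_inv; auto. apply (ccont_rcont_comp F zeta); [apply (regular_ccont F D HF)|apply rcont_affine]. }
  assert (fb : forall r, -2 < r < 2 -> Cmod (f r) <= Cmod v / kap).
  { intros r Hr. unfold f. rewrite Cmod_mult, Cmod_inv by auto.
    apply Rmult_le_compat_l; [apply Cmod_ge_0|]. apply Rinv_le_contravar; auto.
    left. apply Klow. auto. }
  set (z := fun r => z0 + CInt f 0 r).
  assert (Hvk : 2 * (Cmod v / kap) < e).
  { apply Rmult_lt_reg_r with (kap / 2)%R; [lra|].
    replace (2 * (Cmod v / kap) * (kap / 2))%R with (Cmod v) by (field; lra). lra. }
  assert (zb : forall r, 0 <= r <= 1 -> Cmod (z r - z0) < e).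
  { intros r Hr. unfold z. replace (z0 + CInt f 0 r - z0) with (CInt f 0 r) by ring.
    assert (Q : Cmod (CInt f 0 r) <= 2 * (Cmod v / kap) * (r - 0)).
    { apply CInt_bound; [lra| |]; intros s Hs; [apply fc|apply fb]; lra. }
    pose proof (Cmod_ge_0 v). assert (0 < / kap) by (apply Rinv_0_lt_compat; auto).
    assert (0 <= 2 * (Cmod v / kap)) by (unfold Rdiv; nra). nra. }
  exists (z 1%R). split.
  { eapply Rlt_le_trans; [apply zb; lra|apply Rmin_l]. }
  transitivity (zeta 1%R); [|unfold zeta, v; ring].
  apply (ode_unique F D HF (Cmod v / kap) 1 (fun r => U (z r)) zeta f).
  - unfold Rdiv. apply Rmult_le_pos; [apply Cmod_ge_0|]. left. apply Rinv_0_lt_compat; auto.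
  - lra.
  - intros r Hr. rewrite Cmult_comm. apply (cderiv_rderiv_comp U z).
    + apply HU. eapply Rlt_le_trans; [apply zb; auto|apply Rmin_r].
    + unfold z. eapply rderiv_eq; [apply (rderiv_plus (fun _ => z0)); [apply rderiv_const|]|].
      * apply (CInt_primitive f (-2) 2 r); [lra|lra|]. auto.
      * ring.
  - intros r Hr. eapply rderiv_eq; [apply rderiv_affine|]. unfold f. field. apply HFz. lra.
  - intros r Hr. apply fb. lra.
  - unfold z, zeta. assert (E0 : CInt f 0 0 = 0).
    { unfold CInt. apply injective_projections; simpl; apply (RInt_point (V := R_CompleteNormedModule)). }
    rewrite E0. replace (z0 + 0) with z0 by ring. fold y. ring.
Qed.

Definition solves_on (G : C -> C) (lo hi : R) (U : C -> C) : Prop :=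
  forall z : C, lo < snd z < hi -> cderiv U z (G (U z)).

Lemma solves_unique (lo hi : R) (U V : C -> C) (z0 : C) :
  solves_on F lo hi U -> solves_on F lo hi V -> lo < snd z0 < hi -> U z0 = V z0 ->
  forall z : C, lo < snd z < hi -> U z = V z.
Proof.
  intros HU HV H0 E z Hz.
  assert (I : forall t, 0 <= t <= 1 -> lo < snd (z0 + RtoC t * (z - z0))%C < hi).
  { intros t Ht. rewrite snd_segment. apply convex_between; auto. }
  apply (complex_unique F D HF U V z0 z); auto.
Qed.

(** The width d depends on R0 only, so extension can proceed in steps of fixed size. U is glued from
    local flows: its value at z is that of the flow started at Y (fst z) after the vertical time i
    snd z. *)
Lemma strip_flow (R0 : R) : 0 < R0 -> exists d, 0 < d /\
  forall Y : R -> C, (forall t, rderiv Y t (F (Y t))) -> (forall t, Cmod (Y t) <= R0) ->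
  exists U, (forall t : R, U (RtoC t) = Y t) /\ solves_on F (- d) d U /\
    forall z : C, - d < snd z < d -> Cmod (U z) <= R0 + 1.
Proof.
  intros HR0. destruct (complex_flow R0 HR0) as [d [Hd Hflow]].
  exists d. split; auto. intros Y HY HB.
  destruct (choice_function _ _ _ (fun t => Hflow (Y t) (HB t))) as [W HW].
  assert (Wreal : forall t0 t, Rabs (t - t0) < d -> W t0 (RtoC (t - t0)) = Y t).
  { intros t0 t Ht. destruct (HW t0) as [W0 W1].
    set (k := (t - t0)%R) in *.
    replace (Y t) with (Y (k * 1 + t0)%R) by (f_equal; unfold k; ring).
    replace (RtoC k) with (0 + RtoC 1 * RtoC k) by ring.
    apply (ode_unique F D HF (Rabs k) 1 (fun s => W t0 (0 + RtoC s * RtoC k)) (fun s => Y (k * s + t0)%R)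
       (fun _ => RtoC k)); try lra.
    - apply Rabs_pos.
    - intros s Hs. rewrite Cmult_comm. apply cderiv_along. apply W1.
      replace (0 + RtoC s * RtoC k) with (RtoC s * RtoC k) by ring.
      rewrite Cmod_mult, !Cmod_R. rewrite (Rabs_pos_eq s) by lra. pose proof (Rabs_pos k). nra.
    - intros s Hs. apply rderiv_comp_affine. apply HY.
    - intros. rewrite Cmod_R. lra.
    - replace (0 + RtoC 0 * RtoC k) with (RtoC 0) by ring. rewrite W0. f_equal. ring. }
  (* Flows started at different base times agree: along the vertical segment at [fst z] both solve
     the equation and start from Y (fst z). *)
  assert (Wloc : forall t0 z, Cmod (z - RtoC t0) < d -> W (fst z) (0, snd z)%R = W t0 (z - RtoC t0)).
  { intros t0 z Hz.
    assert (Hz1 : Rabs (fst z - t0) < d).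
    { eapply Rle_lt_trans; [|exact Hz]. apply (Cmod_fst (z - RtoC t0)). }
    assert (Hz2 : Rabs (snd z) < d).
    { eapply Rle_lt_trans; [|exact Hz]. eapply Rle_trans; [|apply (Cmod_snd (z - RtoC t0))]. right. f_equal. simpl. ring. }
    replace (z - RtoC t0) with ((0, snd z)%R + RtoC (fst z - t0)) by ceq.
    apply (complex_unique F D HF (W (fst z)) (fun u => W t0 (u + RtoC (fst z - t0))) 0 (0, snd z)%R).
    - intros s Hs. apply HW. 
      replace (0 + RtoC s * ((0%R, snd z) - 0)) with (RtoC s * (0%R, snd z)) by ring.
      rewrite Cmod_real_scal by lra. 
      assert (Q : Cmod (0%R, snd z) <= Rabs (snd z)).
      { eapply Rle_trans; [apply Cmod_le_parts|]. simpl. rewrite Rabs_R0. lra. }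
      pose proof (Cmod_ge_0 (0%R, snd z)). nra.
    - intros s Hs. apply (cderiv_shift (W t0)). apply HW.
      eapply Rle_lt_trans; [|exact Hz].
      assert (HQ : forall u v : C, fst u = fst v -> Rabs (snd u) <= Rabs (snd v) -> Cmod u <= Cmod v).
      { intros u v E1 E2. pose proof (Cmod_ge_0 u). apply Rsqr_incr_0_var; [|apply Cmod_ge_0]. unfold Rsqr.
        rewrite !Cmod_sqr, E1. apply Rsqr_le_abs_1 in E2. unfold Rsqr in E2. lra. }
      apply HQ; simpl; [ring|].
      match goal with |- (Rabs ?u <= _) => replace u with (s * snd z)%R by ring end.
      replace (snd z + - 0)%R with (snd z) by ring. rewrite Rabs_mult, (Rabs_pos_eq s) by lra.
      pose proof (Rabs_pos (snd z)). nra.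
    - rewrite (proj1 (HW (fst z))). replace (0 + RtoC (fst z - t0)) with (RtoC (fst z - t0)) by ring.
      symmetry. apply Wreal. auto. }
  assert (Him : forall z : C, - d < snd z < d -> Cmod (z - RtoC (fst z)) < d).
  { intros z Hz. eapply Rle_lt_trans; [apply Cmod_le_parts|]. simpl.
    replace (fst z + - fst z)%R with 0%R by ring. replace (snd z + - 0)%R with (snd z) by ring.
    rewrite Rabs_R0. assert (Rabs (snd z) < d) by (apply Rabs_def1; lra). 
    change (0 + Rabs (snd z) < d). lra. }
  exists (fun z => W (fst z) (0, snd z)%R). split; [|split].
  - intros t. simpl. apply (proj1 (HW t)).
  - intros z Hz. specialize (Him z Hz).
    cbv beta. rewrite (Wloc (fst z) z Him).
    set (t0 := fst z) in *.
    apply (cderiv_ext_loc (fun u => W t0 (u + - RtoC t0)) _ z _ (d - Cmod (z - RtoC t0))).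
    + lra.
    + intros u Hu. symmetry. apply Wloc. pose proof (Cmod_sub_triangle u z (RtoC t0)). lra.
    + apply (cderiv_shift (W t0) z (- RtoC t0)). apply HW. exact Him.
  - intros z Hz. cbv beta. rewrite (Wloc (fst z) z (Him z Hz)). destruct (HW (fst z)) as [_ W1].
    destruct (W1 _ (Him z Hz)) as [_ W2]. pose proof (Cmod_le_sub (W (fst z) (z - RtoC (fst z))) (Y (fst z))).
    specialize (HB (fst z)). lra.
Qed.

(** V restricted to the line of height S - d / 2 is again a bounded solution; the strip of
    half-width d about that line reaches S + d / 2, and uniqueness glues. *)
Lemma strip_extension (R0 : R) : 0 < R0 -> exists d, 0 < d /\
  (forall Y : R -> C, (forall t, rderiv Y t (F (Y t))) -> (forall t, Cmod (Y t) <= R0) ->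
    exists U, (forall t : R, U (RtoC t) = Y t) /\ solves_on F (- d) d U) /\
  (forall (V : C -> C) (S : R), d <= S -> solves_on F (- d) S V ->
    (forall z : C, 0 <= snd z < S -> Cmod (V z) <= R0) ->
    exists U, solves_on F (- d) (S + d / 2) U /\ forall z : C, snd z < S -> U z = V z).
Proof.
  intros HR0. destruct (strip_flow R0 HR0) as [d [Hd H]].
  exists d. split; auto. split.
  - intros Y HY HB. destruct (H Y HY HB) as (U & U1 & U2 & _). exists U; auto.
  - intros V S HS HV HB.
    set (y0 := (0, S - d / 2)%R : C).
    destruct (H (fun t => V (RtoC t + y0))) as (U & U1 & U2 & _).
    + intros t. apply (rderiv_ext_loc (fun s => V (y0 + RtoC s * 1)) _ t _ 1%R); [lra|intros; f_equal; ring|].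
      eapply rderiv_eq; [apply cderiv_along; apply HV|]. simpl; lra.
      replace (y0 + RtoC t * 1) with (RtoC t + y0) by ring. ring.
    + intros t. apply HB. simpl. lra.
    + set (U' := fun z => U (z + - y0)).
      assert (HU' : solves_on F (S - 3 * d / 2) (S + d / 2) U').
      { intros z Hz. apply (cderiv_shift U). apply U2. simpl. lra. }
      assert (Heq : forall z : C, S - d < snd z < S -> U' z = V z).
      { apply (solves_unique (S - d) S U' V y0).
        - intros z Hz. apply HU'. lra.
        - intros z Hz. apply HV. lra.
        - simpl. lra.
        - unfold U'. replace (y0 + - y0) with (RtoC 0) by ring. rewrite U1. f_equal. ring. }
      exists (fun z => if Rlt_dec (snd z) S then V z else U' z). split.
      * intros z Hz. destruct (Rlt_dec (snd z) S) as [Hlt|Hge].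
        -- apply (cderiv_ext_loc V _ z _ (S - snd z)); [lra| |apply HV; lra].
           intros s Hs. destruct (Rlt_dec (snd s) S) as [|n]; auto. exfalso. apply n.
           pose proof (Cmod_snd (s - z)). simpl in H0. pose proof (Rle_abs (snd s + - snd z)). lra.
        -- apply (cderiv_ext_loc U' _ z _ (d / 2)); [lra| |apply HU'; lra].
           intros s Hs. destruct (Rlt_dec (snd s) S) as [Hl|]; auto. apply Heq.
           pose proof (Cmod_snd (s - z)) as Q. simpl in Q.
           pose proof (Rle_abs (- (snd s + - snd z))) as Q2. rewrite Rabs_Ropp in Q2. lra.
      * intros z Hz. destruct (Rlt_dec (snd z) S); auto. lra.
Qed.
End ComplexTime.

(** * Connectedness in the plane *)

(** The ball of the product space C is a square, which costs a factor 2 in the converse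
    [Cmod_of_ball]. *)
Lemma ball_of_Cmod (z w : C) (r : R) : Cmod (w - z) < r -> ball z r w.
Proof.
  intros H. split.
  - change (Rabs (fst w - fst z) < r). eapply Rle_lt_trans; [apply (Cmod_fst (w - z))|auto].
  - change (Rabs (snd w - snd z) < r). eapply Rle_lt_trans; [apply (Cmod_snd (w - z))|auto].
Qed.

Lemma Cmod_of_ball (z w : C) (r : R) : ball z (r / 2) w -> Cmod (w - z) < r.
Proof.
  intros [H1 H2]. change (Rabs (fst w - fst z) < r / 2) in H1. change (Rabs (snd w - snd z) < r / 2) in H2.
  eapply Rle_lt_trans; [apply Cmod_le_parts|]. simpl.
  change (Rabs (fst w - fst z) + Rabs (snd w - snd z) < r). lra.
Qed.

Lemma locally_Cmod (P : C -> Prop) (z : C) :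
  locally z P <-> exists r, 0 < r /\ forall w, Cmod (w - z) < r -> P w.
Proof.
  split.
  - intros [e He]. exists e. split; [apply cond_pos|]. intros w Hw. apply He, ball_of_Cmod, Hw.
  - intros [r [Hr H]]. assert (Hr2 : 0 < r / 2) by lra. exists (mkposreal _ Hr2).
    intros w Hw. apply H, Cmod_of_ball, Hw.
Qed.

Lemma open_C (U : C -> Prop) :
  open U <-> forall z, U z -> exists r, 0 < r /\ forall w, Cmod (w - z) < r -> U w.
Proof. split; intros H z Hz; apply locally_Cmod; auto. Qed.

(** Continuity relative to [0, 1], to match [continuous_on unit_interval]. *)
Definition path_cont (f : R -> C) : Prop :=
  forall t, 0 <= t <= 1 -> forall eps, 0 < eps -> exists d, 0 < d /\
    forall s, 0 <= s <= 1 -> Rabs (s - t) < d -> Cmod (f s - f t) < eps.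

Lemma path_image_connected (f : R -> C) : path_cont f ->
  connected (fun w => exists t, 0 <= t <= 1 /\ f t = w).
Proof.
  intros Hf U V HU HV Hcov [z1 [[t1 [Ht1 <-]] U1]] [z2 [[t2 [Ht2 <-]] V2]].
  rewrite open_C in HU, HV.
  apply NNPP. intros N.
  (* Runs from t1 to t2 in either order. *)
  set (h := fun r => (t1 + r * (t2 - t1))%R).
  assert (Hh : forall r, 0 <= r <= 1 -> 0 <= h r <= 1).
  { intros r Hr. unfold h. split; nra. }
  assert (A1 : U (f (h 1%R))).
  { apply (interval_clopen (fun r => U (f (h r))) 1); [lra| |].
    - unfold h. rewrite Rmult_0_l, Rplus_0_r. exact U1.
    - intros r Hr Happ.
      assert (Hloc : forall W : C -> Prop, (forall z, W z -> exists r, 0 < r /\ forall w, Cmod (w - z) < r -> W w) ->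
        W (f (h r)) -> exists e, 0 < e /\ forall r', 0 <= r' <= 1 -> Rabs (r' - r) < e -> W (f (h r'))).
      { intros W HW Hr0. destruct (HW _ Hr0) as [e [He K]]. destruct (Hf _ (Hh r Hr) e He) as [d [Hd Kd]].
        exists (d / 2)%R. split; [lra|]. intros r' Hr' Hd'. apply K, Kd; auto.
        unfold h. replace (t1 + r' * (t2 - t1) - (t1 + r * (t2 - t1)))%R with ((r' - r) * (t2 - t1))%R by ring.
        rewrite Rabs_mult. assert (Rabs (t2 - t1) <= 1) by (apply Rabs_le_between; lra).
        pose proof (Rabs_pos (r' - r)). nra. }
      destruct (Hcov (f (h r))) as [Ur|Vr]; [exists (h r); auto|apply Hloc; auto|].
      exfalso. destruct (Hloc V HV Vr) as [e [He K]].
      destruct (Happ e He) as [r' [Hr' [Hd' Ur']]]. apply N. exists (f (h r')). split; [exists (h r'); auto|]. split; auto. }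
  apply N. exists (f t2). split; [exists t2; auto|]. split; auto.
  replace t2 with (h 1%R) by (unfold h; ring). exact A1.
Qed.

Lemma component_path (S : C -> Prop) (f : R -> C) : path_cont f ->
  (forall t, 0 <= t <= 1 -> S (f t)) -> component S (f 0%R) (f 1%R).
Proof.
  intros Hf HS. exists (fun w => exists t, 0 <= t <= 1 /\ f t = w).
  split; [apply path_image_connected; auto|]. split.
  - intros z [t [Ht <-]]. auto.
  - split; [exists 0%R|exists 1%R]; split; auto; lra.
Qed.

Lemma component_trans (S : C -> Prop) (x y z : C) : component S x y -> component S y z -> component S x z.
Proof.
  intros (K1 & C1 & S1 & X1 & Y1) (K2 & C2 & S2 & Y2 & Z2).
  exists (fun w => K1 w \/ K2 w). split; [|split].
  - intros U V HU HV Hcov [u [Ku Uu]] [v [Kv Vv]].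
    assert (Hi : forall (K : C -> Prop) p q, connected K -> (forall w, K w -> K1 w \/ K2 w) -> K p -> U p -> K q -> V q ->
       exists w, (K1 w \/ K2 w) /\ U w /\ V w).
    { intros K p q CK SK Kp Up Kq Vq.
      destruct (CK U V HU HV) as [w (Kw & Uw & Vw)].
      - intros w Kw. apply Hcov. auto.
      - exists p; auto.
      - exists q; auto.
      - exists w; auto. }
    destruct (Hcov y (or_introl Y1)) as [Uy|Vy].
    + destruct Kv as [Kv|Kv]; [apply (Hi K1 y v)|apply (Hi K2 y v)]; auto.
    + destruct Ku as [Ku|Ku]; [apply (Hi K1 u y)|apply (Hi K2 u y)]; auto.
  - intros w [Hw|Hw]; auto.
  - auto.
Qed.

Lemma component_mem (S : C -> Prop) (x y : C) : component S x y -> S y.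
Proof. intros (K & H1 & H2 & H3 & H4). auto. Qed.

Lemma rcont_path_cont (f : R -> C) : (forall t, 0 <= t <= 1 -> rcont f t) -> path_cont f.
Proof. intros H t Ht eps He. destruct (H t Ht eps He) as [d [Hd K]]. exists d. split; auto. Qed.

Lemma segment_path (g : C -> C) (z0 z1 : C) : 
  (forall t, 0 <= t <= 1 -> ccont g (z0 + RtoC t * (z1 - z0))) ->
  path_cont (fun t => g (z0 + RtoC t * (z1 - z0))).
Proof.
  intros H. apply rcont_path_cont. intros t Ht.
  apply (ccont_rcont_comp g (fun t => z0 + RtoC t * (z1 - z0))); auto. apply rcont_affine.
Qed.

Lemma component_segment (S : C -> Prop) (g : C -> C) (z0 z1 : C) :
  (forall t, 0 <= t <= 1 -> ccont g (z0 + RtoC t * (z1 - z0)) /\ S (g (z0 + RtoC t * (z1 - z0)))) ->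
  component S (g z0) (g z1).
Proof.
  intros H.
  replace (g z0) with (g (z0 + RtoC 0 * (z1 - z0))) by (f_equal; ring).
  replace (g z1) with (g (z0 + RtoC 1 * (z1 - z0))) by (f_equal; ring).
  apply (component_path S (fun t => g (z0 + RtoC t * (z1 - z0)))).
  - apply segment_path. intros; apply H; auto.
  - intros; apply H; auto.
Qed.

Lemma ccont_id (z : C) : ccont (fun w => w) z.
Proof. intros eps He. exists eps. auto. Qed.

Lemma component_ball (S : C -> Prop) (w : C) (r : R) :
  (forall p, Cmod (p - w) < r -> S p) ->
  forall p q, Cmod (p - w) < r -> Cmod (q - w) < r -> component S p q.
Proof.
  intros H p q Hp Hq. apply (component_segment S (fun z => z)).
  intros t Ht. split; [apply ccont_id|]. apply H, Cmod_segment; auto.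
Qed.

(** Otherwise the component could be followed along the whole horizontal ray from a, since it can
    stop only near a point of G; but it is bounded. *)
Lemma component_boundary (G : C -> Prop) (a : C) :
  (forall w, ~ G w -> exists r, 0 < r /\ forall p, Cmod (p - w) < r -> ~ G p) ->
  ~ G a -> bounded_in_C (component (fun w => ~ G w) a) ->
  exists y, G y /\ forall eps, 0 < eps -> exists p, component (fun w => ~ G w) a p /\ Cmod (p - y) < eps.
Proof.
  intros HG Ha [M HM]. set (K := component (fun w => ~ G w) a) in *.
  assert (Kball : forall w r, (forall p, Cmod (p - w) < r -> ~ G p) -> forall p q, Cmod (p - w) < r ->
     (Cmod (q - w) < r) -> K p -> K q).
  { intros w r H p q Hp Hq Kp. apply (component_trans _ a p q Kp).
    apply (component_ball (fun w => ~ G w) w r H); auto. }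
  assert (Ka : K a).
  { destruct (HG a Ha) as [r [Hr H]]. apply (component_ball (fun w => ~ G w) a r H);
    rewrite Cmod_diag; auto. }
  apply NNPP. intros N.
  set (T := (Rabs M + Cmod a + 1)%R).
  pose proof (Rabs_pos M). pose proof (Rle_abs M). pose proof (Cmod_ge_0 a).
  assert (KT : K (a + RtoC T)).
  { apply (interval_clopen (fun r => K (a + RtoC r)) T).
    - unfold T; lra.
    - replace (a + RtoC 0) with a by ring. auto.
    - intros r Hr Happ.
      assert (Hd : forall s, Cmod (a + RtoC s - (a + RtoC r)) = Rabs (s - r)).
      { intros s. rewrite <- Cmod_R. f_equal. ceq. }
      destruct (classic (G (a + RtoC r))) as [Gr|Gr].
      + exfalso. apply N. exists (a + RtoC r). split; auto. intros eps He.
        destruct (Happ eps He) as [r' (_ & Hr' & Kr')]. exists (a + RtoC r'). split; auto. rewrite Hd. auto.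
      + destruct (HG _ Gr) as [e [He HGe]]. exists e. split; auto.
        destruct (Happ e He) as [r1 (_ & Hr1 & Kr1)].
        intros r' _ Hr'. apply (Kball _ _ HGe (a + RtoC r1)); auto; rewrite Hd; auto. }
  specialize (HM _ KT).
  assert (Cmod (RtoC T) <= Cmod (a + RtoC T) + Cmod a).
  { replace (RtoC T) with ((a + RtoC T) + - a) at 1 by ring. rewrite <- (Cmod_opp a). apply Cmod_triangle. }
  rewrite Cmod_R, Rabs_pos_eq in H2 by (unfold T; lra). unfold T in *. lra.
Qed.

(** A nonempty open and closed set contains the horizontal ray from each of its points. *)
Lemma no_bounded_clopen (M : C -> Prop) (p0 : C) (B : R) : M p0 ->
  (forall p, M p -> Cmod p <= B) ->
  (forall p, M p -> exists r, 0 < r /\ forall q, Cmod (q - p) < r -> M q) ->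
  (forall p, (forall eps, 0 < eps -> exists q, M q /\ Cmod (q - p) < eps) -> M p) -> False.
Proof.
  intros M0 HB Ho Hc.
  set (T := (2 * Rabs B + 1)%R). pose proof (Rabs_pos B). pose proof (Rle_abs B).
  assert (MT : M (p0 + RtoC T)).
  { apply (interval_clopen (fun r => M (p0 + RtoC r)) T).
    - unfold T; lra.
    - replace (p0 + RtoC 0) with p0 by ring. auto.
    - intros r Hr Happ.
      assert (Hd : forall s, Cmod (p0 + RtoC s - (p0 + RtoC r)) = Rabs (s - r)).
      { intros s. rewrite <- Cmod_R. f_equal. ceq. }
      assert (Mr : M (p0 + RtoC r)).
      { apply Hc. intros eps He. destruct (Happ eps He) as [r' (_ & Hr' & Kr')].
        exists (p0 + RtoC r'). split; auto. rewrite Hd. auto. }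
      destruct (Ho _ Mr) as [e [He K]]. exists e. split; auto.
      intros r' _ Hr'. apply K. rewrite Hd. auto. }
  pose proof (HB _ MT) as B1. pose proof (HB _ M0) as B2.
  assert (Cmod (RtoC T) <= Cmod (p0 + RtoC T) + Cmod p0).
  { replace (RtoC T) with ((p0 + RtoC T) + - p0) at 1 by ring. rewrite <- (Cmod_opp p0). apply Cmod_triangle. }
  rewrite Cmod_R, Rabs_pos_eq in H1 by (unfold T; lra). unfold T in *. lra.
Qed.

(** * Periodic orbits *)

Lemma periodic_reduce (P : R) (f : R -> C) : 0 < P -> (forall t, f (t + P)%R = f t) ->
  forall t, exists t', 0 <= t' <= P /\ f t' = f t.
Proof.
  intros HP Hf t.
  assert (Hn : forall n t, f (t + INR n * P)%R = f t).
  { induction n; intros s.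
    - simpl. f_equal. ring.
    - rewrite S_INR. replace (s + (INR n + 1) * P)%R with ((s + INR n * P) + P)%R by ring. rewrite Hf. apply IHn. }
  assert (Hz : forall k t, f (t + IZR k * P)%R = f t).
  { intros k s. destruct (Z.le_gt_cases 0 k).
    - rewrite <- (Z2Nat.id k) by auto. rewrite <- INR_IZR_INZ. apply Hn.
    - rewrite <- (Hn (Z.to_nat (- k)) (s + IZR k * P)%R). f_equal.
      rewrite INR_IZR_INZ, Z2Nat.id by lia. rewrite opp_IZR. ring. }
  destruct (archimed (t / P)) as [A1 A2].
  (* [up] is the integer strictly above, so [up (t / P) - 1] is the floor. *)
  exists (t + IZR (- (up (t / P) - 1)) * P)%R. split; [|apply Hz].
  rewrite opp_IZR, minus_IZR.
  assert (E : (t = t / P * P)%R) by (field; lra).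
  set (x := (t / P)%R) in *. set (u := IZR (up x)) in *. rewrite E. split; nra.
Qed.

Section Strips.
Variables (F D : C -> C).
Hypothesis (HF : regular F D).

(** Uniqueness against the constant solution, with time rescaled to [0, 1] to cover s < t as
    well. *)
Lemma stationary_solution (Y : R -> C) (t s : R) : (forall t, rderiv Y t (F (Y t))) -> F (Y t) = 0 -> Y s = Y t.
Proof.
  intros HY E.
  replace (Y s) with (Y ((s - t) * 1 + t)%R) by (f_equal; ring).
  apply (ode_unique F D HF (Rabs (s - t)) 1 (fun r => Y ((s - t) * r + t)%R) (fun _ => Y t) (fun _ => RtoC (s - t))).
  - apply Rabs_pos.
  - lra.
  - intros r Hr. apply rderiv_comp_affine. auto.
  - intros r Hr. eapply rderiv_eq; [apply rderiv_const|]. rewrite E. ring.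
  - intros r Hr. rewrite Cmod_R. lra.
  - f_equal. ring.
Qed.

Lemma solution_nonzero (Y : R -> C) (t s : R) : (forall t, rderiv Y t (F (Y t))) -> F (Y s) <> 0 -> F (Y t) <> 0.
Proof. intros HY H0 E. apply H0. rewrite (stationary_solution Y t s); auto. Qed.

Lemma strip_nonzero (lo hi : R) (U : C -> C) (z0 z : C) : solves_on F lo hi U ->
  (lo < snd z0 < hi) -> lo < snd z < hi -> F (U z0) <> 0 -> F (U z) <> 0.
Proof.
  intros HU H0 Hz N E. apply N.
  assert (EU : U z0 = U z); [|rewrite EU; auto].
  apply (solves_unique F D HF lo hi U (fun _ => U z) z HU); auto.
  intros w Hw. rewrite E. intros eps He. exists 1%R. split; [lra|]. intros w' _.
  replace (U z - U z - 0 * (w' - w)) with (RtoC 0) by ring. rewrite Cmod_0.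
  pose proof (Cmod_ge_0 (w' - w)). nra.
Qed.

Lemma strip_periodic (lo hi P : R) (U : C -> C) (z0 : C) : solves_on F lo hi U ->
  (lo < snd z0 < hi) -> U (z0 + RtoC P) = U z0 ->
  forall z : C, lo < snd z < hi -> U (z + RtoC P) = U z.
Proof.
  intros HU H0 E.
  apply (solves_unique F D HF lo hi (fun z => U (z + RtoC P)) U z0); auto.
  intros z Hz. apply (cderiv_shift U). apply HU. simpl. lra.
Qed.

(* If two levels of a strip met, the closed strip between them would have a compact open image. *)
Lemma no_return (lo hi P : R) (U : C -> C) (z1 z2 : C) : solves_on F lo hi U -> 0 < P ->
  (forall z : C, lo < snd z < hi -> U (z + RtoC P) = U z) ->
  F (U z1) <> 0 -> lo < snd z1 -> snd z1 < snd z2 -> snd z2 < hi -> U z1 <> U z2.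
Proof.
  intros HU HP Hper Hnz H1 H12 H2 E.
  set (s1 := snd z1) in *. set (s2 := snd z2) in *.
  set (M := fun p => exists z : C, s1 <= snd z <= s2 /\ U z = p).
  assert (Hred : forall z : C, s1 <= snd z <= s2 -> exists z', in_rect 0 P s1 s2 z' /\ U z' = U z).
  { intros z Hz. destruct (periodic_reduce P (fun t => U (t, snd z)%R) HP) with (t := fst z) as [t' [Ht' Et']].
    - intros t. rewrite <- (Hper (t, snd z)%R) by (simpl; lra). f_equal. ceq.
    - exists (t', snd z)%R. split; [split; simpl; auto|]. rewrite Et'. f_equal. symmetry. apply surjective_pairing. }
  assert (HC : forall z, in_rect 0 P s1 s2 z -> ccont U z).
  { intros z [_ Hz]. eapply cderiv_ccont, HU. lra. }
  destruct (rect_bounded 0 P s1 s2 U HC) as [B [_ HB]].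
  apply (no_bounded_clopen M (U z1) B).
  - exists z1. split; auto. fold s1. lra.
  - intros p [z [Hz <-]]. destruct (Hred z Hz) as [z' [Hz' <-]]. auto.
  - intros p [z [Hz <-]].
    set (e := Rmin (s2 - s1) (Rmin (s1 - lo) (hi - s2))).
    assert (He : 0 < e) by (repeat apply Rmin_pos; lra).
    assert (e1 : e <= s2 - s1) by apply Rmin_l.
    assert (e2 : e <= s1 - lo) by (eapply Rle_trans; [apply Rmin_r|apply Rmin_l]).
    assert (e3 : e <= hi - s2) by (eapply Rle_trans; [apply Rmin_r|apply Rmin_r]).
    assert (Hsn : forall w : C, Cmod (w - z) < e -> snd z - e < snd w < snd z + e).
    { intros w Hw. pose proof (Cmod_snd (w - z)) as Q. simpl in Q.
      assert (Q' : Rabs (snd w + - snd z) < e) by lra. apply Rabs_def2 in Q'. lra. }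
    destruct (local_surjectivity F D HF U z e e He He) as [rho [Hrho K]].
    { intros w Hw. apply HU. apply Hsn in Hw. lra. }
    { apply (strip_nonzero lo hi U z1 z HU); auto; fold s1; lra. }
    exists rho. split; auto. intros q Hq. destruct (K q Hq) as [w [Hw <-]]. apply Hsn in Hw.
    destruct (Rlt_dec (snd w) s1) as [L|L]; [|destruct (Rlt_dec s2 (snd w)) as [L'|L']].
    (* w lies below the strip by less than e, hence its shift by z2 - z1 lies inside. U is invariant
       under this shift near the lower line, because U z1 = U z2. *)
    + exists (w + (z2 - z1)). split.
      { assert (Es : snd (w + (z2 - z1)) = (snd w + (s2 - s1))%R) by (simpl; unfold s1, s2; ring). rewrite Es. lra. }
      symmetry.
      apply (solves_unique F D HF (s1 - e) (s1 + e) U (fun u => U (u + (z2 - z1))) z1).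
      * intros u Hu. apply HU. lra.
      * intros u Hu. apply (cderiv_shift U). apply HU. simpl. fold s1 s2. lra.
      * fold s1. lra.
      * rewrite E. f_equal. ring.
      * lra.
    + exists (w + (z1 - z2)). split.
      { assert (Es : snd (w + (z1 - z2)) = (snd w - (s2 - s1))%R) by (simpl; unfold s1, s2; ring). rewrite Es. lra. }
      symmetry.
      apply (solves_unique F D HF (s2 - e) (s2 + e) U (fun u => U (u + (z1 - z2))) z2).
      * intros u Hu. apply HU. lra.
      * intros u Hu. apply (cderiv_shift U). apply HU. simpl. fold s1 s2. lra.
      * fold s2. lra.
      * rewrite <- E. f_equal. ring.
      * lra.
    + exists w. split; auto. lra.
  - intros p Happ. destruct (rect_image_closed 0 P s1 s2 U p HC) as [z [[_ Hz] Ez]].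
    + intros eps He. destruct (Happ eps He) as [q [[z [Hz <-]] Hq]].
      destruct (Hred z Hz) as [z' [Hz' Ez']]. exists z'. rewrite Ez'. auto.
    + exists z. auto.
Qed.

Definition orbit_of (g : R -> C) (w : C) : Prop := exists t, g t = w.

Lemma periodic_orbit_closed (g : R -> C) (P : R) : 0 < P -> (forall t, g (t + P)%R = g t) ->
  (forall t, rcont g t) -> forall w, ~ orbit_of g w ->
  exists r, 0 < r /\ forall p, Cmod (p - w) < r -> ~ orbit_of g p.
Proof.
  intros HP Hper Hc w Hw. apply NNPP. intros N. apply Hw.
  (* A dummy second coordinate turns [0, P] into a rectangle. *)
  destruct (rect_image_closed 0 P 0 1 (fun z => g (fst z)) w) as [z [_ Ez]].
  - intros z _ eps He. destruct (Hc (fst z) eps He) as [d [Hd K]]. exists d. split; auto.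
    intros u Hu. apply K. eapply Rle_lt_trans; [apply (Cmod_fst (u - z))|auto].
  - intros eps He. apply NNPP. intros N2. apply N. exists eps. split; auto.
    intros p Hp [t Et]. apply N2. destruct (periodic_reduce P g HP Hper t) as [t' [Ht' Et']].
    exists (t', 0)%R. simpl. split; [split; simpl; lra|]. rewrite Et', Et. auto.
  - exists (fst z). auto.
Qed.

Lemma periodic_orbit_bounded (g : R -> C) (P : R) : 0 < P -> (forall t, g (t + P)%R = g t) ->
  (forall t, rcont g t) -> exists B, 0 < B /\ forall t, Cmod (g t) <= B.
Proof.
  intros HP Hper Hc. destruct (curve_bounded g P) as [B [HB K]]; [lra|auto|].
  exists B. split; auto. intros t. destruct (periodic_reduce P g HP Hper t) as [t' [Ht' <-]]. auto.
Qed.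

Section HalfPlane.
Variables (g : R -> C) (P : R) (a : C).
Hypothesis (Hg : forall t, rderiv g t (F (g t))).
Hypothesis (HP : 0 < P).
Hypothesis (Hper : forall t, g (t + P)%R = g t).
Hypothesis (Hnz : F (g 0%R) <> 0).

Let K : C -> Prop := component (fun w => ~ orbit_of g w) a.
Hypothesis (Ha : ~ orbit_of g a).
Hypothesis (HK : bounded_in_C K).

Let gc t : rcont g t.
Proof. eapply rderiv_rcont; auto. Qed.

(** K comes arbitrarily near some point of the orbit, by [component_boundary], and U covers a
    neighbourhood of that point. A point of K is off the orbit, so it is reached off the axis. *)
Lemma strip_meets_component (eta : R) (U : C -> C) : 0 < eta -> solves_on F (- eta) eta U ->
  (forall t : R, U (RtoC t) = g t) ->
  exists z : C, - eta < snd z < eta /\ snd z <> 0%R /\ K (U z).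
Proof.
  intros Heta HU HUg.
  destruct (component_boundary (orbit_of g) a) as [y [[t0 Ht0] Hy]]; auto.
  { apply (periodic_orbit_closed g P); auto. }
  assert (Hsn : forall w : C, Cmod (w - RtoC t0) < eta -> - eta < snd w < eta).
  { intros w Hw. pose proof (Cmod_snd (w - RtoC t0)) as Q. simpl in Q.
    replace (snd w + - 0)%R with (snd w) in Q by ring.
    assert (Q' : Rabs (snd w) < eta) by lra. apply Rabs_def2 in Q'. lra. }
  destruct (local_surjectivity F D HF U (RtoC t0) eta eta Heta Heta) as [rho [Hrho L]].
  { intros z Hz. apply HU. auto. }
  { rewrite HUg. apply (solution_nonzero g _ 0); auto. }
  rewrite HUg, Ht0 in L.
  destruct (Hy rho Hrho) as [p [Kp Hp]]. destruct (L p Hp) as [z [Hz Ez]].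
  exists z. split; auto. split; [|rewrite Ez; exact Kp].
  intros E0. apply component_mem in Kp. apply Kp. exists (fst z). rewrite <- HUg, <- Ez. f_equal. 
  apply injective_projections; simpl; auto.
Qed.

Lemma half_strip_in_component (S : R) (d : R) (V : C -> C) (z1 : C) : 0 < d ->
  solves_on F (- d) S V -> (forall t : R, V (RtoC t) = g t) ->
  (0 < snd z1 < S) -> K (V z1) -> forall z : C, 0 < snd z < S -> K (V z).
Proof.
  intros Hd HV HVg H1 K1 z Hz.
  apply (component_trans _ a (V z1) (V z) K1).
  assert (HVp : forall z : C, - d < snd z < S -> V (z + RtoC P) = V z).
  { apply (strip_periodic (- d) S P V 0 HV); [simpl; lra|].
    rewrite <- RtoC_plus, !HVg. apply Hper. }
  apply component_segment. intros t Ht.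
  assert (I : 0 < snd (z1 + RtoC t * (z - z1))%C < S).
  { rewrite snd_segment. apply convex_between; auto. }
  split; [eapply cderiv_ccont, HV; lra|].
  intros [s Es]. rewrite <- HVg in Es. revert Es.
  apply (no_return (- d) S P V); auto.
  - rewrite HVg. apply (solution_nonzero g _ 0); auto.
  - simpl; lra.
  - apply I.
  - apply I.
Qed.

(** At every height the extension takes the real axis to the orbit and the points above it into K,
    so one bound R0 and one step d / 2 serve for all extensions V n. *)
Lemma half_plane_flow (eta : R) (U0 : C -> C) (z0 : C) : 0 < eta -> solves_on F (- eta) eta U0 ->
  (forall t : R, U0 (RtoC t) = g t) -> 0 < snd z0 < eta -> K (U0 z0) ->
  exists d U, 0 < d /\ (forall z : C, - d < snd z -> cderiv U z (F (U z))) /\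
    (forall t : R, U (RtoC t) = g t) /\ forall z : C, 0 < snd z -> K (U z).
Proof.
  intros Heta HU0 HU0g Hz0 Kz0.
  destruct (periodic_orbit_bounded g P HP Hper gc) as [B [HB0 HB]].
  destruct HK as [M HM].
  set (R0 := (B + Rabs M)%R). pose proof (Rabs_pos M). pose proof (Rle_abs M).
  destruct (strip_extension F D HF R0) as (d & Hd & Hbase & Hext); [unfold R0; lra|].
  assert (Hin : forall S V, d <= S -> solves_on F (- d) S V -> (forall t : R, V (RtoC t) = g t) ->
     forall z : C, 0 < snd z < S -> K (V z)).
  { intros S V HS HV HVg. set (m := Rmin eta d). assert (Hm : 0 < m) by (apply Rmin_pos; auto).
    assert (m1 : m <= eta) by apply Rmin_l. assert (m2 : m <= d) by apply Rmin_r.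
    set (z1 := (0, m / 2)%R : C).
    apply (half_strip_in_component S d V z1); auto.
    - simpl; lra.
    - replace (V z1) with (U0 z1).
      + apply (half_strip_in_component eta eta U0 z0); auto. simpl; lra.
      + apply (solves_unique F D HF (- m) m U0 V 0).
        * intros z Hz. apply HU0. lra.
        * intros z Hz. apply HV. lra.
        * simpl; lra.
        * rewrite HU0g, HVg. auto.
        * simpl; lra. }
  assert (Hall : forall n, exists V, solves_on F (- d) (d + INR n * (d / 2)) V /\ forall t : R, V (RtoC t) = g t).
  { induction n.
    - destruct (Hbase g Hg) as [V [V1 V2]].
      + intros t. specialize (HB t). unfold R0. lra.
      + exists V. simpl. rewrite Rmult_0_l, Rplus_0_r. auto.
    - destruct IHn as [V [V1 V2]]. pose proof (pos_INR n).
      assert (HS : d <= d + INR n * (d / 2)) by nra.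
      destruct (Hext V _ HS V1) as [V' [V1' V2']].
      + intros z Hz. destruct (Req_dec (snd z) 0) as [E|NE].
        * assert (Ez : z = RtoC (fst z)) by (apply injective_projections; simpl; auto).
          rewrite Ez, V2. specialize (HB (fst z)). unfold R0; lra.
        * assert (Kz : K (V z)) by (apply (Hin _ V HS V1 V2); lra).
          specialize (HM _ Kz). unfold R0; lra.
      + exists V'. rewrite S_INR. split.
        * replace (d + (INR n + 1) * (d / 2))%R with (d + INR n * (d / 2) + d / 2)%R by ring. auto.
        * intros t. rewrite V2'; [auto|]. simpl. nra. }
  destruct (choice_function _ _ _ Hall) as [V HV].
  assert (Hagree : forall n m (z : C), - d < snd z < d + INR n * (d / 2) -> - d < snd z < d + INR m * (d / 2) ->
     V n z = V m z).
  { intros n m z Hn Hm. destruct (HV n) as [N1 N2]. destruct (HV m) as [M1 M2].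
    pose proof (pos_INR n). pose proof (pos_INR m).
    apply (solves_unique F D HF (- d) (Rmin (d + INR n * (d / 2)) (d + INR m * (d / 2))) (V n) (V m) 0).
    - intros w Hw. apply N1. pose proof (Rmin_l (d + INR n * (d / 2)) (d + INR m * (d / 2))). lra.
    - intros w Hw. apply M1. pose proof (Rmin_r (d + INR n * (d / 2)) (d + INR m * (d / 2))). lra.
    - simpl. split; [lra|]. apply Rmin_glb_lt; nra.
    - rewrite N2, M2. auto.
    - split; [lra|]. apply Rmin_glb_lt; lra. }
  (* [N z] is so large that V (N z) is defined up to height d above z. By [Hagree] the choice does
     not affect the value, so the diagonal function is differentiable. *)
  destruct (choice_function _ _ _ (fun z : C => INR_unbounded (2 * snd z / d))) as [N HN'].
  assert (HN : forall z : C, snd z + d < d + INR (N z) * (d / 2)).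
  { intros z. specialize (HN' z). apply (Rmult_lt_compat_r (d / 2)) in HN'; [|lra].
    replace (2 * snd z / d * (d / 2))%R with (snd z) in HN' by (field; lra). lra. }
  exists d, (fun z => V (N z) z). split; auto. split; [|split].
  - intros z Hz. pose proof (HN z).
    apply (cderiv_ext_loc (V (N z)) _ z _ (Rmin d (snd z + d))).
    + apply Rmin_pos; lra.
    + intros w Hw. pose proof (HN w). pose proof (Cmod_snd (w - z)) as Q. simpl in Q.
      assert (Q' : Rabs (snd w + - snd z) < Rmin d (snd z + d)) by lra. apply Rabs_def2 in Q'.
      pose proof (Rmin_l d (snd z + d)). pose proof (Rmin_r d (snd z + d)).
      apply Hagree; lra.
    + apply HV. lra.
  - intros t. apply HV.
  - intros z Hz. pose proof (HN z). destruct (HV (N z)) as [V1 V2]. pose proof (pos_INR (N z)).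
    apply (Hin (d + INR (N z) * (d / 2))%R (V (N z))); auto; [nra|lra].
Qed.
End HalfPlane.
End Strips.

(** * Equilibria and half-plane solutions *)

Section Equilibria.
Variables (F D : C -> C).
Hypothesis (HF : regular F D).

Lemma constant_solution (a : C) (c : R -> C) (t : R) : F a = 0 -> rderiv (fun _ => a) t (c t * F a).
Proof. intros E. eapply rderiv_eq; [apply rderiv_const|]. rewrite E. ring. Qed.

Lemma zero_isolated (w : C) : F w = 0 -> D w <> 0 ->
  exists r, 0 < r /\ forall p, p <> w -> Cmod (p - w) < r -> F p <> 0.
Proof.
  intros E HD. apply Cmod_gt_0 in HD.
  destruct (proj1 HF w (Cmod (D w) / 2)%R ltac:(lra)) as [r [Hr K]].
  exists r. split; auto. intros p Hp Hpr E'. specialize (K p Hpr). rewrite E, E' in K.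
  replace (0 - 0 - D w * (p - w)) with (- (D w * (p - w))) in K by ring.
  rewrite Cmod_opp, Cmod_mult in K. pose proof (Cmod_pos_neq _ _ Hp). nra.
Qed.

Lemma dot_derive (p : C) (Y : R -> C) (t : R) (v : C) : rderiv Y t v -> is_derive (fun s => dot p (Y s)) t (dot p v).
Proof.
  intros [H1 H2]. unfold dot.
  apply (is_derive_plus (fun s => (fst p * fst (Y s))%R) (fun s => (snd p * snd (Y s))%R)).
  - apply is_derive_scal; auto.
  - apply is_derive_scal; auto.
Qed.

(* Near a zero of F with vanishing derivative the speed is nearly constant along
   an orbit during one period, so the orbit cannot close up. *)
Lemma period_at_zero (y : C) (P : R) : 0 < P -> F y = 0 ->
  (forall eps, 0 < eps -> exists Y : R -> C, (forall t, rderiv Y t (F (Y t))) /\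
     Y P = Y 0%R /\ F (Y 0%R) <> 0 /\ Cmod (Y 0%R - y) < eps) ->
  D y <> 0.
Proof.
  intros HP E0 H ED.
  pose proof (Cmod_ge_0 y) as Hy0.
  destruct (proj2 HF (Cmod y + 1)%R ltac:(lra)) as (L & M & HL & HM & HB).
  destruct (ode_dependence F D HF (Cmod y + 1) 1 P ltac:(lra) ltac:(lra) ltac:(lra)) as [E [HE Hdep]].
  set (E2 := exp ((2 * 1 + 1) * P)). assert (HE2 : 1 <= E2) by (apply exp_ge_1; nra).
  (* Makes eps E2 <= 1/2 for eps = 4 M r, which is a Lipschitz constant of F on the disc of radius r
     about y. *)
  set (r := (/ (8 * (M + 1) * E2))%R).
  assert (HME : 8 <= 8 * (M + 1) * E2) by nra.
  assert (Hr : 0 < r) by (apply Rinv_0_lt_compat; lra).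
  assert (HrM : (r * (M + 1) * E2 = / 8)%R).
  { unfold r. field. split; nra. }
  assert (Hr1 : r < 1).
  { apply Rmult_lt_reg_r with ((M + 1) * E2)%R; [nra|]. rewrite <- Rmult_assoc, HrM. nra. }
  (* The Taylor estimates from y to q and from q to y are added; as D y = 0, only D q (q - y)
     remains on the left. *)
  assert (HD : forall q, Cmod (q - y) <= r -> Cmod (D q) <= 2 * M * r).
  { intros q Hq. destruct (classic (q = y)) as [->|Hne].
    - rewrite ED, Cmod_0. nra.
    - pose proof (Cmod_pos_neq _ _ Hne) as Hpos.
      assert (Hqb : Cmod q <= Cmod y + 1) by (pose proof (Cmod_le_sub q y); lra).
      destruct (HB y q ltac:(lra) Hqb) as (_ & _ & B1).
      destruct (HB q y Hqb ltac:(lra)) as (_ & _ & B2). rewrite (Cmod_minus_sym y q) in B2.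
      assert (Es : D q * (q - y) = (F q - F y - D y * (q - y)) + (F y - F q - D q * (y - q))).
      { rewrite ED. ring. }
      apply (f_equal Cmod) in Es. rewrite Cmod_mult in Es.
      pose proof (Cmod_triangle (F q - F y - D y * (q - y)) (F y - F q - D q * (y - q))) as T.
      apply Rle_trans with (2 * M * Cmod (q - y))%R; [|apply Rmult_le_compat_l; lra].
      apply Rmult_le_reg_r with (Cmod (q - y)); auto. nra. }
  set (eps := (4 * M * r)%R).
  assert (HepsE : eps * E2 <= / 2).
  { unfold eps. assert (0 < r * E2) by nra. nra. }
  assert (Heps0 : 0 <= eps) by (unfold eps; nra).
  assert (Heps1 : eps <= 1) by nra.
  assert (HLip : forall p q, Cmod (p - y) <= r -> Cmod (q - y) <= r ->
     (Cmod (F q - F p) <= eps * Cmod (q - p))).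
  { intros p q Hp Hq.
    assert (Hpb : Cmod p <= Cmod y + 1) by (pose proof (Cmod_le_sub p y); lra).
    assert (Hqb : Cmod q <= Cmod y + 1) by (pose proof (Cmod_le_sub q y); lra).
    destruct (HB p q Hpb Hqb) as (_ & _ & B1). specialize (HD p Hp).
    pose proof (Cmod_le_sub (F q - F p) (D p * (q - p))) as T. rewrite Cmod_mult in T.
    pose proof (Cmod_sub_triangle q y p) as T2. rewrite (Cmod_minus_sym y p) in T2.
    pose proof (Cmod_ge_0 (q - p)). unfold eps.
    assert (M * (Cmod (q - p) * Cmod (q - p)) <= M * (2 * r * Cmod (q - p))).
    { apply Rmult_le_compat_l; [lra|]. apply Rmult_le_compat_r; lra. }
    assert (Cmod (D p) * Cmod (q - p) <= 2 * M * r * Cmod (q - p)) by (apply Rmult_le_compat_r; auto).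
    lra. }
  destruct (H (r / E)%R) as (Y & HY & HYP & HY0 & HYy).
  { apply Rdiv_lt_0_compat; lra. }
  assert (HYE : Cmod (Y 0%R - y) * E < r).
  { apply (Rmult_lt_compat_r E) in HYy; [|lra]. replace (r / E * E)%R with r in HYy by (field; lra). exact HYy. }
  assert (Hnear : forall t, 0 <= t <= P -> Cmod (Y t - y) <= r).
  { intros t Ht. eapply Rle_trans; [apply (Hdep (fun _ => y) Y (fun _ => 1))|]; auto.
    - intros s _. apply (constant_solution y (fun _ => 1)); auto.
    - intros s _. eapply rderiv_eq; [apply HY|]. ring.
    - intros s _. rewrite Cmod_1. lra.
    - intros s _. lra.
    - lra.
    - lra. }
  set (p := Y 0%R) in *.
  assert (Hp : 0 < Cmod (F p)) by (apply Cmod_gt_0; auto).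
  assert (Hdist : forall t, 0 <= t <= P -> Cmod (Y t - p) <= Cmod (F p) * E2).
  { assert (Hpp : Cmod (Y 0%R - p) = 0%R) by (unfold p; replace (Y 0%R - Y 0%R) with (RtoC 0) by ring; apply Cmod_0).
    assert (G := growth (fun t => Y t - p) (fun t => F (Y t) - 0) P 1 (Cmod (F p)) (Cmod (F p) * E2 + 1)).
    cbv beta in G. rewrite Hpp, Rplus_0_l in G. apply G; try lra.
    - intros t Ht. apply rderiv_minus; [apply HY|apply rderiv_const].
    - intros t Ht _. replace (F (Y t) - 0) with (F (Y t)) by ring.
      pose proof (Cmod_le_sub (F (Y t)) (F p)). pose proof (HLip p (Y t) (Hnear 0%R ltac:(lra)) (Hnear t Ht)).
      pose proof (Cmod_ge_0 (Y t - p)). nra.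
    - fold E2. lra. }
  (* The component of Y along F p grows at rate at least c, half of its initial rate, which excludes
     Y P = Y 0. *)
  set (c := (Cmod (F p) * Cmod (F p) / 2)%R). assert (Hc : 0 < c) by (unfold c; nra).
  assert (Hmono : c * P - dot (F p) (Y P) <= c * 0 - dot (F p) (Y 0%R)).
  { apply (nonincreasing_of_derive (fun t => (c * t - dot (F p) (Y t))%R) (fun t => (c - dot (F p) (F (Y t)))%R)); [lra|].
    intros t Ht. split.
    - apply (is_derive_minus (fun t => (c * t)%R) (fun t => dot (F p) (Y t))).
      + auto_derive; auto; ring.
      + apply dot_derive; auto.
    - assert (Ed : (dot (F p) (F (Y t)) = Cmod (F p) * Cmod (F p) + dot (F p) (F (Y t) - F p))%R).
      { rewrite Cmod_sqr. unfold dot; simpl; ring. }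
      rewrite Ed. pose proof (dot_bound (F p) (F (Y t) - F p)) as B.
      pose proof (Rle_abs (- dot (F p) (F (Y t) - F p))) as B'. rewrite Rabs_Ropp in B'.
      pose proof (HLip p (Y t) (Hnear 0%R ltac:(lra)) (Hnear t Ht)) as B2.
      specialize (Hdist t Ht).
      assert (B3 : Cmod (F (Y t) - F p) <= Cmod (F p) / 2).
      { eapply Rle_trans; [exact B2|]. apply Rle_trans with (eps * (Cmod (F p) * E2))%R.
        - apply Rmult_le_compat_l; auto.
        - replace (eps * (Cmod (F p) * E2))%R with (Cmod (F p) * (eps * E2))%R by ring.
          unfold Rdiv. apply Rmult_le_compat_l; lra. }
      assert (Cmod (F p) * Cmod (F (Y t) - F p) <= Cmod (F p) * (Cmod (F p) / 2)) by (apply Rmult_le_compat_l; lra).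
      unfold c. lra. }
  rewrite HYP in Hmono. fold p in Hmono. nra.
Qed.

(** The first term is half the derivative of |v - a|^2 along v' = c F(v); its leading coefficient is
    the real part of c F'(a). *)
Lemma radial_estimate (a c : C) : F a = 0 -> forall eps, 0 < eps -> exists r, 0 < r /\
  forall p, Cmod (p - a) < r ->
    (Rabs (dot (p - a) (c * F p) - fst (c * D a)%C * (Cmod (p - a) * Cmod (p - a))) <= eps * (Cmod (p - a) * Cmod (p - a))).
Proof.
  intros Ea eps Heps. pose proof (Cmod_ge_0 c) as Hc.
  destruct (proj1 HF a (eps / (Cmod c + 1))%R) as [r [Hr K]].
  { apply Rdiv_lt_0_compat; lra. }
  exists r. split; auto. intros p Hp. specialize (K p Hp). rewrite Ea in K.
  set (v := p - a) in *.
  assert (E : (dot v (c * F p) - fst (c * D a)%C * (Cmod v * Cmod v) = dot v (c * (F p - 0 - D a * v)))%R).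
  { rewrite Cmod_sqr. unfold dot; simpl. ring. }
  rewrite E. eapply Rle_trans; [apply dot_bound|]. rewrite Cmod_mult.
  pose proof (Cmod_ge_0 v).
  assert (Cmod c * Cmod (F p - 0 - D a * v) <= eps * Cmod v).
  { apply Rle_trans with ((Cmod c + 1) * (eps / (Cmod c + 1) * Cmod v))%R.
    - apply Rmult_le_compat; auto; [apply Cmod_ge_0|lra].
    - right. field. lra. }
  nra.
Qed.

(** With error at most |Re (c F'(a))| in [radial_estimate] the distance to a cannot grow; [barrier]
    with rate 0 also keeps v in the disc where the estimate holds. *)
Lemma attracting_stable (a c : C) : F a = 0 -> fst (c * D a)%C < 0 -> exists r, 0 < r /\
  forall (v : R -> C) (T : R), 0 <= T -> (forall s, 0 <= s <= T -> rderiv v s (c * F (v s))) ->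
    (Cmod (v 0%R - a) < r) -> forall s, 0 <= s <= T -> Cmod (v s - a) <= Cmod (v 0%R - a).
Proof.
  intros Ea Hneg.
  destruct (radial_estimate a c Ea (- fst (c * D a)%C) ltac:(lra)) as [r [Hr K]].
  exists r. split; auto. intros v T HT Hv H0 s Hs.
  assert (B := barrier (fun s => Cmod (v s - a) * Cmod (v s - a))%R (fun s => 2 * dot (v s - a) (c * F (v s) - 0))%R T 0 (r * r)).
  cbv beta in B. pose proof (Cmod_ge_0 (v 0%R - a)). pose proof (Cmod_ge_0 (v s - a)).
  assert (B' : Cmod (v s - a) * Cmod (v s - a) <= Cmod (v 0%R - a) * Cmod (v 0%R - a) * exp (0 * s)).
  { apply B; auto; try lra; [nra| | |].
    - intros t Ht. apply (rderiv_sqr (fun s => v s - a)). apply rderiv_minus; [auto|apply rderiv_const].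
    - intros t Ht Hlt. rewrite Rmult_0_l. replace (c * F (v t) - 0) with (c * F (v t)) by ring.
      pose proof (Cmod_ge_0 (v t - a)).
      assert (Hr' : Cmod (v t - a) < r) by (destruct (Rlt_dec (Cmod (v t - a)) r); auto; nra).
      specialize (K _ Hr'). apply Rabs_le_between in K. lra.
    - rewrite Rmult_0_l, exp_0. nra. }
  rewrite Rmult_0_l, exp_0, Rmult_1_r in B'. apply Rsqr_incr_0_var; auto.
Qed.

(** Distance to a does not increase, so periodicity makes it constant, while half of the linear rate
    forces a strict decrease unless it is 0. *)
Lemma periodic_not_contracting (a c : C) : F a = 0 -> fst (c * D a)%C < 0 -> exists r, 0 < r /\
  forall (v : R -> C) (T : R), 0 < T -> (forall s, rderiv v s (c * F (v s))) ->
    (Cmod (v 0%R - a) < r) -> v T = v 0%R -> v 0%R = a.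
Proof.
  intros Ea Hneg.
  destruct (attracting_stable a c Ea Hneg) as [r1 [Hr1 S]].
  destruct (radial_estimate a c Ea (- fst (c * D a)%C / 2) ltac:(lra)) as [r2 [Hr2 K]].
  exists (Rmin r1 r2). split; [apply Rmin_pos; auto|]. intros v T HT Hv H0 HvT.
  destruct (Rlt_Rmin _ _ _ H0) as [H1 H2].
  assert (S' := fun T' HT' => S v T' HT' (fun s _ => Hv s) H1).
  set (m := (- fst (c * D a)%C / 2)%R) in *.
  assert (Hd0 : forall t, 0 <= t <= T -> dot (v t - a) (c * F (v t)) <= - m * (Cmod (v t - a) * Cmod (v t - a))).
  { intros t Ht. specialize (K (v t)). pose proof (S' t ltac:(lra) t ltac:(lra)).
    specialize (K ltac:(lra)). apply Rabs_le_between in K. unfold m in *. lra. }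
  assert (Hm : 0 < m) by (unfold m; lra).
  (* The radius at time t is at least the radius at time T, which is the initial one. *)
  assert (Hconst : forall t, 0 <= t <= T -> Cmod (v t - a) = Cmod (v 0%R - a)).
  { intros t Ht. apply Rle_antisym; [apply (S' T); lra|]. rewrite <- HvT.
    replace (v T) with (v (1 * (T - t) + t)%R) by (f_equal; ring).
    assert (St := S (fun s => v (1 * s + t)%R) (T - t)%R ltac:(lra)).
    replace (Cmod (v t - a)) with (Cmod (v (1 * 0 + t)%R - a)) by (do 3 f_equal; ring).
    apply St; [| |lra].
    - intros s _. eapply rderiv_eq; [apply rderiv_comp_affine; apply Hv|]. ring.
    - replace (1 * 0 + t)%R with t by ring. eapply Rle_lt_trans; [apply (S' t); lra|auto]. }
  apply Cmod_zero_eq. destruct (Req_dec (Cmod (v 0%R - a)) 0) as [|n]; auto. exfalso.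
  set (q := (Cmod (v 0%R - a) * Cmod (v 0%R - a))%R) in *.
  assert (Hq : 0 < q) by (unfold q; pose proof (Cmod_ge_0 (v 0%R - a)); nra).
  assert (Hmono : Cmod (v T - a) * Cmod (v T - a) + 2 * m * q * T <= Cmod (v 0%R - a) * Cmod (v 0%R - a) + 2 * m * q * 0).
  { apply (nonincreasing_of_derive (fun s => Cmod (v s - a) * Cmod (v s - a) + 2 * m * q * s)%R
      (fun s => 2 * dot (v s - a) (c * F (v s) - 0) + 2 * m * q)%R); [lra|].
    intros t Ht. split.
    - apply (is_derive_plus (fun s => Cmod (v s - a) * Cmod (v s - a))%R (fun s => 2 * m * q * s)%R).
      + apply (rderiv_sqr (fun s => v s - a)). apply rderiv_minus; [auto|apply rderiv_const].
      + auto_derive; auto; ring.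
    - replace (c * F (v t) - 0) with (c * F (v t)) by ring. specialize (Hd0 t Ht).
      rewrite (Hconst t Ht) in Hd0. fold q in Hd0. lra. }
  rewrite HvT in Hmono. assert (0 < m * q * T) by (apply Rmult_lt_0_compat; [apply Rmult_lt_0_compat|]; auto). lra.
Qed.
End Equilibria.

Lemma Cmult_eq_0_r (x y : C) : x * y = 0 -> x <> 0 -> y = 0.
Proof. intros E Hx. apply NNPP. intros Hy. apply (Cmult_neq_0 x y); auto. Qed.

(** If the segment from al to be passes through 0, both ends lie on one real line through 0. The
    detour via Ci al leaves this line and meets it again only at be. *)
Lemma segment_detour (al be : C) (t0 : R) : al <> 0 -> be <> 0 -> 0 <= t0 <= 1 ->
  al + RtoC t0 * (be - al) = 0 ->
  forall t, 0 <= t <= 1 -> al + RtoC t * (Ci * al - al) <> 0 /\ Ci * al + RtoC t * (be - Ci * al) <> 0.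
Proof.
  intros Hal Hbe Ht0 E0 t Ht. split.
  - intros E.
    assert (E' : al * (1 + RtoC t * (Ci - 1)) = 0) by (rewrite <- E; ring).
    apply Cmult_eq_0_r in E'; [|auto].
    pose proof (f_equal fst E') as E1. pose proof (f_equal snd E') as E2. simpl in E1, E2. lra.
  - intros E.
    (* Multiplying by t0 lets [E0] eliminate be; what is left is al times a number whose real and
       imaginary parts must vanish. *)
    assert (E' : al * (RtoC t0 * RtoC (1 - t) * Ci - RtoC t * RtoC (1 - t0)) = 0).
    { replace (RtoC 0) with (RtoC t0 * (Ci * al + RtoC t * (be - Ci * al)) - RtoC t * (al + RtoC t0 * (be - al))) by (rewrite E, E0; ring).
      rewrite !RtoC_minus. ring. }
    apply Cmult_eq_0_r in E'; [|auto].
    pose proof (f_equal fst E') as E1. pose proof (f_equal snd E') as E2. simpl in E1, E2.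
    assert (Q1 : (t0 * (1 - t) = 0)%R) by lra. assert (Q2 : (t * (1 - t0) = 0)%R) by lra.
    apply Rmult_integral in Q1. destruct Q1 as [Q1|Q1].
    + subst t0. apply Hal. rewrite <- E0. ring.
    + assert (t = 1)%R by lra. subst t. assert (t0 = 1)%R by lra. subst t0.
      apply Hbe. rewrite <- E0. ring.
Qed.

(** * Images of half-planes and their limit points *)

Section HalfPlaneSolution.
Variables (F D : C -> C) (U : C -> C) (d P B : R).
Hypothesis (HF : regular F D).
Hypothesis (Hd : 0 < d).
Hypothesis (HP : 0 < P).
Hypothesis (HU : forall z : C, - d < snd z -> cderiv U z (F (U z))).
Hypothesis (Hper : forall z : C, - d < snd z -> U (z + RtoC P) = U z).
Hypothesis (Hnz : forall z : C, - d < snd z -> F (U z) <> 0).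
Hypothesis (HB : forall z : C, 0 <= snd z -> Cmod (U z) <= B).

Definition level (s t : R) : C := U (t, s).

Definition above (s : R) (w : C) : Prop := exists z : C, s < snd z /\ U z = w.

(** The image itself omits every zero of F, so only its closure can contain a. *)
Definition above_closure (s : R) (w : C) : Prop :=
  forall eps, 0 < eps -> exists z : C, s < snd z /\ Cmod (U z - w) < eps.

Lemma level_solution (s t : R) : 0 <= s -> rderiv (level s) t (F (level s t)).
Proof.
  intros Hs. apply (rderiv_ext_loc (fun r => U ((0, s)%R + RtoC r * 1)) _ t _ 1%R).
  - lra.
  - intros r _. unfold level. f_equal. ceq.
  - assert (E : (t, s)%R = (0, s)%R + RtoC t * 1) by ceq. unfold level.
    eapply rderiv_eq; [apply cderiv_along; apply HU; simpl; lra|]. rewrite <- E. ring.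
Qed.

Lemma level_periodic (s t : R) : 0 <= s -> level s (t + P) = level s t.
Proof.
  intros Hs. unfold level. rewrite <- (Hper (t, s)%R) by (simpl; lra). f_equal. ceq.
Qed.

Lemma level_closed (s : R) : 0 <= s -> forall w, ~ orbit_of (level s) w ->
  exists r, 0 < r /\ forall p, Cmod (p - w) < r -> ~ orbit_of (level s) p.
Proof.
  intros Hs. apply (periodic_orbit_closed (level s) P HP).
  - intros; apply level_periodic; auto.
  - intros t. eapply rderiv_rcont, level_solution; auto.
Qed.

(** A local flow W from w covers a neighbourhood of w, which contains some U z with s < snd z. There
    U and W differ by a translation of time, so moving z by zp - zq leads U to p. *)
Lemma above_open_at_regular (s : R) (w : C) : 0 <= s -> above_closure s w -> ~ orbit_of (level s) w ->
  F w <> 0 -> exists r, 0 < r /\ forall p, Cmod (p - w) < r -> above s p.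
Proof.
  intros Hs Hcl Hlev Hw.
  destruct (level_closed s Hs w Hlev) as [r0 [Hr0 Hav]].
  pose proof (Cmod_ge_0 w).
  destruct (complex_flow F D HF (Cmod w + 1) ltac:(lra)) as [e0 [He0 Hfl]].
  destruct (Hfl w ltac:(lra)) as [W [W0 HW]].
  destruct (cderiv_ccont _ _ _ (proj1 (HW 0 ltac:(rewrite Cmod_0; auto))) r0 Hr0) as [e1 [He1 Kc]].
  set (e := Rmin (d / 2) (Rmin e0 e1)).
  assert (He : 0 < e) by (repeat apply Rmin_pos; lra).
  assert (ed : e <= d / 2) by apply Rmin_l.
  assert (ee0 : e <= e0) by (eapply Rle_trans; [apply Rmin_r|apply Rmin_l]).
  assert (ee1 : e <= e1) by (eapply Rle_trans; [apply Rmin_r|apply Rmin_r]).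
  assert (Z0 : forall z : C, z - 0 = z) by (intros; ring).
  destruct (local_surjectivity F D HF W 0 e e He He) as [rho [Hrho L]].
  { intros z Hz. rewrite Z0 in Hz. apply HW. lra. }
  { rewrite W0. auto. }
  rewrite W0 in L.
  exists rho. split; auto. intros p Hp.
  destruct (L p Hp) as [zp [Hzp Ep]]. rewrite Z0 in Hzp.
  destruct (Hcl rho Hrho) as [z [Hz Hzw]].
  destruct (L (U z) Hzw) as [zq [Hzq Eq]]. rewrite Z0 in Hzq.
  assert (Hseg : forall t, 0 <= t <= 1 -> Cmod (zq + RtoC t * (zp - zq)) < e).
  { intros t Ht. rewrite <- (Z0 (zq + _)). apply Cmod_segment; rewrite ?Z0; auto. }
  assert (Him : forall t, 0 <= t <= 1 -> - d < snd (z + RtoC t * (zp - zq))%C).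
  { intros t Ht. pose proof (Cmod_snd (zp - zq)%C) as Q. pose proof (Cmod_triangle zp (- zq)) as Q2.
    rewrite Cmod_opp in Q2. change (zp + - zq) with (zp - zq) in Q2.
    assert (Q3 : Rabs (snd (zp - zq)%C) < d) by lra. apply Rabs_def2 in Q3.
    replace (snd (z + RtoC t * (zp - zq))%C) with (snd z + t * snd (zp - zq)%C)%R by (simpl; ring). nra. }
  assert (Hmatch : forall t, 0 <= t <= 1 -> U (z + RtoC t * (zp - zq)) = W (zq + RtoC t * (zp - zq))).
  { intros t Ht. replace (z + RtoC t * (zp - zq)) with (zq + RtoC t * (zp - zq) + (z - zq)) by ring.
    apply (complex_unique F D HF (fun u => U (u + (z - zq))) W zq (zq + RtoC t * (zp - zq))).
    - intros r Hr. replace (zq + RtoC r * (zq + RtoC t * (zp - zq) - zq)) with (zq + RtoC (r * t) * (zp - zq)) by (rewrite RtoC_mult; ring).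
      apply (cderiv_shift U). apply HU.
      replace (zq + RtoC (r * t) * (zp - zq) + (z - zq)) with (z + RtoC (r * t) * (zp - zq)) by ring.
      apply Him. nra.
    - intros r Hr. replace (zq + RtoC r * (zq + RtoC t * (zp - zq) - zq)) with (zq + RtoC (r * t) * (zp - zq)) by (rewrite RtoC_mult; ring).
      apply HW. assert (Hrt : 0 <= r * t <= 1) by nra. specialize (Hseg _ Hrt). lra.
    - replace (zq + (z - zq)) with z by ring. auto. }
  exists (z + RtoC 1 * (zp - zq)). split.
  - destruct (Rlt_dec s (snd (z + RtoC 1 * (zp - zq))%C)) as [|N]; auto. exfalso.
    set (dz := snd (zp - zq)%C).
    assert (Es : forall t, snd (z + RtoC t * (zp - zq))%C = (snd z + t * dz)%R) by (intros; unfold dz; simpl; ring).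
    rewrite Es in N.
    assert (Hdz : dz < 0) by lra.
    (* The moment at which the path would cross height s: there W lies on the level and within r0 of
       w, against the choice of r0. *)
    set (t := ((s - snd z) / dz)%R).
    assert (Et : (t * dz = s - snd z)%R) by (unfold t; field; lra).
    assert (Ht : 0 <= t <= 1) by (split; nra).
    apply (Hav (W (zq + RtoC t * (zp - zq)))).
    + rewrite <- W0. apply Kc. rewrite Z0. specialize (Hseg t Ht). lra.
    + exists (fst (z + RtoC t * (zp - zq))). unfold level. rewrite <- Hmatch by auto. f_equal.
      apply injective_projections; [reflexivity|]. cbn [snd]. rewrite Es, Et. ring.
  - rewrite Hmatch by lra. rewrite <- Ep. f_equal. ring.
Qed.

(** F'(w) <> 0 isolates w among the zeros, so in a punctured disc about w the image is both open and
    relatively closed. Punctured discs are connected by segments and detours, hence the image fills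
    this one. *)
Lemma above_open_at_zero (s : R) (w : C) : 0 <= s -> above_closure s w -> F w = 0 ->
  exists r, 0 < r /\ forall p, Cmod (p - w) < r -> above_closure s p.
Proof.
  intros Hs Hcl Hw.
  assert (HD : D w <> 0).
  { apply (period_at_zero F D HF w P HP Hw). intros eps Heps.
    destruct (Hcl eps Heps) as [z [Hz Hzw]].
    exists (fun t => level (snd z) (1 * t + fst z)%R). assert (Hz0 : 0 <= snd z) by lra. split; [|split; [|split]].
    - intros t. eapply rderiv_eq; [apply rderiv_comp_affine, level_solution; auto|]. ring.
    - rewrite <- (level_periodic _ (1 * 0 + fst z)) by auto. f_equal. ring.
    - apply Hnz. simpl. lra.
    - replace (level (snd z) (1 * 0 + fst z)) with (U z); auto.
      unfold level. f_equal. ceq. }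
  destruct (zero_isolated F D HF w Hw HD) as [r1 [Hr1 Hiso]].
  assert (Hnl : forall p, F p = 0 -> ~ orbit_of (level s) p).
  { intros p Ep [t Et]. rewrite <- Et in Ep. revert Ep. apply Hnz. simpl. lra. }
  destruct (level_closed s Hs w (Hnl w Hw)) as [r2 [Hr2 Hav]].
  set (r := Rmin r1 r2). assert (Hr : 0 < r) by (apply Rmin_pos; auto).
  assert (rr1 : r <= r1) by apply Rmin_l. assert (rr2 : r <= r2) by apply Rmin_r.
  assert (Hloc : forall p, p <> w -> Cmod (p - w) < r -> above_closure s p ->
     exists e, 0 < e /\ forall q, Cmod (q - p) < e -> above s q).
  { intros p Hp Hpr Hcp. apply above_open_at_regular; auto.
    - apply Hav. lra.
    - apply Hiso; auto. lra. }
  assert (Hself : forall p, above s p -> above_closure s p).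
  { intros p [z [Hz <-]] eps Heps. exists z. split; auto. rewrite Cmod_diag; auto. }
  assert (Hsegm : forall q p, Cmod (q - w) < r -> Cmod (p - w) < r ->
    (forall t, 0 <= t <= 1 -> q + RtoC t * (p - q) <> w) -> above s q -> above s p).
  { intros q p Hq Hp Hne Aq.
    replace p with (q + RtoC 1 * (p - q)) by ring.
    apply (interval_clopen (fun t => above s (q + RtoC t * (p - q))) 1).
    - lra.
    - replace (q + RtoC 0 * (p - q)) with q by ring. auto.
    - intros t Ht Happ.
      assert (Hdist : forall t', Cmod (q + RtoC t' * (p - q) - (q + RtoC t * (p - q))) = (Rabs (t' - t) * Cmod (p - q))%R).
      { intros t'. rewrite <- Cmod_R, <- Cmod_mult. f_equal. rewrite RtoC_minus. ring. }
      pose proof (Cmod_ge_0 (p - q)) as Hpq.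
      assert (Hin : Cmod (q + RtoC t * (p - q) - w) < r) by (apply Cmod_segment; auto).
      assert (Hsc : forall e t', 0 < e -> Rabs (t' - t) < e / (Cmod (p - q) + 1) ->
         (Cmod (q + RtoC t' * (p - q) - (q + RtoC t * (p - q))) < e)).
      { intros e t' He Ht'. rewrite Hdist. apply (Rmult_lt_compat_r (Cmod (p - q) + 1)) in Ht'; [|lra].
        replace (e / (Cmod (p - q) + 1) * (Cmod (p - q) + 1))%R with e in Ht' by (field; lra).
        pose proof (Rabs_pos (t' - t)). nra. }
      destruct (Hloc (q + RtoC t * (p - q))) as [e [He K]]; auto.
      { intros eps Heps. destruct (Happ (eps / (Cmod (p - q) + 1))%R) as [t' (Ht' & Htt & [z [Hz Ez]])].
        - apply Rdiv_lt_0_compat; lra.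
        - exists z. split; auto. rewrite Ez. apply Hsc; auto. }
      exists (e / (Cmod (p - q) + 1))%R. split; [apply Rdiv_lt_0_compat; lra|].
      intros t' Ht' Htt. apply K. apply Hsc; auto. }
  destruct (Hcl r Hr) as [z0 [Hz0 Hzw]].
  set (q := U z0) in *. assert (Aq : above s q) by (exists z0; auto).
  assert (Hqw : q <> w).
  { intros E. apply (Hnz z0); [lra|]. fold q. rewrite E. auto. }
  exists r. split; auto. intros p Hp.
  destruct (classic (p = w)) as [->|Hpw]; auto.
  apply Hself.
  destruct (classic (forall t, 0 <= t <= 1 -> q + RtoC t * (p - q) <> w)) as [Hav1|Hhit].
  - apply (Hsegm q p); auto.
  - apply not_all_ex_not in Hhit. destruct Hhit as [t0 Hhit]. apply imply_to_and in Hhit.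
    destruct Hhit as [Ht0 Hhit]. apply NNPP in Hhit.
    assert (Hdet := segment_detour (q - w) (p - w) t0 (Csub_neq_0 _ _ Hqw) (Csub_neq_0 _ _ Hpw) Ht0).
    specialize (Hdet ltac:(rewrite <- (Cplus_opp_r w); rewrite <- Hhit at 4; ring)).
    set (m := w + Ci * (q - w)).
    assert (Hm : Cmod (m - w) < r).
    { unfold m. replace (w + Ci * (q - w) - w) with (Ci * (q - w)) by ring.
      rewrite Cmod_mult, Cmod_Ci, Rmult_1_l. auto. }
    apply (Hsegm m p); auto.
    + intros t Ht E. apply (proj2 (Hdet t Ht)). rewrite <- (Cplus_opp_r w). rewrite <- E at 4. unfold m. ring.
    + apply (Hsegm q m); auto.
      intros t Ht E. apply (proj1 (Hdet t Ht)). rewrite <- (Cplus_opp_r w). rewrite <- E at 4. unfold m. ring.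
Qed.

Lemma above_closure_connected (s : R) (G : C -> Prop) (p0 : C) : 0 <= s -> connected G ->
  (forall w, G w -> ~ orbit_of (level s) w) -> G p0 -> above_closure s p0 ->
  forall w, G w -> above_closure s w.
Proof.
  intros Hs HG Hav G0 H0 w Gw. apply NNPP. intros Nw.
  (* [O1] is the interior of the closure and [O2] the exterior of the image. They are disjoint, and
     they cover G because the closure is open off the level. *)
  set (O1 := fun p => exists r, 0 < r /\ forall q, Cmod (q - p) < r -> above_closure s q).
  set (O2 := fun p => exists r, 0 < r /\ forall q, Cmod (q - p) < r -> ~ above s q).
  assert (Hopen : forall Q : C -> Prop, open (fun p => exists r, 0 < r /\ forall q, Cmod (q - p) < r -> Q q)).
  { intros Q. apply open_C. intros p [r [Hr K]]. exists (r / 2)%R. split; [lra|].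
    intros q Hq. exists (r / 2)%R. split; [lra|]. intros q' Hq'. apply K.
    pose proof (Cmod_sub_triangle q' q p). lra. }
  assert (Hself : forall p, above s p -> above_closure s p).
  { intros p [z [Hz <-]] eps Heps. exists z. split; auto. rewrite Cmod_diag; auto. }
  assert (H1 : forall p, G p -> above_closure s p -> O1 p).
  { intros p Gp Hp. destruct (classic (F p = 0)) as [E|E].
    - apply above_open_at_zero; auto.
    - destruct (above_open_at_regular s p Hs Hp (Hav p Gp) E) as [r [Hr K]]. exists r. split; auto. }
  assert (H2 : forall p, ~ above_closure s p -> O2 p).
  { intros p Hp. apply NNPP. intros N. apply Hp. intros eps Heps. apply NNPP. intros N'. apply N.
    exists eps. split; auto. intros q Hq [z [Hz Ez]]. apply N'. exists z. split; auto. rewrite Ez. auto. }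
  destruct (HG O1 O2 (Hopen _) (Hopen _)) as [p (Gp & [r1 [Hr1 K1]] & [r2 [Hr2 K2]])].
  - intros p Gp. destruct (classic (above_closure s p)); [left; auto|right; auto].
  - exists p0. auto.
  - exists w. auto.
  - assert (Hp0 : Cmod (p - p) < r1) by (rewrite Cmod_diag; auto).
    destruct (K1 p Hp0 r2 Hr2) as [z [Hz Hzp]]. apply (K2 (U z) Hzp). exists z. auto.
Qed.

Lemma level_reduce (s t : R) : 0 <= s -> exists t', 0 <= t' <= P /\ level s t' = level s t.
Proof. intros Hs. apply (periodic_reduce P (level s) HP). intros; apply level_periodic; auto. Qed.

Lemma above_closure_bounded (s : R) (w : C) : 0 <= s -> above_closure s w -> Cmod w <= B + 1.
Proof.
  intros Hs Hw. destruct (Hw 1%R ltac:(lra)) as [z [Hz Hzw]].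
  pose proof (HB z ltac:(lra)). pose proof (Cmod_le_sub w (U z)). rewrite (Cmod_minus_sym w) in H0. lra.
Qed.

Section Center.
Variable (a : C).
Hypothesis (Ha : F a = 0).
Hypothesis (HK : component (fun w => ~ orbit_of (level 0) w) a (U Ci)).

(** For s = 0 the component of a contains U Ci, so all of it lies in the closure. If a were missed
    above s, the points of the image tending to a would have heights in [0, s], and compactness of
    the rectangle of width P would make a a value of U. *)
Lemma center_in_closure (s : R) : 0 <= s -> above_closure s a.
Proof.
  intros Hs.
  assert (H0 : above_closure 0 a).
  { destruct HK as (G & G1 & G2 & G3 & G4).
    apply (above_closure_connected 0 G (U Ci)); auto; [lra|].
    intros eps Heps. exists Ci. split; [simpl; lra|]. rewrite Cmod_diag; auto. }
  apply NNPP. intros N.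
  assert (N' : exists eps, 0 < eps /\ forall z : C, s < snd z -> eps <= Cmod (U z - a)).
  { apply NNPP. intros N'. apply N. intros eps Heps. apply NNPP. intros N2. apply N'. exists eps. split; auto.
    intros z Hz. apply Rnot_lt_le. intros H. apply N2. exists z. auto. }
  destruct N' as [e1 [He1 K1]].
  destruct (rect_image_closed 0 P 0 s U a) as [z [[_ Hz] Ez]].
  - intros z [_ Hz]. eapply cderiv_ccont, HU. lra.
  - intros eps Heps. destruct (H0 (Rmin eps e1)) as [z [Hz Hza]]; [apply Rmin_pos; auto|].
    pose proof (Rmin_l eps e1). pose proof (Rmin_r eps e1).
    assert (Hzs : snd z <= s).
    { apply Rnot_lt_le. intros H'. specialize (K1 z H'). lra. }
    destruct (level_reduce (snd z) (fst z) ltac:(lra)) as [t' [Ht' Et']].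
    exists (t', snd z)%R. split; [split; simpl; auto; lra|].
    change (U (t', snd z)%R) with (level (snd z) t'). rewrite Et'. unfold level.
    rewrite <- surjective_pairing. lra.
  - apply (Hnz z); [lra|]. rewrite Ez. auto.
Qed.

Lemma center_not_on_level (s : R) : 0 <= s -> ~ orbit_of (level s) a.
Proof. intros Hs [t Et]. apply (Hnz (t, s)%R); [simpl; lra|]. unfold level in Et. rewrite Et. auto. Qed.

(** The component avoids the level and contains a, which is in the closure of the image above s; so
    it lies in that bounded closure. Thus every level encircles a. *)
Lemma component_bounded_at_level (s : R) : 0 <= s ->
  bounded_in_C (component (fun w => ~ orbit_of (level s) w) a).
Proof.
  intros Hs. exists (B + 1)%R. intros w (G & G1 & G2 & G3 & G4).
  apply (above_closure_bounded s); auto.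
  apply (above_closure_connected s G a); auto. apply center_in_closure; auto.
Qed.

Lemma vertical_solution (z : C) (k : R) (s : R) : - d < snd z + k * s ->
  rderiv (fun s => U (z + RtoC s * (RtoC k * Ci))) s (RtoC k * Ci * F (U (z + RtoC s * (RtoC k * Ci)))).
Proof.
  intros Hz. rewrite (Cmult_comm (RtoC k * Ci)). apply cderiv_along. apply HU. simpl. lra.
Qed.

Lemma center_not_repelling : 0 <= snd (D a).
Proof.
  apply Rnot_lt_le. intros Hneg.
  destruct (attracting_stable F D HF a (RtoC (-1) * Ci) Ha) as [r [Hr S]].
  { simpl. lra. }
  destruct (level_closed 0 ltac:(lra) a (center_not_on_level 0 ltac:(lra))) as [e0 [He0 Hav]].
  destruct (center_in_closure 0 ltac:(lra) (Rmin r e0)) as [z [Hz Hza]]; [apply Rmin_pos; auto|].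
  pose proof (Rmin_l r e0). pose proof (Rmin_r r e0).
  (* Descending from z reaches the real axis at time [snd z], still within e0 of a. *)
  specialize (S (fun s => U (z + RtoC s * (RtoC (-1) * Ci))) (snd z) ltac:(lra)).
  cbv beta in S. replace (z + RtoC 0 * (RtoC (-1) * Ci)) with z in S by ring.
  apply (Hav (U (z + RtoC (snd z) * (RtoC (-1) * Ci)))).
  - eapply Rle_lt_trans; [apply S; try lra|lra].
    intros s Hs. apply vertical_solution. lra.
  - exists (fst z). unfold level. f_equal. ceq.
Qed.

(** Closeness to a is known at one point z only. The upward flow keeps the vertical line through z
    close to a, and the flow of F over at most one period carries this to the imaginary axis. *)
Lemma converges_to_center : 0 < snd (D a) -> forall eps, 0 < eps -> exists S, forall s, S <= s ->
  (Cmod (level s 0 - a) < eps).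
Proof.
  intros Hpos eps Heps.
  destruct (attracting_stable F D HF a (RtoC 1 * Ci) Ha) as [r [Hr St]].
  { simpl. lra. }
  pose proof (Cmod_ge_0 a).
  destruct (ode_dependence F D HF (Cmod a + 1) 1 P ltac:(lra) ltac:(lra) ltac:(lra)) as [E [HE Hdep]].
  (* r is for stability, / E for the smallness required in [ode_dependence], eps / E for the
     conclusion. *)
  set (e := Rmin r (Rmin (/ E) (eps / E))).
  assert (He : 0 < e).
  { repeat apply Rmin_pos; auto; [apply Rinv_0_lt_compat; lra|apply Rdiv_lt_0_compat; lra]. }
  assert (er : e <= r) by apply Rmin_l.
  assert (eE : e <= / E) by (eapply Rle_trans; [apply Rmin_r|apply Rmin_l]).
  assert (eE2 : e <= eps / E) by (eapply Rle_trans; [apply Rmin_r|apply Rmin_r]).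
  destruct (center_in_closure 0 ltac:(lra) e He) as [z [Hz Hza]].
  exists (snd z). intros s Hs.
  assert (H1 : Cmod (level s (fst z) - a) < e).
  { eapply Rle_lt_trans; [|exact Hza].
    specialize (St (fun s => U (z + RtoC s * (RtoC 1 * Ci))) (s - snd z)%R ltac:(lra)).
    cbv beta in St. replace (z + RtoC 0 * (RtoC 1 * Ci)) with z in St by ring.
    replace (level s (fst z)) with (U (z + RtoC (s - snd z) * (RtoC 1 * Ci))).
    - apply St; try lra. intros s' Hs'. apply vertical_solution. lra.
    - unfold level. f_equal. ceq. }
  destruct (periodic_reduce P (fun t => level s (1 * t + fst z)%R) HP) with (t := (- fst z)%R) as [t' [Ht' Et']].
  { intros t. rewrite <- (level_periodic s (1 * t + fst z)) by lra. f_equal. ring. }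
  replace (1 * - fst z + fst z)%R with 0%R in Et' by ring. rewrite <- Et'.
  assert (E0 : level s (1 * 0 + fst z)%R = level s (fst z)) by (f_equal; ring).
  apply (Rmult_le_compat_r E) in eE; [|lra]. rewrite Rinv_l in eE by lra.
  apply (Rmult_le_compat_r E) in eE2; [|lra]. replace (eps / E * E)%R with eps in eE2 by (field; lra).
  assert (HeE : Cmod (level s (fst z) - a) * E < e * E) by (apply Rmult_lt_compat_r; lra).
  assert (Q := Hdep (fun _ => a) (fun t => level s (1 * t + fst z)%R) (fun _ => 1)).
  cbv beta in Q. rewrite E0 in Q.
  eapply Rle_lt_trans; [apply Q|]; auto.
  - intros t _. apply (constant_solution F a (fun _ => 1)); auto.
  - intros t _. eapply rderiv_eq; [apply rderiv_comp_affine, level_solution; lra|]. ring.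
  - intros t _. rewrite Cmod_1. lra.
  - intros t _. lra.
  - lra.
  - lra.
Qed.
End Center.
End HalfPlaneSolution.

(** * The basin of a center *)

(* Unfolds center_basin away from a; a itself is off the orbit because F a = 0. *)
Definition encircled (F : C -> C) (a x : C) : Prop :=
  exists (Y : R -> C) (P : R), 0 < P /\ (forall t, rderiv Y t (F (Y t))) /\
    (forall t, Y (t + P)%R = Y t) /\ Y 0%R = x /\ F x <> 0 /\
    bounded_in_C (component (fun w => ~ orbit_of Y w) a).

Lemma regular_opp (F D : C -> C) : regular F D -> regular (fun z => - F z) (fun z => - D z).
Proof.
  intros [H1 H2]. split.
  - intros z eps He. destruct (H1 z eps He) as [d [Hd K]]. exists d. split; auto. intros w Hw.
    replace (- F w - - F z - - D z * (w - z)) with (- (F w - F z - D z * (w - z))) by ring.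
    rewrite Cmod_opp. auto.
  - intros R0 HR. destruct (H2 R0 HR) as (L & M & HL & HM & K). exists L, M. split; auto. split; auto.
    intros x y Hx Hy. destruct (K x y Hx Hy) as (K1 & K2 & K3).
    replace (- F y - - F x) with (- (F y - F x)) by ring.
    replace (- (F y - F x) - - D x * (y - x)) with (- (F y - F x - D x * (y - x))) by ring.
    rewrite !Cmod_opp. auto.
Qed.

Lemma component_mono (S S' : C -> Prop) (x y : C) : (forall z, S z -> S' z) -> component S x y -> component S' x y.
Proof. intros H (K & K1 & K2 & K3). exists K. split; auto. Qed.

Lemma bounded_component_ext (S S' : C -> Prop) (x : C) : (forall z, S z <-> S' z) ->
  bounded_in_C (component S x) -> bounded_in_C (component S' x).
Proof.
  intros H [M HM]. exists M. intros z Hz. apply HM. apply (component_mono S'); auto. intros w; apply H.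
Qed.

(** Time reversal is written -1 * s + 0 to fit [rderiv_comp_affine]. *)
Lemma reversed_solution (F : C -> C) (Y : R -> C) : (forall t, rderiv Y t (F (Y t))) ->
  forall t, rderiv (fun s => Y (-1 * s + 0)%R) t (- F (Y (-1 * t + 0)%R)).
Proof.
  intros H t. eapply rderiv_eq; [apply rderiv_comp_affine, H|]. ceq.
Qed.

Lemma orbit_of_reversed (Y : R -> C) (w : C) : orbit_of Y w <-> orbit_of (fun s => Y (-1 * s + 0)%R) w.
Proof.
  split; intros [t <-]; [exists (- t)%R|exists (-1 * t + 0)%R]; auto. f_equal. ring.
Qed.

Lemma encircled_opp (F : C -> C) (a x : C) : encircled F a x -> encircled (fun z => - F z) a x.
Proof.
  intros (Y & P & HP & HY & Hper & Y0 & Hx & HK).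
  exists (fun s => Y (-1 * s + 0)%R), P. split; auto. split; [|split; [|split; [|split]]].
  - apply reversed_solution; auto.
  - intros t. rewrite <- (Hper (-1 * (t + P) + 0)%R). f_equal. ring.
  - rewrite <- Y0. f_equal. ring.
  - intros E. apply Hx. replace (F x) with (- - F x) by ring. rewrite E. ring.
  - eapply bounded_component_ext; [|exact HK]. intros z. cbv beta. rewrite (orbit_of_reversed Y). reflexivity.
Qed.

Definition contracting_curve (F : C -> C) (a x : C) (v : R -> C) : Prop :=
  v 0%R = x /\ (forall s, 0 <= s -> rderiv v s (Ci * F (v s)) /\ encircled F a (v s)) /\
  forall eps, 0 < eps -> exists S, forall s, S <= s -> Cmod (v s - a) < eps.

(** The case in which K is entered above the axis. The sign in the conclusion makes the curve
    converge; applied to - F, it also excludes entry from below. *)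
Lemma inward_curve (F D : C -> C) (a : C) (Y : R -> C) (P eta : R) (U0 : C -> C) (z0 : C) :
  regular F D -> F a = 0 -> snd (D a) <> 0%R -> 0 < P -> (forall t, rderiv Y t (F (Y t))) ->
  (forall t, Y (t + P)%R = Y t) -> F (Y 0%R) <> 0 -> bounded_in_C (component (fun w => ~ orbit_of Y w) a) ->
  (0 < eta) -> solves_on F (- eta) eta U0 -> (forall t : R, U0 (RtoC t) = Y t) ->
  (0 < snd z0 < eta) -> component (fun w => ~ orbit_of Y w) a (U0 z0) ->
  (0 < snd (D a)) /\ exists v, contracting_curve F a (Y 0%R) v.
Proof.
  intros HF Ea HDa HP HY Hper Hnz HK Heta HU0 HU0Y Hz0 Kz0.
  destruct (half_plane_flow F D HF Y P a HY HP Hper Hnz HK eta U0 z0 Heta HU0 HU0Y Hz0 Kz0)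
    as (d & U & Hd & HU & HUY & HUK).
  (* The upper end |snd z| + d depends on the point at hand, so that lemmas on strips apply to the
     half-plane. *)
  assert (Hsol : forall z : C, solves_on F (- d) (Rabs (snd z) + d) U).
  { intros z w Hw. apply HU. lra. }
  assert (Hdom : forall z : C, - d < snd z -> - d < snd z < Rabs (snd z) + d).
  { intros z Hz. pose proof (Rle_abs (snd z)). lra. }
  assert (HUper : forall z : C, - d < snd z -> U (z + RtoC P) = U z).
  { intros z Hz. pose proof (Rabs_pos (snd z)). apply (strip_periodic F D HF (- d) (Rabs (snd z) + d) P U 0); auto.
    - simpl. lra.
    - rewrite <- RtoC_plus, !HUY. apply Hper. }
  assert (HUnz : forall z : C, - d < snd z -> F (U z) <> 0).
  { intros z Hz. pose proof (Rabs_pos (snd z)). apply (strip_nonzero F D HF (- d) (Rabs (snd z) + d) U 0); auto.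
    - simpl. lra.
    - rewrite HUY. auto. }
  destruct (periodic_orbit_bounded Y P HP Hper) as [B1 [HB1 HB1']].
  { intros t. eapply rderiv_rcont, HY. }
  destruct HK as [M HM].
  assert (HB : forall z : C, 0 <= snd z -> Cmod (U z) <= B1 + Rabs M).
  { intros z Hz. pose proof (Rabs_pos M). pose proof (Rle_abs M). destruct (Req_dec (snd z) 0) as [E|NE].
    - replace z with (RtoC (fst z)) by (apply injective_projections; simpl; auto). rewrite HUY.
      specialize (HB1' (fst z)). lra.
    - specialize (HM _ (HUK z ltac:(lra))). lra. }
  assert (E0 : level U 0 = Y).
  { apply functional_extensionality. intros t. apply HUY. }
  assert (HC : component (fun w => ~ orbit_of (level U 0) w) a (U Ci)).
  { rewrite E0. apply HUK. simpl; lra. }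
  assert (Hpos : 0 < snd (D a)).
  { pose proof (center_not_repelling F D U d P HF Hd HP HU HUper HUnz a Ea HC). lra. }
  split; auto.
  exists (fun s => level U s 0). split; [|split].
  - rewrite E0. auto.
  - intros s Hs. split.
    + apply (rderiv_ext_loc (fun s => U (0 + RtoC s * (RtoC 1 * Ci))) _ s _ 1%R); [lra| |].
      * intros r _. unfold level. f_equal. ceq.
      * assert (E : level U s 0 = U (0 + RtoC s * (RtoC 1 * Ci))) by (unfold level; f_equal; ceq).
        rewrite E. replace (Ci * F (U (0 + RtoC s * (RtoC 1 * Ci)))) with (RtoC 1 * Ci * F (U (0 + RtoC s * (RtoC 1 * Ci)))) by ring.
        apply (vertical_solution F U d HU 0 1 s). simpl. lra.
    + exists (level U s), P. split; auto. split; [|split; [|split; [|split]]]; auto.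
      * intros t. apply (level_solution F U d Hd HU); auto.
      * intros t. apply (level_periodic U d P Hd HUper); auto.
      * apply HUnz. simpl; lra.
      * apply (component_bounded_at_level F D U d P (B1 + Rabs M) HF Hd HP HU HUper HUnz HB a Ea HC s Hs).
  - apply (converges_to_center F D U d P HF Hd HP HU HUper HUnz a Ea HC Hpos).
Qed.

Lemma contracting_curve_exists (F D : C -> C) (a x : C) : regular F D -> F a = 0 -> 0 < snd (D a) ->
  encircled F a x -> exists v, contracting_curve F a x v.
Proof.
  intros HF Ea HDa (Y & P & HP & HY & Hper & Y0 & Hx & HK). subst x.
  destruct (periodic_orbit_bounded Y P HP Hper) as [B [HB0 HB]].
  { intros t. eapply rderiv_rcont, HY. }
  destruct (strip_flow F D HF B HB0) as (eta & Heta & Hstrip).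
  destruct (Hstrip Y HY HB) as (U & UY & HU & _).
  assert (Ha : ~ orbit_of Y a).
  { intros [t Et]. apply (solution_nonzero F D HF Y t 0 HY Hx). rewrite Et. auto. }
  destruct (strip_meets_component F D HF Y P a HY HP Hper Hx Ha HK eta U Heta HU UY) as (z & Hz & Hz0 & Kz).
  destruct (Rlt_dec 0 (snd z)) as [Hpos|Hneg].
  - apply (inward_curve F D a Y P eta U z); auto; lra.
  - exfalso.
    (* U (- z) solves the equation of - F and moves the point of entry above the axis. *)
    destruct (inward_curve (fun z => - F z) (fun z => - D z) a (fun s => Y (-1 * s + 0)%R) P eta (fun z => U (- z)) (- z)) as [H _].
    + apply regular_opp; auto.
    + rewrite Ea. ring.
    + simpl. lra.
    + auto.
    + apply reversed_solution; auto.
    + intros t. rewrite <- (Hper (-1 * (t + P) + 0)%R). f_equal. ring.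
    + intros E. apply Hx. replace (-1 * 0 + 0)%R with 0%R in E by ring.
      replace (F (Y 0%R)) with (- - F (Y 0%R)) by ring. rewrite E. ring.
    + eapply bounded_component_ext; [|exact HK]. intros w. cbv beta. rewrite (orbit_of_reversed Y). reflexivity.
    + auto.
    + intros w Hw eps Heps. destruct (HU (- w)) with (eps := eps) as [r [Hr K]]; auto.
      { simpl. lra. }
      exists r. split; auto. intros u Hu.
      replace (U (- u) - U (- w) - - F (U (- w)) * (u - w)) with (U (- u) - U (- w) - F (U (- w)) * (- u - - w)) by ring.
      rewrite (Cmod_minus_sym u w) in *. replace (w - u) with (- u - - w) in * by ring. auto.
    + intros t. rewrite <- RtoC_opp, UY. f_equal. ring.
    + simpl. lra.
    + replace (- - z) with z by ring.
      apply (component_mono (fun w => ~ orbit_of Y w)); auto.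
      intros w. rewrite (orbit_of_reversed Y). auto.
    + simpl in H. lra.
Qed.

Lemma Rbar_between (alpha beta : Rbar) (t s : R) : Rbar_lt alpha 0 -> Rbar_lt 0 beta ->
  Rbar_lt alpha t -> Rbar_lt t beta -> 0 <= s <= 1 -> Rbar_lt alpha (t * s + 0)%R /\ Rbar_lt (t * s + 0)%R beta.
Proof.
  intros H1 H2 H3 H4 Hs. split; [destruct alpha|destruct beta]; simpl in *; auto; destruct (Rle_dec 0 t); nra.
Qed.

(** * Orbits and periodic solutions *)

Section Orbits.
Variables (F D : C -> C).
Hypothesis (HF : regular F D).

(** A solution on the whole line is maximal since no interval is larger; any other maximal solution
    agrees with it by uniqueness, after rescaling time to [0, 1] for either sign of t. *)
Lemma orbit_of_global_solution (Y : R -> C) (w : C) : (forall t, rderiv Y t (F (Y t))) ->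
  orbit F (Y 0%R) w <-> orbit_of Y w.
Proof.
  intros HY. split.
  - intros (alpha & beta & u & t & (H1 & H2 & H3 & H4 & _) & H5 & H6 & <-).
    exists t.
    replace (Y t) with (Y (t * 1 + 0)%R) by (f_equal; ring). replace (u t) with (u (t * 1 + 0)%R) by (f_equal; ring).
    apply (ode_unique F D HF (Rabs t) 1 (fun s => Y (t * s + 0)%R) (fun s => u (t * s + 0)%R) (fun _ => RtoC t)).
    + apply Rabs_pos.
    + lra.
    + intros s Hs. apply rderiv_comp_affine. auto.
    + intros s Hs. apply rderiv_comp_affine. apply rderiv_iff. 
      destruct (Rbar_between alpha beta t s H1 H2 H5 H6 Hs). apply H4; auto.
    + intros s Hs. rewrite Cmod_R. lra.
    + replace (t * 0 + 0)%R with 0%R by ring. auto.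
  - intros [t <-]. exists m_infty, p_infty, Y, t. split; [|simpl; auto].
    split; [simpl; auto|]. split; [simpl; auto|]. split; auto. split.
    + intros s _ _. apply rderiv_iff, HY.
    + intros alpha' beta' v Ha Hb _ _. split.
      * destruct alpha'; simpl in Ha; tauto.
      * destruct beta'; simpl in Hb; tauto.
Qed.

Lemma periodic_orbit_solution (x : C) : is_periodic_orbit F (orbit F x) ->
  exists (Y : R -> C) (P : R), 0 < P /\ (forall t, rderiv Y t (F (Y t))) /\
    (forall t, Y (t + P)%R = Y t) /\ Y 0%R = x /\ F x <> 0.
Proof.
  intros (u & T & Hu & HT & Hper & [t1 Ht1] & HG).
  assert (Hu' : forall t, rderiv u t (F (u t))).
  { intros t. apply rderiv_iff. apply Hu; simpl; auto. }
  (* The orbit is nonempty, as it contains u 0; hence a maximal solution from x exists, and at time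
     0 it yields x. *)
  assert (Hx : orbit F x x).
  { assert (H0 : orbit F x (u 0%R)) by (apply HG; exists 0%R; auto).
    destruct H0 as (alpha & beta & v & t & (H1 & H2 & H3 & H4) & _).
    exists alpha, beta, v, 0%R. split; [split; auto|]. auto. }
  apply HG in Hx. destruct Hx as [t0 Ht0].
  exists (fun t => u (1 * t + t0)%R), T. split; auto. split; [|split; [|split]].
  - intros t. eapply rderiv_eq; [apply rderiv_comp_affine, Hu'|]. ring.
  - intros t. rewrite <- (Hper (1 * t + t0)%R). f_equal. ring.
  - rewrite <- Ht0. f_equal. ring.
  - intros E. rewrite <- Ht0 in E. apply Ht1.
    rewrite (stationary_solution F D HF u t0 t1 Hu' E), (stationary_solution F D HF u t0 0 Hu' E). auto.
Qed.

Lemma center_basin_encircled (a x : C) : F a = 0 -> center_basin F a x <-> (x = a \/ encircled F a x).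
Proof.
  intros Ea. split; (intros [Hx|Hx]; [left; exact Hx|right]).
  - destruct Hx as [Hp [Hn Hb]].
    destruct (periodic_orbit_solution x Hp) as (Y & P & HP & HY & Hper & Y0 & Hx).
    exists Y, P. repeat (split; auto).
    eapply bounded_component_ext; [|exact Hb]. intros z. cbv beta.
    rewrite <- Y0, orbit_of_global_solution by auto. reflexivity.
  - destruct Hx as (Y & P & HP & HY & Hper & Y0 & Hx & HK). subst x.
    split; [|split].
    + exists Y, P. split; [|split; [|split; [|split]]]; auto.
      * intros t _ _. apply rderiv_iff, HY.
      * apply NNPP. intros N. apply Hx.
        assert (Hc : forall t, Y t = Y 0%R).
        { intros t. apply NNPP. intros N'. apply N. exists t. auto. }
        apply (rderiv_unique Y 0); auto.
        apply (rderiv_ext_loc (fun _ => Y 0%R) _ _ _ 1%R); [lra|auto|apply rderiv_const].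
      * intros y. apply orbit_of_global_solution; auto.
    + rewrite orbit_of_global_solution by auto. intros [t Et].
      apply (solution_nonzero F D HF Y t 0 HY Hx). rewrite Et. auto.
    + eapply bounded_component_ext; [|exact HK]. intros z. cbv beta.
      rewrite orbit_of_global_solution by auto. reflexivity.
Qed.

(** If F'(a) were real, F or - F would contract towards a, against the periodicity of nearby
    orbits. *)
Lemma center_derivative (a : C) : is_center F a -> F a = 0 /\ snd (D a) <> 0%R.
Proof.
  intros [[Ea [l [Hl Hl0]]] Hloc]. split; auto. intros E.
  assert (Dl : D a = l) by (apply (cderiv_unique F a); [apply HF|apply cderiv_iff, Hl]).
  destruct (proj1 (locally_Cmod _ _) Hloc) as [r0 [Hr0 Hloc']]. clear Hloc. rename Hloc' into Hloc.
  assert (Hfst : fst (D a) <> 0%R).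
  { intros E1. apply Hl0. rewrite <- Dl. apply injective_projections; simpl; auto. }
  assert (Hc : exists k : R, k * fst (D a) < 0).
  { destruct (Rdichotomy _ _ Hfst); [exists 1%R|exists (-1)%R]; lra. }
  destruct Hc as [k Hk].
  destruct (periodic_not_contracting F D HF a (RtoC k) Ea) as [r [Hr Hno]].
  { simpl. lra. }
  set (e := (Rmin r0 r / 2)%R). assert (He : 0 < Rmin r0 r) by (apply Rmin_pos; auto).
  pose proof (Rmin_l r0 r). pose proof (Rmin_r r0 r).
  set (x := a + RtoC e).
  assert (Hxa : Cmod (x - a) = e).
  { unfold x. replace (a + RtoC e - a) with (RtoC e) by ring. rewrite Cmod_R. apply Rabs_pos_eq. unfold e; lra. }
  assert (Hne : x <> a).
  { intros Ex. rewrite Ex in Hxa. replace (a - a) with (RtoC 0) in Hxa by ring. rewrite Cmod_0 in Hxa. unfold e in Hxa; lra. }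
  destruct (Hloc x) as [Hp _]; auto.
  { rewrite Hxa. unfold e; lra. }
  destruct (periodic_orbit_solution x Hp) as (Y & P & HP & HY & Hper & Y0 & Hx).
  assert (Hk0 : k <> 0%R) by (intros ->; lra).
  apply Hne. 
  assert (Q := Hno (fun t => Y (k * t + 0)%R) (P / Rabs k)%R).
  cbv beta in Q. replace (k * 0 + 0)%R with 0%R in Q by ring. rewrite Y0 in Q. apply Q.
  - apply Rdiv_lt_0_compat; auto. apply Rabs_pos_lt; auto.
  - intros s. apply rderiv_comp_affine. apply HY.
  - rewrite Hxa. unfold e; lra.
  - rewrite <- Y0. destruct (Rdichotomy _ _ Hk0).
    + rewrite Rabs_left by auto. rewrite <- Hper. f_equal. field. lra.
    + rewrite Rabs_pos_eq by lra. rewrite <- (Hper 0%R). f_equal. field. lra.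
Qed.
End Orbits.

(** * Contractible sets *)

(** Joint continuity relative to S and [0, 1]. Base points of loops move during the contraction, and
    [contracts_null_homotopic] corrects for that. *)
Definition contracts (S : C -> Prop) (a : C) (H : C -> R -> C) : Prop :=
  S a /\ (forall x, S x -> H x 0%R = x /\ H x 1%R = a /\ forall r, unit_interval r -> S (H x r)) /\
  forall x r, S x -> unit_interval r -> forall eps, 0 < eps -> exists d, 0 < d /\
    forall x' r', S x' -> unit_interval r' -> Cmod (x' - x) < d -> Rabs (r' - r) < d ->
      (Cmod (H x' r' - H x r) < eps).

Lemma continuous_on_C {T : UniformSpace} (A : T -> Prop) (f : T -> C) :
  continuous_on A f <-> (forall p, A p -> forall eps, 0 < eps ->
    locally p (fun q => A q -> Cmod (f q - f p) < eps)).
Proof.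
  split.
  - intros H p Hp eps He. apply (H p Hp (fun w => (Cmod (w - f p) < eps))).
    apply locally_Cmod. exists eps. auto.
  - intros H p Hp Q HQ. apply locally_Cmod in HQ. destruct HQ as [r [Hr K]].
    specialize (H p Hp r Hr). change (locally p (fun q => A q -> Q (f q))).
    revert H. apply filter_imp. intros q Hq Aq. auto.
Qed.

Lemma continuous_on_glue {T : UniformSpace} (A : T -> Prop) (k : T -> R) (f1 f2 : T -> C) :
  (forall p, continuous k p) ->
  continuous_on (fun p => A p /\ k p <= 0) f1 -> continuous_on (fun p => A p /\ 0 <= k p) f2 ->
  (forall p, A p -> k p = 0%R -> f1 p = f2 p) ->
  continuous_on A (fun p => if Rle_dec (k p) 0 then f1 p else f2 p).
Proof.
  intros Hk H1 H2 E. rewrite continuous_on_C in H1, H2. apply continuous_on_C.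
  intros p Ap eps He.
  destruct (Rtotal_order (k p) 0) as [Hlt|[Heq|Hgt]].
  - assert (L : locally p (fun q => (k q < 0))) by (apply (Hk p (fun y => (y < 0))), open_lt; auto).
    generalize (filter_and _ _ L (H1 p (conj Ap (Rlt_le _ _ Hlt)) eps He)). apply filter_imp.
    intros q [Hq1 Hq2] Aq. destruct (Rle_dec (k q) 0); [|lra]. destruct (Rle_dec (k p) 0); [|lra]. apply Hq2; auto.
  - generalize (filter_and _ _ (H1 p (conj Ap (Req_le _ _ Heq)) eps He) (H2 p (conj Ap (Req_le _ _ (eq_sym Heq))) eps He)).
    apply filter_imp. intros q [Hq1 Hq2] Aq. destruct (Rle_dec (k p) 0); [|lra].
    destruct (Rle_dec (k q) 0); [apply Hq1; auto|]. rewrite (E p Ap Heq). apply Hq2. split; auto; lra.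
  - assert (L : locally p (fun q => (0 < k q))) by (apply (Hk p (fun y => (0 < y))), open_gt; auto).
    assert (Hge : 0 <= k p) by lra.
    generalize (filter_and _ _ L (H2 p (conj Ap Hge) eps He)). apply filter_imp.
    intros q [Hq1 Hq2] Aq. destruct (Rle_dec (k q) 0); [lra|]. destruct (Rle_dec (k p) 0); [lra|]. apply Hq2; auto; split; auto; lra.
Qed.

Lemma continuous_on_contraction {T : UniformSpace} (A : T -> Prop) (S : C -> Prop) (a : C) (H : C -> R -> C)
  (f : T -> C) (l : T -> R) : contracts S a H -> continuous_on A f -> (forall p, A p -> S (f p)) ->
  (forall p, continuous l p) -> (forall p, A p -> unit_interval (l p)) ->
  continuous_on A (fun p => H (f p) (l p)).
Proof.
  intros (_ & _ & Hc) Hf HfS Hl Hlu. rewrite continuous_on_C in Hf. apply continuous_on_C.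
  intros p Ap eps He.
  destruct (Hc (f p) (l p) (HfS p Ap) (Hlu p Ap) eps He) as [d [Hd K]].
  assert (L : locally p (fun q => (Rabs (l q - l p) < d))).
  { apply (Hl p (fun y => (Rabs (y - l p) < d))). exists (mkposreal d Hd). intros y Hy. exact Hy. }
  generalize (filter_and _ _ L (Hf p Ap d Hd)). apply filter_imp. intros q [Hq1 Hq2] Aq. apply K; auto.
Qed.

Lemma continuous_on_reparam {T : UniformSpace} (A : T -> Prop) (g : R -> C) (l : T -> R) :
  continuous_on unit_interval g -> (forall p, continuous l p) -> (forall p, A p -> unit_interval (l p)) ->
  continuous_on A (fun p => g (l p)).
Proof.
  intros Hg Hl Hlu. rewrite continuous_on_C in Hg. apply continuous_on_C. intros p Ap eps He.
  generalize (Hl p _ (Hg (l p) (Hlu p Ap) eps He)). unfold filtermap. apply filter_imp. intros q Hq Aq. auto.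
Qed.

Lemma continuous_on_constant {T : UniformSpace} (A : T -> Prop) (c : C) : continuous_on A (fun _ => c).
Proof.
  apply continuous_on_C. intros p _ eps He. apply filter_forall. intros q _.
  rewrite Cmod_diag. auto.
Qed.

Lemma path_connected_connected (S : C -> Prop) : path_connected S -> connected S.
Proof.
  intros HS U V HU HV Hcov [x [Sx Ux]] [y [Sy Vy]].
  destruct (HS x y Sx Sy) as (g & [Hg HgS] & g0 & g1).
  rewrite continuous_on_C in Hg.
  destruct (path_image_connected g) with (U := U) (V := V) as [z [[t [Ht <-]] Hz]]; auto.
  - intros t Ht eps He. destruct (Hg t Ht eps He) as [d K]. exists d. split; [apply cond_pos|].
    intros s Hs Hd. apply K; auto.
  - intros z [t [Ht <-]]. auto.
  - exists x. split; auto. exists 0%R. split; auto; lra.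
  - exists y. split; auto. exists 1%R. split; auto; lra.
  - exists (g t). auto.
Qed.

Lemma contracts_path_connected (S : C -> Prop) (a : C) (H : C -> R -> C) : contracts S a H -> path_connected S.
Proof.
  intros Hc x y Sx Sy. pose proof Hc as (Sa & HS & _).
  destruct (HS x Sx) as (x0 & x1 & xS). destruct (HS y Sy) as (y0 & y1 & yS).
  exists (fun t => if Rle_dec (t - / 2) 0 then H x (2 * t)%R else H y (2 - 2 * t)%R).
  assert (Hcont : forall k m : R, forall t, continuous (fun t => (k * t + m)%R) t).
  { intros k m t. apply (ex_derive_continuous (V := R_NormedModule)). auto_derive. auto. }
  split; [split|split].
  - apply (continuous_on_glue unit_interval (fun t => (t - / 2)%R)).
    + intros t. apply (continuous_ext (fun t => (1 * t + - / 2)%R)); [intros; simpl; ring|apply Hcont].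
    + apply (continuous_on_contraction _ S a H (fun _ => x)); auto.
      * apply continuous_on_constant.
      * intros t. apply (continuous_ext (fun t => (2 * t + 0)%R)); [intros; simpl; ring|apply Hcont].
      * unfold unit_interval. intros t [Ht1 Ht2]. lra.
    + apply (continuous_on_contraction _ S a H (fun _ => y)); auto.
      * apply continuous_on_constant.
      * intros t. apply (continuous_ext (fun t => (-2 * t + 2)%R)); [intros; simpl; ring|apply Hcont].
      * unfold unit_interval. intros t [Ht1 Ht2]. lra.
    + intros t _ Ht. replace (2 * t)%R with 1%R by lra. replace (2 - 1)%R with 1%R by ring. rewrite x1, y1. auto.
  - unfold unit_interval. intros t Ht. destruct (Rle_dec (t - / 2) 0); [apply xS|apply yS]; unfold unit_interval; lra.
  - destruct (Rle_dec (0 - / 2) 0); [|lra]. rewrite Rmult_0_r. auto.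
  - destruct (Rle_dec (1 - / 2) 0); [lra|]. replace (2 - 2 * 1)%R with 0%R by ring. auto.
Qed.

Lemma continuous_Rmin {T : UniformSpace} (f g : T -> R) (p : T) : continuous f p -> continuous g p ->
  continuous (fun q => Rmin (f q) (g q)) p.
Proof.
  intros Hf Hg. apply filterlim_locally. intros eps.
  pose proof (proj1 (filterlim_locally _ _) Hf eps) as L1. pose proof (proj1 (filterlim_locally _ _) Hg eps) as L2.
  generalize (filter_and _ _ L1 L2). apply filter_imp. intros q [H1 H2].
  change (Rabs (f q - f p) < eps) in H1. change (Rabs (g q - g p) < eps) in H2.
  change (Rabs (Rmin (f q) (g q) - Rmin (f p) (g p)) < eps).
  apply Rabs_def2 in H1. apply Rabs_def2 in H2. apply Rabs_def1; unfold Rmin;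
  destruct (Rle_dec (f q) (g q)); destruct (Rle_dec (f p) (g p)); lra.
Qed.

Ltac Rmin_cases :=
  repeat match goal with |- context [Rmin ?u ?v] =>
    lazymatch constr:((u, v)) with
    | context [Rmin _ _] => fail
    | _ => destruct (Rle_dec u v); [rewrite (Rmin_left u v) by lra|rewrite (Rmin_right u v) by lra]
    end end; lra.

(** The inner - Rmin 0 (- x) is max(0, x); written so, continuity of [Rmin] suffices. *)
Definition clamp (x : R) : R := Rmin 1 (- Rmin 0 (- x)).

Lemma clamp_spec (x : R) : 0 <= clamp x <= 1 /\ ((x <= 0) -> clamp x = 0%R) /\ ((1 <= x) -> clamp x = 1%R) /\
  ((0 <= x <= 1) -> clamp x = x).
Proof.
  unfold clamp. repeat split; intros; Rmin_cases.
Qed.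

Lemma continuous_opp_R {T : UniformSpace} (f : T -> R) p : continuous f p -> continuous (fun q => (- f q)%R) p.
Proof. apply (continuous_opp (V := R_NormedModule)). Qed.

Lemma continuous_plus_R {T : UniformSpace} (f g : T -> R) p : continuous f p -> continuous g p ->
  continuous (fun q => (f q + g q)%R) p.
Proof. apply (continuous_plus (V := R_NormedModule)). Qed.

Lemma continuous_mult_R {T : UniformSpace} (f g : T -> R) p : continuous f p -> continuous g p ->
  continuous (fun q => (f q * g q)%R) p.
Proof. apply (continuous_mult (K := R_AbsRing)). Qed.

Lemma continuous_const_R {T : UniformSpace} (c : R) (p : T) : continuous (fun _ => c) p.
Proof. apply continuous_const. Qed.

Lemma continuous_clamp {T : UniformSpace} (f : T -> R) p : continuous f p -> continuous (fun q => clamp (f q)) p.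
Proof.
  intros H. apply continuous_Rmin; [apply continuous_const_R|]. apply continuous_opp_R.
  apply continuous_Rmin; [apply continuous_const_R|]. apply continuous_opp_R. auto.
Qed.
Ltac plane_cont := repeat match goal with
  | |- continuous (fun p => fst p) _ => apply continuous_fst
  | |- continuous fst _ => apply continuous_fst
  | |- continuous snd _ => apply continuous_snd
  | |- continuous (fun p => snd p) _ => apply continuous_snd
  | |- continuous (fun _ => ?c) _ => apply (continuous_const_R c)
  | |- continuous (fun p => Rmin _ _) _ => apply continuous_Rmin
  | |- continuous (fun p => clamp _) _ => apply continuous_clamp
  | |- continuous (fun p => Rmult _ _) _ => apply continuous_mult_R
  | |- continuous (fun p => Rplus _ _) _ => apply continuous_plus_R
  | |- continuous (fun p => Ropp _) _ => apply continuous_opp_R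
  end.

(** On [0, 1] a trapezoid that equals 1 on the middle third: how far along the track of the base
    point the homotopy has to be at parameter t. *)
Definition plateau (t : R) : R := Rmin 1 (Rmin (3 * t) (3 * (1 + - t))).

(* For s <= 2/3 the loop is first reparametrized to rest at its base point on
   [0,1/3] and [2/3,1], then its middle third is contracted to a while the outer
   thirds follow the track of the base point; for s >= 2/3 the resulting
   there-and-back path is retracted along itself. *)
Lemma contracts_null_homotopic (S : C -> Prop) (a : C) (H : C -> R -> C) (g : R -> C) : contracts S a H ->
  is_path_in S g -> g 0%R = g 1%R -> null_homotopic_in S g.
Proof.
  intros Hc [Hg HgS] E01. pose proof Hc as (Sa & HS & _).
  set (x0 := g 0%R).
  assert (Sx0 : S x0) by (apply HgS; unfold unit_interval; lra).
  (* Clocks of the three stages: alpha runs while s is in [0, 1/3], beta in [1/3, 2/3], gamma in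
     [2/3, 1]. They drive the reparametrization theta, the contraction time lam and the retraction
     mu. *)
  set (alpha := fun s => clamp (3 * s)). set (beta := fun s => clamp (3 * s + -1)).
  set (gamma := fun s => clamp (3 * s + -2)).
  set (theta := fun p : R * R => ((1 + - alpha (snd p)) * fst p + alpha (snd p) * clamp (3 * fst p + -1))%R).
  set (lam := fun p : R * R => Rmin (beta (snd p)) (plateau (fst p))).
  set (mu := fun p : R * R => ((1 + - gamma (snd p)) * plateau (fst p))%R).
  set (A := fun p : R * R => unit_interval (fst p) /\ unit_interval (snd p)).
  assert (Ha : forall s, 0 <= alpha s <= 1) by (intros; apply clamp_spec).
  assert (Hb : forall s, 0 <= beta s <= 1) by (intros; apply clamp_spec).
  assert (Hga : forall s, 0 <= gamma s <= 1) by (intros; apply clamp_spec).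
  assert (Hpl : forall t, 0 <= t <= 1 -> 0 <= plateau t <= 1).
  { intros t Ht. unfold plateau. split; Rmin_cases. }
  assert (Hth : forall p, A p -> unit_interval (theta p)).
  { intros p [P1 P2]. unfold unit_interval, theta in *. specialize (Ha (snd p)).
    destruct (clamp_spec (3 * fst p + -1)) as [Q _]. split; nra. }
  assert (Hlam : forall p, A p -> unit_interval (lam p)).
  { intros p [P1 P2]. unfold unit_interval, lam in *. specialize (Hb (snd p)). specialize (Hpl _ P1).
    unfold Rmin. destruct (Rle_dec (beta (snd p)) (plateau (fst p))); lra. }
  assert (Hmu : forall p, A p -> unit_interval (mu p)).
  { intros p [P1 P2]. unfold unit_interval, mu in *. specialize (Hga (snd p)). specialize (Hpl _ P1). split; nra. }
  assert (c1 : forall p : R * R, continuous (fun p => fst p) p) by (intros; apply continuous_fst).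
  assert (c2 : forall p : R * R, continuous (fun p => snd p) p) by (intros; apply continuous_snd).
  assert (cpl : forall p : R * R, continuous (fun p => plateau (fst p)) p).
  { intros p. unfold plateau. plane_cont. }
  assert (cth : forall p, continuous theta p).
  { intros p. unfold theta, alpha. plane_cont. }
  assert (clam : forall p, continuous lam p).
  { intros p. unfold lam, beta. apply continuous_Rmin; [|apply cpl].
    plane_cont. }
  assert (cmu : forall p, continuous mu p).
  { intros p. unfold mu, gamma. apply continuous_mult_R; [|apply cpl].
    plane_cont. }
  assert (p0 : plateau 0 = 0%R).
  { unfold plateau. Rmin_cases. }
  assert (p1 : plateau 1 = 0%R).
  { unfold plateau. Rmin_cases. }
  destruct (HS x0 Sx0) as (X0 & X1 & XS).
  exists (fun p => if Rle_dec (snd p + - (2 / 3)) 0 then H (g (theta p)) (lam p) else H x0 (mu p)).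
  split; [|split; [|split; [|split]]].
  - apply (continuous_on_glue A (fun p => (snd p + - (2 / 3))%R)).
    + intros p. apply continuous_plus_R; [apply c2|apply continuous_const_R].
    + apply (continuous_on_contraction _ S a H (fun p => g (theta p))); auto.
      * apply continuous_on_reparam; auto. intros p [Ap _]. auto.
      * intros p [Ap _]. apply HgS, Hth; auto.
      * intros p [Ap _]. auto.
    + apply (continuous_on_contraction _ S a H (fun _ => x0)); auto.
      * apply continuous_on_constant.
      * intros p [Ap _]. auto.
    + intros [t s] [P1 P2] Hs. simpl in *. assert (Es : s = (2 / 3)%R) by lra. subst s.
      assert (Ea : alpha (2 / 3)%R = 1%R) by (apply clamp_spec; lra).
      assert (Eb : beta (2 / 3)%R = 1%R) by (apply clamp_spec; lra).
      assert (Ec : gamma (2 / 3)%R = 0%R) by (apply clamp_spec; lra).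
      unfold theta, lam, mu. simpl. rewrite Ea, Eb, Ec.
      assert (El : Rmin 1 (plateau t) = plateau t) by (apply Rmin_right; apply Hpl; auto).
      rewrite El. replace ((1 + - (1)) * t + 1 * clamp (3 * t + -1))%R with (clamp (3 * t + -1)) by ring.
      replace ((1 + - 0) * plateau t)%R with (plateau t) by ring.
      unfold unit_interval in P1.
      (* On the outer thirds the loop rests at [x0], so both formulas follow its track; on the
         middle third both give a. *)
      destruct (Rle_dec t (/ 3)) as [L1|L1]; [|destruct (Rle_dec (2 / 3) t) as [L2|L2]].
      * f_equal. unfold x0. f_equal. apply clamp_spec. lra.
      * f_equal. unfold x0. rewrite E01. f_equal. apply clamp_spec. lra.
      * assert (Ep : plateau t = 1%R).
        { unfold plateau. Rmin_cases. }
        rewrite Ep, X1. apply HS. apply HgS. apply clamp_spec.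
  - intros t s Ht Hs. simpl. assert (Ap : A (t, s)) by (split; auto).
    destruct (Rle_dec (s + - (2 / 3)) 0); [apply HS|apply XS]; auto.
  - intros t Ht. simpl. destruct (Rle_dec (0 + - (2 / 3)) 0); [|lra].
    assert (Ea : alpha 0%R = 0%R) by (apply clamp_spec; lra).
    assert (Eb : beta 0%R = 0%R) by (apply clamp_spec; lra).
    unfold theta, lam. simpl. rewrite Ea, Eb. rewrite Rmin_left by (apply Hpl; auto).
    replace ((1 + - 0) * t + 0 * clamp (3 * t + -1))%R with t by ring. apply HS. auto.
  - intros t Ht. simpl. destruct (Rle_dec (1 + - (2 / 3)) 0); [lra|].
    assert (Ec : gamma 1%R = 1%R) by (apply clamp_spec; lra).
    unfold mu. simpl. rewrite Ec. replace ((1 + - (1)) * plateau t)%R with 0%R by ring. auto.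
  - intros s Hs. simpl. 
    assert (El : forall x, 0 <= x -> Rmin x 0 = 0%R) by (intros; apply Rmin_right; auto).
    unfold lam, mu, theta. simpl. rewrite p0, p1, !Rmult_0_r, !El by apply Hb.
    assert (C0 : clamp (0 + -1) = 0%R) by (apply clamp_spec; lra).
    assert (C1 : clamp (3 * 1 + -1) = 1%R) by (apply clamp_spec; lra).
    rewrite C0, C1.
    replace (0 + alpha s * 0)%R with 0%R by ring.
    replace ((1 + - alpha s) * 1 + alpha s * 1)%R with 1%R by ring. rewrite <- E01. fold x0.
    destruct (Rle_dec (s + - (2 / 3)) 0); auto.
Qed.

Lemma contracts_conclusion (S : C -> Prop) (a : C) (H : C -> R -> C) : contracts S a H ->
  connected S /\ path_connected S /\ simply_connected S.
Proof.
  intros Hc. pose proof (contracts_path_connected S a H Hc) as Hp.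
  split; [apply path_connected_connected; auto|]. split; auto. split; auto.
  intros g Hg E. apply (contracts_null_homotopic S a H); auto.
Qed.

(** * The flow of i F as a contraction of the basin *)

Lemma basin_contracts (F D : C -> C) (a : C) : regular F D -> F a = 0 -> 0 < snd (D a) ->
  exists H, contracts (fun x => x = a \/ encircled F a x) a H.
Proof.
  intros HF Ea HDa. set (S := fun x => x = a \/ encircled F a x).
  assert (Hex : forall x, exists v : R -> C, S x -> v 0%R = x /\ (forall s, 0 <= s -> rderiv v s (Ci * F (v s)) /\ S (v s)) /\
     forall eps, 0 < eps -> exists T, forall s, T <= s -> Cmod (v s - a) < eps).
  { intros x. destruct (classic (S x)) as [[->|Hx]|N]; [| |exists (fun _ => a); tauto].
    - exists (fun _ => a). intros _. split; auto. split.
      + intros s _. split; [apply (constant_solution F a (fun _ => Ci)); auto|left; auto].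
      + intros eps He. exists 0%R. intros s _. rewrite Cmod_diag; auto.
    - destruct (contracting_curve_exists F D a x HF Ea HDa Hx) as [v (v0 & v1 & v2)].
      exists v. intros _. split; auto. split; auto. intros s Hs. destruct (v1 s Hs). split; auto. right; auto. }
  destruct (choice_function _ _ _ Hex) as [psi Hpsi].
  assert (Hdep : forall x T, S x -> 0 <= T -> exists E, 1 <= E /\ forall x', S x' -> Cmod (x' - x) * E < 1 ->
     forall s, 0 <= s <= T -> Cmod (psi x' s - psi x s) <= Cmod (x' - x) * E).
  { intros x T Sx HT. destruct (Hpsi x Sx) as (P0 & P1 & _).
    destruct (curve_bounded (psi x) T HT) as [B [HB HB']].
    { intros t Ht. eapply rderiv_rcont. apply P1. lra. }
    destruct (ode_dependence F D HF B 1 T HB ltac:(lra) HT) as [E [HE K]].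
    exists E. split; auto. intros x' Sx' Hx'. destruct (Hpsi x' Sx') as (P0' & P1' & _).
    specialize (K (psi x) (psi x') (fun _ => Ci)). rewrite P0, P0' in K. apply K; auto.
    - intros t Ht. apply P1. lra.
    - intros t Ht. apply P1'. lra.
    - intros t Ht. rewrite Cmod_Ci. lra. }
  (* An increasing bijection from [0, 1) to [0, +oo), compressing all forward time into the
     contraction parameter. *)
  set (tau := fun r => (/ (1 - r) - 1)%R).
  assert (Htau : forall r, 0 <= r < 1 -> 0 <= tau r).
  { intros r Hr. unfold tau. assert (1 <= / (1 - r)); [|lra]. rewrite <- Rinv_1 at 1. apply Rinv_le_contravar; lra. }
  exists (fun x r => if Rlt_dec r 1 then psi x (tau r) else a).
  split; [left; auto|]. split.
  - intros x Sx. destruct (Hpsi x Sx) as (P0 & P1 & _). split; [|split].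
    + destruct (Rlt_dec 0 1); [|lra]. replace (tau 0) with 0%R; auto. unfold tau. field.
    + destruct (Rlt_dec 1 1); auto. lra.
    + intros r Hr. unfold unit_interval in Hr. destruct (Rlt_dec r 1); [apply P1, Htau; lra|left; auto].
  - intros x r Sx Hr eps He. unfold unit_interval in Hr. destruct (Hpsi x Sx) as (P0 & P1 & P2).
    destruct (Rlt_dec r 1) as [Hr1|Hr1].
    + set (s := tau r). assert (Hs : 0 <= s) by (apply Htau; lra).
      destruct (Hdep x (s + 1)%R Sx ltac:(lra)) as [E [HE K]].
      destruct (rderiv_rcont _ _ _ (proj1 (P1 s Hs)) (eps / 2)%R ltac:(lra)) as [d1 [Hd1 K1]].
      assert (Ht' : is_derive tau r (/ ((1 - r) * (1 - r)))%R).
      { unfold tau. auto_derive; [lra|]. field. lra. }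
      destruct (is_derive_continuous_eps tau r _ Ht' (Rmin d1 1)) as [d2 [Hd2 K2]]; [apply Rmin_pos; lra|].
      (* e E is below 1, as [Hdep] requires, and below eps / 2. *)
      set (e := (Rmin 1 (eps / 2) / (2 * E))%R).
      assert (Hm : 0 < Rmin 1 (eps / 2)) by (apply Rmin_pos; lra).
      assert (Hepos : 0 < e) by (apply Rdiv_lt_0_compat; lra).
      assert (HeE : (e * E = Rmin 1 (eps / 2) / 2)%R) by (unfold e; field; lra).
      pose proof (Rmin_l 1 (eps / 2)). pose proof (Rmin_r 1 (eps / 2)).
      exists (Rmin e (Rmin d2 (1 - r))). split; [repeat apply Rmin_pos; lra|].
      intros x' r' Sx' Hr' Hx' Hrr. unfold unit_interval in Hr'.
      assert (q1 := Rlt_le_trans _ _ _ Hx' (Rmin_l _ _)).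
      assert (q2 := Rlt_le_trans _ _ _ Hrr (Rle_trans _ _ _ (Rmin_r _ _) (Rmin_l _ _))).
      assert (q3 := Rlt_le_trans _ _ _ Hrr (Rle_trans _ _ _ (Rmin_r _ _) (Rmin_r _ _))).
      apply Rabs_def2 in q3. destruct (Rlt_dec r' 1); [|lra].
      specialize (K2 r' q2).
      destruct (Rlt_Rmin _ _ _ K2) as [k1 k2].
      fold s in k1, k2. apply Rabs_def2 in k2.
      assert (Hs' : 0 <= tau r' <= s + 1) by (split; [apply Htau|]; lra).
      assert (HxE : Cmod (x' - x) * E <= e * E) by (apply Rmult_le_compat_r; lra).
      specialize (K x' Sx' ltac:(lra) _ Hs'). specialize (K1 _ k1).
      pose proof (Cmod_sub_triangle (psi x' (tau r')) (psi x (tau r')) (psi x s)). lra.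
    + assert (Er : r = 1%R) by lra. subst r.
      (* Continuity at r = 1: at time [s0] the curve from x is within e / 2 of a, nearby curves are
         then within e, and stability keeps them there for all later times. *)
      destruct (attracting_stable F D HF a Ci Ea) as [rr [Hrr St]].
      { simpl. lra. }
      set (e := Rmin rr eps). assert (Hep : 0 < e) by (apply Rmin_pos; auto).
      assert (e1 : e <= rr) by apply Rmin_l. assert (e2 : e <= eps) by apply Rmin_r.
      destruct (P2 (e / 2)%R ltac:(lra)) as [T HT].
      set (s0 := Rmax T 0). assert (Hs0 : 0 <= s0) by apply Rmax_r.
      specialize (HT s0 (Rmax_l _ _)).
      destruct (Hdep x s0 Sx Hs0) as [E [HE K]].
      set (d := (Rmin 1 (e / 2) / (2 * E))%R).
      assert (Hm : 0 < Rmin 1 (e / 2)) by (apply Rmin_pos; lra).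
      assert (Hdpos : 0 < d) by (apply Rdiv_lt_0_compat; lra).
      assert (HdE : (d * E = Rmin 1 (e / 2) / 2)%R) by (unfold d; field; lra).
      pose proof (Rmin_l 1 (e / 2)). pose proof (Rmin_r 1 (e / 2)).
      assert (Hi : 0 < / (s0 + 1)) by (apply Rinv_0_lt_compat; lra).
      (* For r' < 1 the bound 1 - r' < / (s0 + 1) gives s0 <= tau r'. *)
      exists (Rmin d (/ (s0 + 1))). split; [apply Rmin_pos; auto|].
      intros x' r' Sx' Hr' Hx' Hr1'. unfold unit_interval in Hr'.
      assert (q1 := Rlt_le_trans _ _ _ Hx' (Rmin_l _ _)).
      assert (q2 := Rlt_le_trans _ _ _ Hr1' (Rmin_r _ _)).
      destruct (Rlt_dec r' 1) as [L|L].
      * destruct (Hpsi x' Sx') as (P0' & P1' & _).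
        assert (HxE : Cmod (x' - x) * E <= d * E) by (apply Rmult_le_compat_r; lra).
        specialize (K x' Sx' ltac:(lra) s0 ltac:(lra)).
        pose proof (Cmod_sub_triangle (psi x' s0) (psi x s0) a).
        assert (Hst : s0 <= tau r').
        { unfold tau. rewrite Rabs_left in q2 by lra.
          assert (s0 + 1 <= / (1 - r')); [|lra].
          rewrite <- (Rinv_inv (s0 + 1)). apply Rinv_le_contravar; lra. }
        specialize (St (fun s => psi x' (1 * s + s0)%R) (tau r' - s0)%R ltac:(lra)). cbv beta in St.
        replace (1 * 0 + s0)%R with s0 in St by ring.
        eapply Rle_lt_trans with (Cmod (psi x' s0 - a)); [|lra].
        replace (tau r') with (1 * (tau r' - s0) + s0)%R at 1 by ring. apply St; try lra.
        intros s Hs. eapply rderiv_eq; [apply rderiv_comp_affine, P1'; lra|]. ring.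
      * rewrite Cmod_diag; auto.
Qed.

Lemma contracts_ext (S S' : C -> Prop) (a : C) (H : C -> R -> C) : (forall x, S x <-> S' x) ->
  contracts S a H -> contracts S' a H.
Proof.
  intros E (H1 & H2 & H3). split; [apply E; auto|]. split.
  - intros x Hx. apply E in Hx. destruct (H2 x Hx) as (A1 & A2 & A3). repeat split; auto. intros. apply E; auto.
  - intros x r Hx Hr eps He. apply E in Hx. destruct (H3 x r Hx Hr eps He) as [d [Hd K]]. exists d. split; auto.
    intros x' r' Hx'. apply E in Hx'. auto.
Qed.

Local Close Scope C_scope.
Local Close Scope R_scope.

Theorem theorem2p5 (F : C -> C) (a : C)
  (hF : entire F)
  (hF0 : exists z : C, F z <> RtoC 0)
  (ha : is_center F a) :
  connected (center_basin F a) /\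
  path_connected (center_basin F a) /\
  simply_connected (center_basin F a).
Proof.
  destruct (entire_regular F hF) as [D HF].
  destruct (center_derivative F D HF a ha) as [Ea HDa].
  assert (Hcontr : exists H, contracts (center_basin F a) a H).
  { destruct (Rdichotomy _ _ HDa) as [Hneg|Hpos].
    - destruct (basin_contracts (fun z => (- F z)%C) (fun z => (- D z)%C) a) as [H HH].
      + apply regular_opp, HF.
      + rewrite Ea. ring.
      + simpl. lra.
      + exists H. refine (contracts_ext _ _ a H _ HH). intros x.
        rewrite (center_basin_encircled F D HF a x Ea).
        assert (E : encircled (fun z => (- F z)%C) a x <-> encircled F a x).
        { split; intros Hx; [|apply encircled_opp, Hx].
          apply encircled_opp in Hx.
          replace F with (fun z => (- - F z)%C); [exact Hx|].
          apply functional_extensionality. intros z. ring. }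
        rewrite E. reflexivity.
    - destruct (basin_contracts F D a HF Ea Hpos) as [H HH].
      exists H. refine (contracts_ext _ _ a H _ HH). intros x.
      rewrite (center_basin_encircled F D HF a x Ea). reflexivity. }
  destruct Hcontr as [H HH]. exact (contracts_conclusion _ a H HH).
Qed.
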